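(* Let $n\ge2$ be an integer and let $\alpha,t,q$ be real numbers with $n<\alpha$ and $\frac n\alpha<t<1<q$. Let $t'$ be defined by $\frac1t+\frac1{t'}=1$ and set $$\widetilde\gamma:=\frac{(n-1)-q(\alpha-1)-\frac{n}{t'}q}{(n-1)(1-q)},$$ which satisfies $\widetilde\gamma>1$. Then there is a positive constant $\widetilde{\mathscr C}(n,\alpha,q,t)$ such that $$\|\widetilde E_\alpha f\|_{L^{t'}(\mathbb R^n_+)}\,\|f\|_{L^q(\partial\mathbb R^n_+)}^{\widetilde\gamma-1}\ \ge\ \widetilde{\mathscr C}(n,\alpha,q,t)\,\|f\|_{L^1(\partial\mathbb R^n_+)}^{\widetilde\gamma}$$ for every nonnegative $f\in L^1(\partial\mathbb R^n_+)\cap L^q(\partial\mathbb R^n_+)$ with $f\not\equiv0$. Moreover, the sharp (largest possible) constant $\widetilde{\mathscr C}(n,\alpha,q,t)$ is achieved: there exists a nonnegative, not identically zero, radially symmetric, non-increasing, bounded function on $\partial\mathbb R^n_+$ with compact support for which equality holds with the sharp constant.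
   Context: $\mathbb R^n_+:=\{x=(x',x_n)\in\mathbb R^n:x_n>0\}$, and $\partial\mathbb R^n_+=\{x_n=0\}$ is identified with $\mathbb R^{n-1}$ with Lebesgue measure. For a nonnegative measurable $f$ on $\partial\mathbb R^n_+$, $\widetilde E_\alpha f(x):=\int_{\partial\mathbb R^n_+}|x-y|^{\alpha-n}f(y)\,dy\in[0,\infty]$ for $x=(x',x_n)\in\mathbb R^n_+$, where $|x-y|=(|x'-y|^2+x_n^2)^{1/2}$. For $\Omega=\mathbb R^n_+$ or $\partial\mathbb R^n_+$ and real $p\ne0$, $f\in L^p(\Omega)$ means $\int_\Omega|f|^p<\infty$, and $\|f\|_{L^p(\Omega)}:=\left(\int_\Omega|f|^p\right)^{1/p}$. Note that $0<t<1$ gives $t'<0$; for negative exponents the usual conventions $0^{t'}=\infty$, $\infty^{t'}=0$, $0^{1/t'}=\infty$, $\infty^{1/t'}=0$ are used, so $\|\widetilde E_\alpha f\|_{L^{t'}}\in[0,\infty]$. ''Radially symmetric, non-increasing'' means $f(y)=\varphi(|y|)$ with $\varphi$ non-increasing. *)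

(* Defs.v *)
From HB Require Import structures.
From mathcomp Require Import all_boot all_order all_algebra.
From mathcomp Require Import all_classical all_reals all_analysis.
From mathcomp Require Import measurable_realfun.

Set Implicit Arguments.
Unset Strict Implicit.
Unset Printing Implicit Defensive.

Import Order.TTheory GRing.Theory Num.Theory.
Import numFieldNormedType.Exports.

Local Open Scope classical_set_scope.
Local Open Scope ring_scope.

(* R^n is 'rV[R]_n with the product sigma-algebra, generated by the          *)
(* coordinate maps into R with its Borel sets (as for n.-tuple R).           *)
Section measurable_rV.
Variables (R : realType) (n : nat).

Definition rV_coord (i : 'I_n) (v : 'rV[R]_n) : measurableTypeR R := v ord0 i.

Let rV_set0 : g_sigma_preimage rV_coord set0.
Proof. exact: sigma_algebra0. Qed.

Let rV_setC A : g_sigma_preimage rV_coord A -> g_sigma_preimage rV_coord (~` A).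
Proof. exact: sigma_algebraC. Qed.

Let rV_bigcup (F : (set 'rV[R]_n)^nat) :
  (forall i, g_sigma_preimage rV_coord (F i)) ->
  g_sigma_preimage rV_coord (\bigcup_i (F i)).
Proof. exact: sigma_algebra_bigcup. Qed.

HB.instance Definition _ :=
  @isMeasurable.Build (measure_tuple_display R.-ocitv.-measurable.-sigma)
    'rV[R]_n (g_sigma_preimage rV_coord) rV_set0 rV_setC rV_bigcup.

End measurable_rV.

Section lebesgue_rV.
Variable R : realType.

Definition rV_cons n (p : measurableTypeR R * 'rV[R]_n) : 'rV[R]_n.+1 :=
  row_mx p.1%:M p.2 : 'rV[R]_(1 + n).

Lemma measurable_rV_coord n (i : 'I_n) :
  measurable_fun [set: 'rV[R]_n] (@rV_coord R n i).
Proof.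
move=> _ Y mY; rewrite setTI; apply: sub_sigma_algebra => /=.
rewrite -bigcup_seq/=; exists i => /=; first by rewrite mem_index_enum.
by exists Y => //; rewrite setTI.
Qed.

Lemma measurable_fun_rVP d (T : measurableType d) n (f : T -> 'rV[R]_n) :
  measurable_fun [set: T] f <->
  forall i, measurable_fun [set: T] (@rV_coord R n i \o f).
Proof.
split=> [mf i|mf].
  exact: measurableT_comp (measurable_rV_coord i) mf.
have H : preimage_set_system [set: T] f (g_sigma_preimage (@rV_coord R n))
    `<=` measurable.
  rewrite -g_sigma_preimageE; apply: smallest_sub.
    exact: sigma_algebra_measurable.
  move=> _ [B + <-]; rewrite -bigcup_seq => -[i _ [C mC <-]].
  by rewrite !setTI -comp_preimage -[X in measurable X]setTI; exact: mf.
by move=> _ A mA; apply: H; exists A.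
Qed.

Lemma measurable_rV_cons n : measurable_fun setT (@rV_cons n).
Proof.
apply/measurable_fun_rVP => i.
have [j ->|j ->] := @split_ordP 1 n i.
  rewrite (_ : _ \o _ = fst) //.
  apply/funext => -[a v] /=.
  by rewrite /rV_coord/rV_cons (@row_mxEl _ 1 1 n) mxE (ord1 j).
rewrite (_ : _ \o _ = @rV_coord R n j \o snd).
  exact: measurableT_comp (measurable_rV_coord j) measurable_snd.
by apply/funext => -[a v] /=; rewrite /rV_coord/rV_cons (@row_mxEr _ 1 1 n).
Qed.

Definition rV_uncons n (v : 'rV[R]_n.+1) : measurableTypeR R * 'rV[R]_n :=
  (v ord0 ord0, @rsubmx _ 1 1 n v).

Lemma rV_consK n : cancel (@rV_cons n) (@rV_uncons n).
Proof.
move=> [a v]; rewrite /rV_uncons/rV_cons; congr pair.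
  rewrite (_ : ord0 = @lshift 1 n ord0); last exact/val_inj.
  by rewrite (@row_mxEl _ 1 1 n) mxE.
exact: (@row_mxKr _ 1 1 n).
Qed.

Lemma measurable_rV_uncons n : measurable_fun setT (@rV_uncons n).
Proof.
apply/measurable_fun_pairP; split; first exact: measurable_rV_coord.
apply/measurable_fun_rVP => j.
rewrite (_ : _ \o _ = @rV_coord R n.+1 (@rshift 1 n j)).
  exact: measurable_rV_coord.
by apply/funext => v; rewrite /rV_coord/= mxE.
Qed.

Section lebesgue_rV_step.
Variables (n : nat) (mu : {sigma_finite_measure set 'rV[R]_n -> \bar R}).

Definition lebesgue_rVS : set 'rV[R]_n.+1 -> \bar R :=
  pushforward (@lebesgue_measure R \x mu)%E (@rV_cons n).

Let measurable_rV_consV A :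
  measurable A -> measurable (@rV_cons n @^-1` A).
Proof.
by move=> mA; rewrite -[X in measurable X]setTI; exact: measurable_rV_cons.
Qed.

Let lebesgue_rVS0 : lebesgue_rVS set0 = 0%E.
Proof. by rewrite /lebesgue_rVS/pushforward preimage_set0 measure0. Qed.

Let lebesgue_rVS_ge0 A : (0 <= lebesgue_rVS A)%E.
Proof. by rewrite /lebesgue_rVS/pushforward; exact: measure_ge0. Qed.

Let lebesgue_rVS_sigma_additive : semi_sigma_additive lebesgue_rVS.
Proof.
move=> F mF tF mUF; rewrite /lebesgue_rVS/pushforward preimage_bigcup.
apply: measure_semi_sigma_additive.
- by move=> k; exact: measurable_rV_consV.
- apply/trivIsetP => /= i j _ _ ij; rewrite -preimage_setI.
  by move/trivIsetP : tF => /(_ _ _ _ _ ij) ->//; rewrite preimage_set0.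
- by rewrite -preimage_bigcup; exact: measurable_rV_consV.
Qed.

HB.instance Definition _ := isMeasure.Build _ _ _ lebesgue_rVS
  lebesgue_rVS0 lebesgue_rVS_ge0 lebesgue_rVS_sigma_additive.

Let lebesgue_rVS_sigma_finite : sigma_finite setT lebesgue_rVS.
Proof.
have /sigma_finiteP[F [TF ndF Foo]] := sigma_finiteT (@lebesgue_measure R).
have /sigma_finiteP[G [TG ndG Goo]] := sigma_finiteT mu.
exists (fun k => @rV_uncons n @^-1` (F k `*` G k)).
  apply/seteqP; split=> // v _.
  have /= [i _ Fi] : (\bigcup_k F k) (rV_uncons v).1 by rewrite -TF.
  have /= [j _ Gj] : (\bigcup_k G k) (rV_uncons v).2 by rewrite -TG.
  exists (maxn i j) => //; split=> /=.
  - by move: Fi; exact/subsetPset/ndF/leq_maxl.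
  - by move: Gj; exact/subsetPset/ndG/leq_maxr.
move=> k; have [? ?] := Foo k; have [? ?] := Goo k; split.
  rewrite -[X in measurable X]setTI; apply: measurable_rV_uncons => //.
  exact: measurableX.
rewrite /lebesgue_rVS/pushforward (_ : _ @^-1` _ = F k `*` G k).
  by rewrite product_measure1E// lte_mul_pinfty// ge0_fin_numE.
rewrite -comp_preimage (_ : _ \o _ = id) ?preimage_id//.
exact/funext/rV_consK.
Qed.

HB.instance Definition _ := Measure_isSigmaFinite.Build _ _ _ lebesgue_rVS
  lebesgue_rVS_sigma_finite.

End lebesgue_rV_step.

Fixpoint lebesgue_rV n : {sigma_finite_measure set 'rV[R]_n -> \bar R} :=
  if n is m.+1 then lebesgue_rVS (lebesgue_rV m) else \d_(0 : 'rV[R]_0).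

Lemma lebesgue_rV_box n (A : 'I_n -> set (measurableTypeR R)) :
  (forall i, measurable (A i)) ->
  lebesgue_rV n [set v : 'rV[R]_n | forall i, A i (v ord0 i)] =
  (\prod_(i < n) lebesgue_measure (A i))%E.
Proof.
have mbox k (B : 'I_k -> set (measurableTypeR R)) :
    (forall i, measurable (B i)) ->
    measurable [set v : 'rV[R]_k | forall i, B i (v ord0 i)].
  move=> mB; rewrite (_ : mkset _ = \bigcap_(i in [set: 'I_k])
      (@rV_coord R k i @^-1` B i)); last first.
    by apply/seteqP; split=> v /= vB i => [_|]; exact: vB.
  apply: fin_bigcap_measurable => // i _.
  by rewrite -[X in measurable X]setTI; exact: measurable_rV_coord.
elim: n A => [|n IHn] A mA /=.
  by rewrite big_ord0 diracE mem_set//= => -[].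
rewrite big_ord_recl -IHn// -product_measure1E//; last first.
  exact: (@mbox n (fun i => A (lift ord0 i))).
rewrite /lebesgue_rVS/pushforward; congr (_ _).
apply/seteqP; split=> -[a v] /=.
  move=> H; split=> [|i].
    have := H ord0; rewrite (_ : ord0 = @lshift 1 n ord0); last exact/val_inj.
    by rewrite (@row_mxEl _ 1 1 n) mxE.
  by have := H (lift ord0 i); rewrite -rshift1 (@row_mxEr _ 1 1 n).
move=> [Ha Hv] i; have [j ->|j ->] := @split_ordP 1 n i.
  have -> : @lshift 1 n j = (ord0 : 'I_n.+1) by rewrite (ord1 j); exact/val_inj.
  have -> : (ord0 : 'I_n.+1) = @lshift 1 n ord0 by exact/val_inj.
  rewrite (@row_mxEl _ 1 1 n) mxE; move: Ha; congr (A _ _).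
  exact/val_inj.
by rewrite (@row_mxEr _ 1 1 n) rshift1.
Qed.

End lebesgue_rV.

Section Lp.
Context d (T : measurableType d) (R : realType).
Variables (mu : set T -> \bar R) (D : set T).
Local Open Scope ereal_scope.

(* Measurability for the completion of mu, so that Lebesgue measurable, and  *)
(* not only Borel, functions are covered. The integral of a nonnegative      *)
(* function being a supremum over the simple functions below it, \int[mu] is *)
(* also the integral against the completion of mu for such functions.        *)
Definition completion_measurable_fun (f : T -> \bar R) :=
  exists2 g : T -> \bar R,
    measurable_fun D g & {ae mu, forall x, D x -> f x = g x}.

(* [poweR] is 0 at 0 and +oo at +oo also for negative exponents. *)
Definition epow (x : \bar R) (r : R) : \bar R :=
  if (0 <= r)%R then x `^ r else (x `^ (- r))^-1.

Definition inLp (p : R) (f : T -> \bar R) :=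
  completion_measurable_fun f /\ \int[mu]_(x in D) epow `|f x| p < +oo.

Definition Lpnorm (p : R) (f : T -> \bar R) : \bar R :=
  epow (\int[mu]_(x in D) epow `|f x| p) p^-1.

End Lp.

Section half_space.
Variables (R : realType) (n : nat).

(* R^n is R^(n-1) * R, a point x being the pair (x', x_n). *)
Definition half_space : set ('rV[R]_n.-1 * measurableTypeR R) :=
  [set x | 0 < x.2].

Definition lebesgue_Rn :
    set ('rV[R]_n.-1 * measurableTypeR R) -> \bar R :=
  (lebesgue_rV R n.-1 \x @lebesgue_measure R)%E.

Definition enorm m (v : 'rV[R]_m) : R :=
  Num.sqrt (\sum_(i < m) v ord0 i ^+ 2).

(* the distance from x to the boundary point (y, 0) *)
Definition bdist (x : 'rV[R]_n.-1 * measurableTypeR R) (y : 'rV[R]_n.-1) : R :=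
  Num.sqrt (enorm (x.1 - y) ^+ 2 + x.2 ^+ 2).

Definition extension (alpha : R) (f : 'rV[R]_n.-1 -> R)
    (x : 'rV[R]_n.-1 * measurableTypeR R) : \bar R :=
  (\int[lebesgue_rV R n.-1]_y (bdist x y `^ (alpha - n%:R) * f y)%:E)%E.

Definition norm_half_space (p : R) :=
  Lpnorm lebesgue_Rn half_space p.

Definition norm_boundary (p : R) (f : 'rV[R]_n.-1 -> R) : \bar R :=
  Lpnorm (lebesgue_rV R n.-1) setT p (EFin \o f).

Definition admissible (q : R) (f : 'rV[R]_n.-1 -> R) :=
  [/\ forall y, 0 <= f y,
      inLp (lebesgue_rV R n.-1) setT 1 (EFin \o f),
      inLp (lebesgue_rV R n.-1) setT q (EFin \o f) &
      ~ {ae lebesgue_rV R n.-1, forall y, f y = 0}].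

Definition gammat (alpha q t' : R) : R :=
  ((n%:R - 1) - q * (alpha - 1) - n%:R / t' * q) / ((n%:R - 1) * (1 - q)).

Definition lhs (alpha q t' : R) (f : 'rV[R]_n.-1 -> R) : \bar R :=
  (norm_half_space t' (extension alpha f) *
   epow (norm_boundary q f) (gammat alpha q t' - 1))%E.

Definition rhs (alpha q t' C : R) (f : 'rV[R]_n.-1 -> R) : \bar R :=
  (C%:E * epow (norm_boundary 1 f) (gammat alpha q t'))%E.

Definition valid_constant (alpha q t' C : R) :=
  forall f, admissible q f -> (rhs alpha q t' C f <= lhs alpha q t' f)%E.

Definition sharp_constant (alpha q t' C : R) :=
  valid_constant alpha q t' C /\
  forall C', valid_constant alpha q t' C' -> C' <= C.

Definition radially_nonincreasing (f : 'rV[R]_n.-1 -> R) :=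
  exists2 phi : R -> R,
    forall r s, 0 <= r -> r <= s -> phi s <= phi r &
    forall y, f y = phi (enorm y).

Definition compact_support (f : 'rV[R]_n.-1 -> R) :=
  compact (closure [set y | f y != 0]).

End half_space.

(* Main.v *)
(* Put b = alpha - n and s = - t' > 0. The functional N f = ||E f||_{t'} is homogeneous and, by
   the reverse Hoelder inequality, concave. Through the two-parameter scaling a f(y / l), the sharp
   inequality amounts to maximizing Lam f = ||f||_1 - ||f||_q^q - N f, and truncation at height 1
   does not decrease Lam. As the kernel grows at infinity, N f is large when the mass of f spreads
   out, so a maximizing sequence can be translated to be tight. Concavity also shows that Lam does
   not decrease when f is replaced by Phi (grad f), where grad f is the supergradient of N at f and
   Phi t maximizes a (1 - t) - a^q over a >= 0. The potentials grad f_j are equicontinuous and grow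
   like |y|^b, uniformly in j, so Arzela-Ascoli provides a maximizer, bounded with compact support.
   Polarization with respect to a hyperplane decreases N strictly unless it leaves f, up to a
   reflection, unchanged; hence the maximizer is radially non-increasing about its barycenter. *)
Require Import Defs.
From HB Require Import structures.
From mathcomp Require Import all_boot all_order all_algebra.
From mathcomp Require Import all_classical all_reals all_analysis.
From mathcomp Require Import measurable_realfun ring lra.

Set Implicit Arguments.
Unset Strict Implicit.
Unset Printing Implicit Defensive.

Import Order.TTheory GRing.Theory Num.Theory.
Import numFieldNormedType.Exports.

Local Open Scope classical_set_scope.
Local Open Scope ring_scope.

(** * Integrals of nonnegative functions *)

(** In the lemmas [n] is the dimension of the boundary, so the half-space has dimension [n.+1], and
    the hypothesis on [t] becomes [n.+1 < b * s]. This is the condition for [(1 + |x|) ^ (- b s)] to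
    be integrable over the half-space, and also the positivity of the degree [kap] by which dilation
    raises [N] above the mass. The obstacle to existence is that bounds on a maximizing sequence
    [f_j] give no pointwise convergence. The potentials do cluster, locally uniformly, at some [G0],
    and [g = Phi G0] is compared with [f_j] directly: [N g] is at most the integral of [g grad f_j],
    [N f_j] equals that of [f_j grad f_j], and [g y] nearly maximizes [a (1 - grad f_j y) - a ^ q],
    so [Lam f_j <= Lam g + o(1)]. As [Phi] vanishes from 1 on and [grad f_j >= 1] off a fixed ball,
    the comparison is confined to that ball. In the symmetry argument a hyperplane leaves two
    alternatives, [f] or its reflection; the barycenter decides between them, for it lies on the
    favoured side whenever the first one holds. *)

Section nonnegative_integrals.
Local Open Scope ereal_scope.
Context d (T : measurableType d) (R : realType).
Implicit Types (mu : {measure set T -> \bar R}) (D : set T).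
Import HBNNSimple.

(* No measurability is required: the integral is a supremum over the simple functions below. *)
Lemma nn_le_integral mu D (f g : T -> \bar R) :
  (forall x, D x -> 0 <= f x) -> (forall x, D x -> f x <= g x) ->
  \int[mu]_(x in D) f x <= \int[mu]_(x in D) g x.
Proof.
move=> f0 fg.
have g0 x : D x -> 0 <= g x by move=> Dx; rewrite (le_trans (f0 _ Dx))// fg.
rewrite (ge0_integralE _ f0) (ge0_integralE _ g0).
apply: ereal_sup_le => _ [h /= hf <-]; exists h => //= x.
apply: le_trans (hf x) _; rewrite !patchE; case: ifPn => // /set_mem; exact: fg.
Qed.

(** The null set is removed from a simple function below [f], which is measurable, and what remains
    lies below [g]; arbitrary nonnegative functions are thus allowed. *)
Lemma nn_ae_le_integral mu D (f g : T -> \bar R) :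
  measurable D ->
  (forall x, D x -> 0 <= f x) -> (forall x, D x -> 0 <= g x) ->
  {ae mu, forall x, D x -> f x <= g x} ->
  \int[mu]_(x in D) f x <= \int[mu]_(x in D) g x.
Proof.
move=> mD f0 g0 [N [mN muN fgN]].
rewrite (ge0_integralE _ f0).
apply: ge_ereal_sup => _ [h /= hf <-].
have h0 x : 0 <= (h x)%:E by rewrite lee_fin.
have mh : measurable_fun setT (EFin \o h) by exact/measurable_EFinP.
rewrite -integralT_nnsfun (ge0_negligible_integral mN _ _ _ muN)//.
apply: (@le_trans _ _ (\int[mu]_(x in setT `\` N) (g \_ D) x)).
  apply: nn_le_integral => // x [_ Nx].
  apply: (le_trans (hf x)); rewrite !patchE; case: ifPn => // /set_mem Dx.
  apply: contrapT => /negP fgx; apply: Nx; apply: fgN => /= /(_ Dx).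
  exact/negP.
rewrite (integral_mkcond D) (integral_mkcond (setT `\` N)).
apply: nn_le_integral => x _; rewrite !patchE.
  by case: ifPn => // _; case: ifPn => // /set_mem /g0.
by case: ifPn => // _; case: ifPn => // /set_mem /g0.
Qed.

Lemma nn_ae_eq_integral mu D (f g : T -> \bar R) :
  measurable D ->
  (forall x, D x -> 0 <= f x) -> (forall x, D x -> 0 <= g x) ->
  {ae mu, forall x, D x -> f x = g x} ->
  \int[mu]_(x in D) f x = \int[mu]_(x in D) g x.
Proof.
move=> mD f0 g0 fg; apply/eqP; rewrite eq_le; apply/andP; split;
  apply: nn_ae_le_integral => //; apply: filterS fg => x /[apply] -> //.
Qed.

Lemma integral_eq0_ae mu D (f : T -> \bar R) :
  measurable D -> measurable_fun D f -> (forall x, D x -> 0 <= f x) ->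
  \int[mu]_(x in D) f x = 0 -> {ae mu, forall x, D x -> f x = 0}.
Proof.
move=> mD mf f0 If0; apply/(ae_eq_integral_abs mu mD mf).
by rewrite -[RHS]If0; apply: eq_integral => x /set_mem Dx; rewrite gee0_abs// f0.
Qed.

End nonnegative_integrals.

Section tonelli_restricted.
Local Open Scope ereal_scope.
Context d1 d2 (T1 : measurableType d1) (T2 : measurableType d2) (R : realType).
Variables (m1 : {sigma_finite_measure set T1 -> \bar R})
          (m2 : {sigma_finite_measure set T2 -> \bar R}) (D : set T1).
Hypothesis mD : measurable D.

Lemma tonelli_in (F : T1 * T2 -> \bar R) :
  measurable_fun setT F -> (forall z, 0 <= F z) ->
  \int[m1]_(x in D) \int[m2]_y F (x, y) = \int[m2]_y \int[m1]_(x in D) F (x, y).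
Proof.
move=> mF F0; rewrite integral_mkcond.
pose F' (z : T1 * T2) := (F \_ (D `*` setT)) z.
have mF' : measurable_fun setT F'.
  apply/(measurable_restrictT _ _).1 => //; first exact: measurableX.
  exact: measurable_funS mF.
transitivity (\int[m1]_x \int[m2]_y F' (x, y)).
  apply: eq_integral => x _; rewrite patchE; case: ifPn => xD.
    by apply: eq_integral => y _; rewrite /F' patchE in_setX xD in_setT.
  apply/esym/integral0_eq => y _.
  by rewrite /F' patchE in_setX (negbTE xD).
rewrite fubini_tonelli//; last first.
  by move=> z; rewrite /F' patchE; case: ifP.
apply: eq_integral => y _; rewrite [RHS]integral_mkcond.
by apply: eq_integral => x _; rewrite /F' !patchE in_setX in_setT andbT.
Qed.

Lemma measurable_integral_in (F : T1 * T2 -> \bar R) :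
  measurable_fun setT F -> (forall z, 0 <= F z) ->
  measurable_fun setT (fun y => \int[m1]_(x in D) F (x, y)).
Proof.
move=> mF F0.
pose F' (z : T1 * T2) := (F \_ (D `*` setT)) z.
have mF' : measurable_fun setT F'.
  apply/(measurable_restrictT _ _).1 => //; first exact: measurableX.
  exact: measurable_funS mF.
have -> : (fun y => \int[m1]_(x in D) F (x, y)) = fubini_G m1 F'.
  apply/funext => y; rewrite /fubini_G [LHS]integral_mkcond.
  by apply: eq_integral => x _; rewrite /F' !patchE in_setX in_setT andbT.
apply: measurable_fun_fubini_tonelli_G => // z; rewrite /F' patchE.
by case: ifP.
Qed.

End tonelli_restricted.

(** * Translation invariance of Lebesgue measure on row vectors *)

Section translation.
Local Open Scope ereal_scope.
Context (R : realType).

Lemma nn_integral_translate1 (f : measurableTypeR R -> \bar R) (a : R) :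
  measurable_fun setT f -> (forall x, 0 <= f x) ->
  \int[lebesgue_measure]_x f (x + a)%R = \int[lebesgue_measure]_x f x.
Proof.
move=> mf f0; pose phi (x : measurableTypeR R) : measurableTypeR R := (x + a)%R.
have mphi : measurable_fun setT phi by exact: measurable_funD.
rewrite -[LHS](@ge0_integral_pushforward _ _ _ _ _ phi mphi lebesgue_measure setT f)//.
apply: eq_measure_integral => A mA _.
apply/esym/lebesgue_measure_unique => //= _ [[c e]] _ <-.
rewrite /pushforward.
have -> : phi @^-1` `]c, e] = `](c - a)%R, (e - a)%R]%classic.
  by apply/seteqP; split=> x /=; rewrite !in_itv/= ltrBlDr lerBrDr.
rewrite !lebesgue_measure_itv/= !lte_fin.
have -> : (c - a < e - a)%R = (c < e)%R by lra.
by case: ifP => // _; rewrite -!EFinD; congr EFin; lra.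
Qed.

Lemma nn_integral_rVS n (f : 'rV[R]_n.+1 -> \bar R) :
  measurable_fun setT f -> (forall v, 0 <= f v) ->
  \int[lebesgue_rV R n.+1]_v f v =
  \int[lebesgue_measure]_a \int[lebesgue_rV R n]_v f (rV_cons (a, v)).
Proof.
move=> mf f0.
have mfc : measurable_fun setT (f \o @rV_cons R n).
  exact: measurableT_comp mf (@measurable_rV_cons R n).
rewrite -(fubini_tonelli1 (f \o @rV_cons R n))//=.
by rewrite [LHS](@ge0_integral_pushforward _ _ _ _ _ _ (@measurable_rV_cons R n) _ setT f).
Qed.

Lemma measurable_rV_add n (w : 'rV[R]_n) : measurable_fun setT (fun v : 'rV[R]_n => v + w)%R.
Proof.
apply/measurable_fun_rVP => i.
rewrite (_ : _ \o _ = fun v => (rV_coord i v + rV_coord i w)%R); last first.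
  by apply/funext => v /=; rewrite /rV_coord mxE.
by apply: measurable_funD => //; exact: measurable_rV_coord.
Qed.

Lemma nn_integral_translate n (f : 'rV[R]_n -> \bar R) (w : 'rV[R]_n) :
  measurable_fun setT f -> (forall v, 0 <= f v) ->
  \int[lebesgue_rV R n]_v f (v + w)%R = \int[lebesgue_rV R n]_v f v.
Proof.
elim: n f w => [|n IH] f w mf f0.
  by apply: eq_integral => v _; congr f; apply/rowP => -[].
have mfw : measurable_fun setT (fun v : 'rV[R]_n.+1 => f (v + w)%R).
  exact: measurableT_comp mf (measurable_rV_add w).
rewrite (nn_integral_rVS mfw (fun v => f0 _)) (nn_integral_rVS mf f0).
have mfc : measurable_fun setT (f \o @rV_cons R n).
  exact: measurableT_comp mf (@measurable_rV_cons R n).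
pose b := (rV_uncons w).1; pose u := (rV_uncons w).2.
rewrite -[RHS](nn_integral_translate1 (f := fun a => \int[lebesgue_rV R n]_v f (rV_cons (a, v))) b); last 2 first.
- exact: (measurable_fun_fubini_tonelli_F (m2 := lebesgue_rV R n)
    (f \o @rV_cons R n) mfc (fun z => f0 _)).
- by move=> x; exact: integral_ge0.
apply: eq_integral => a _.
rewrite -[RHS](IH (fun v => f (rV_cons ((a + b)%R, v))) u).
- apply: eq_integral => v _; congr f.
  rewrite /u/b/rV_uncons/rV_cons/=.
  apply/rowP => i; have [j ->|j ->] := @split_ordP 1 n i.
    rewrite mxE !(@row_mxEl _ 1 1 n) !mxE (ord1 j) !mulr1n.
    by congr (_ + w _ _)%R; exact/val_inj.
  by rewrite mxE !(@row_mxEr _ 1 1 n) !mxE.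
- have : measurable_fun setT (f \o @rV_cons R n \o (pair (a + b)%R)).
    by apply: measurableT_comp mfc _; exact: pair1_measurable.
  by [].
- by [].
Qed.

End translation.

(** * Euclidean geometry of row vectors *)

Lemma measurable_fun_powRl d (T : measurableType d) (R : realType) (D : set T)
    (f : T -> R) p :
  measurable_fun D f -> measurable_fun D (fun x => f x `^ p).
Proof. by move=> mf; exact: measurableT_comp (measurable_powR p) mf. Qed.

Section euclidean.
Context (R : realType) (n : nat).
Implicit Types u v w e : 'rV[R]_n.

Definition dot u v : R := \sum_(i < n) u ord0 i * v ord0 i.

Lemma dotC u v : dot u v = dot v u.
Proof. by apply: eq_bigr => i _; rewrite mulrC. Qed.

Lemma dotDl u v w : dot (u + v) w = dot u w + dot v w.
Proof.
by rewrite /dot -big_split; apply: eq_bigr => i _; rewrite mxE mulrDl.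
Qed.

Lemma dotZl a u w : dot (a *: u) w = a * dot u w.
Proof.
by rewrite /dot mulr_sumr; apply: eq_bigr => i _; rewrite mxE mulrA.
Qed.

Lemma dot0l u : dot 0 u = 0.
Proof. by rewrite -(scale0r 0) dotZl mul0r. Qed.

Lemma dotNl u w : dot (- u) w = - dot u w.
Proof. by rewrite -scaleN1r dotZl mulN1r. Qed.

Lemma dotDr u v w : dot w (u + v) = dot w u + dot w v.
Proof. by rewrite dotC dotDl !(dotC w). Qed.

Lemma dotZr a u w : dot w (a *: u) = a * dot w u.
Proof. by rewrite dotC dotZl (dotC w). Qed.

Lemma dotNr u w : dot w (- u) = - dot w u.
Proof. by rewrite dotC dotNl (dotC w). Qed.

Definition dotE := (dotDl, dotDr, dotNl, dotNr, dotZl, dotZr).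

Lemma dot_ge0 u : 0 <= dot u u.
Proof. by apply: sumr_ge0 => i _; rewrite -expr2 sqr_ge0. Qed.

Lemma dot_gt0 u : u != 0 -> 0 < dot u u.
Proof.
move=> u0; rewrite lt_neqAle dot_ge0 andbT eq_sym; apply: contra u0.
rewrite /dot psumr_eq0 => [/allP H|i _]; last by rewrite -expr2 sqr_ge0.
apply/eqP/rowP => i; rewrite mxE; apply/eqP.
by have := H i (mem_index_enum _); rewrite mulf_eq0 orbb.
Qed.

Lemma enormE u : enorm u = Num.sqrt (dot u u).
Proof. by congr Num.sqrt; apply: eq_bigr => i _; rewrite expr2. Qed.

Lemma sqr_enorm u : enorm u ^+ 2 = dot u u.
Proof. by rewrite enormE sqr_sqrtr// dot_ge0. Qed.

Lemma enorm_ge0 u : 0 <= enorm u.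
Proof. exact: sqrtr_ge0. Qed.

Lemma enorm_gt0 u : u != 0 -> 0 < enorm u.
Proof. by move=> /dot_gt0; rewrite enormE sqrtr_gt0. Qed.

Lemma enorm0 : enorm (0 : 'rV[R]_n) = 0.
Proof. by rewrite enormE -(scale0r 0) dotZl mul0r sqrtr0. Qed.

Lemma enormN u : enorm (- u) = enorm u.
Proof. by rewrite !enormE !dotE opprK. Qed.

Lemma enormZ a u : enorm (a *: u) = `|a| * enorm u.
Proof.
by rewrite !enormE dotZl dotZr mulrA -expr2 sqrtrM ?sqr_ge0// sqrtr_sqr.
Qed.

Lemma dot_le_enorm u v : dot u v <= enorm u * enorm v.
Proof.
have [->|u0] := eqVneq u 0; first by rewrite enorm0 -(scale0r 0) dotZl !mul0r.
have [->|v0] := eqVneq v 0.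
  by rewrite enorm0 -(scale0r 0) dotZr mul0r mulr0.
have pu := enorm_gt0 u0; have pv := enorm_gt0 v0.
have := dot_ge0 (enorm v *: u - enorm u *: v).
rewrite !dotE -!sqr_enorm (dotC v u).
move=> H; have : 0 <= 2 * (enorm u * enorm v) * (enorm u * enorm v - dot u v).
  by apply: le_trans H _; rewrite le_eqVlt; apply/orP; left; apply/eqP; ring.
by rewrite pmulr_rge0 ?mulr_gt0// subr_ge0.
Qed.

Lemma ler_enormD u v : enorm (u + v) <= enorm u + enorm v.
Proof.
rewrite -(@ler_pXn2r _ 2) ?nnegrE ?addr_ge0 ?enorm_ge0//.
rewrite sqr_enorm !dotE -!sqr_enorm (dotC v u).
have := dot_le_enorm u v; nra.
Qed.

Lemma coord_le_enorm u i : `|u ord0 i| <= enorm u.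
Proof.
rewrite -sqrtr_sqr enormE ler_wsqrtr// /dot (bigD1 i)//= expr2 lerDl.
by apply: sumr_ge0 => j _; rewrite -expr2 sqr_ge0.
Qed.

Lemma enorm_le_coord u r : 0 <= r -> (forall i, `|u ord0 i| <= r) ->
  enorm u <= n%:R * r.
Proof.
move=> r0 ur; rewrite -(@ler_pXn2r _ 2) ?nnegrE ?mulr_ge0 ?enorm_ge0//.
rewrite sqr_enorm.
have : dot u u <= \sum_(i < n) r ^+ 2.
  apply: ler_sum => i _; rewrite -expr2 -real_normK ?num_real//.
  by rewrite ler_pXn2r ?nnegrE.
rewrite big_const_ord iter_addr addr0 => /le_trans; apply.
rewrite exprMn -[_ *+ n]mulr_natl ler_wpM2r ?sqr_ge0// -natrX ler_nat.
by case: (n) => // k; rewrite leq_pmulr.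
Qed.

End euclidean.

Section cube.
Context (R : realType) (n : nat).
Local Notation mu := (lebesgue_rV R n).

Definition cube (r : R) : set 'rV[R]_n := [set v | forall i, v ord0 i \in `[-r, r]].

Lemma cubeE r : cube r = \bigcap_(i in [set: 'I_n]) (@rV_coord R n i @^-1` `[-r, r]).
Proof. by apply/seteqP; split=> v vB i; have := vB i; rewrite /= /rV_coord; [|apply]. Qed.

Lemma measurable_cube r : measurable (cube r).
Proof.
rewrite cubeE; apply: fin_bigcap_measurable => // i _.
rewrite -[X in measurable X]setTI; apply: measurable_rV_coord => //.
Qed.

Lemma lebesgue_cube r : 0 <= r -> mu (cube r) = ((2 * r) ^+ n)%:E.
Proof.
move=> r0; have := @lebesgue_rV_box R n (fun=> `[-r, r]%classic) (fun=> measurable_itv _).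
rewrite (_ : mkset _ = cube r)// => ->.
under eq_bigr do rewrite lebesgue_measure_itv/=.
have -> : (if (- r)%:E < r%:E then r%:E - (- r)%:E else 0)%E = (2 * r)%:E.
  case: ltP; first by move=> _; rewrite -EFinD; congr EFin; lra.
  by rewrite lee_fin => ?; congr EFin; lra.
elim: n => [|k IH]; first by rewrite big_ord0 expr0.
by rewrite big_ord_recl IH exprS EFinM.
Qed.

Lemma cube_enorm r v : 0 <= r -> cube r v -> enorm v <= n%:R * r.
Proof.
by move=> r0 vr; apply: enorm_le_coord => // i; have := vr i; rewrite in_itv/= ler_norml.
Qed.

Lemma enorm_cube r v : enorm v <= r -> cube r v.
Proof.
by move=> vr i; rewrite in_itv/= -ler_norml (le_trans (coord_le_enorm _ _)).
Qed.

Lemma measurable_enorm : measurable_fun setT (@enorm R n : 'rV[R]_n -> R).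
Proof.
rewrite (_ : @enorm R n = fun v => (\sum_(i < n) rV_coord i v ^+ 2) `^ 2^-1); last first.
  by apply/funext => v; rewrite powR12_sqrt// sumr_ge0// => i _; rewrite sqr_ge0.
apply: measurable_fun_powRl; apply: measurable_sum => i.
by apply: measurable_funX; exact: measurable_rV_coord.
Qed.

End cube.

(** * Linear changes of variables without determinants *)

Section linear_change.
Local Open Scope ereal_scope.
Context (R : realType) (n : nat).
Local Notation mu := (lebesgue_rV R n).

Lemma measurable_rV_opp : measurable_fun setT (fun v : 'rV[R]_n => - v)%R.
Proof.
apply/measurable_fun_rVP => i.
rewrite (_ : _ \o _ = fun v => (- rV_coord i v)%R); last first.
  by apply/funext => v /=; rewrite /rV_coord mxE.
by apply: measurableT_comp => //; exact: measurable_rV_coord.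
Qed.

Lemma measurable_rV_addfun d (T : measurableType d) (f g : T -> 'rV[R]_n) :
  measurable_fun setT f -> measurable_fun setT g ->
  measurable_fun setT (fun x => f x + g x)%R.
Proof.
move=> /measurable_fun_rVP mf /measurable_fun_rVP mg; apply/measurable_fun_rVP => i.
rewrite (_ : _ \o _ = fun v => (rV_coord i (f v) + rV_coord i (g v))%R); last first.
  by apply/funext => v /=; rewrite /rV_coord mxE.
exact: (measurable_funD (mf i) (mg i)).
Qed.

Lemma measurable_rV_scalefun d (T : measurableType d) (a : T -> R) (f : T -> 'rV[R]_n) :
  measurable_fun setT a -> measurable_fun setT f ->
  measurable_fun setT (fun x => a x *: f x)%R.
Proof.
move=> ma /measurable_fun_rVP mf; apply/measurable_fun_rVP => i.
rewrite (_ : _ \o _ = fun v => (a v * rV_coord i (f v))%R); last first.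
  by apply/funext => v /=; rewrite /rV_coord mxE.
exact: (measurable_funM ma (mf i)).
Qed.

(* Both sides equal [\int\int f(x) g(L y) dy dx], by Tonelli and translation invariance alone. *)
Lemma integral_linear_change (L L' : 'rV[R]_n -> 'rV[R]_n) (f g : 'rV[R]_n -> \bar R) :
  {morph L : x y / (x + y)%R} -> cancel L' L -> measurable_fun setT L ->
  measurable_fun setT f -> (forall v, 0 <= f v) -> (forall v, f (- v)%R = f v) ->
  measurable_fun setT g -> (forall v, 0 <= g v) ->
  \int[mu]_v f v * \int[mu]_v g (L v) = \int[mu]_v f (L v) * \int[mu]_v g v.
Proof.
move=> LD LK mL mf f0 fN mg g0.
have L0 : L 0%R = 0%R by have /(congr1 (fun z => z - L 0)%R) := LD 0%R 0%R;
  rewrite addr0 subrr addrK => <-.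
have LN x : L (- x)%R = (- L x)%R.
  by apply/eqP; rewrite -addr_eq0 -LD addNr L0.
have mgL : measurable_fun setT (fun v => g (L v)) by exact: measurableT_comp mg mL.
have mfL : measurable_fun setT (fun v => f (L v)) by exact: measurableT_comp mf mL.
have m2 : measurable_fun setT (fun z : 'rV[R]_n * 'rV[R]_n => L z.2).
  exact: measurableT_comp mL measurable_snd.
transitivity (\int[mu]_x \int[mu]_y (f x * g (L y + x)%R)).
  rewrite -ge0_integralZr//; last exact: integral_ge0.
  apply: eq_integral => x _; rewrite ge0_integralZl//; last first.
  - have : measurable_fun setT (fun y => g (L y + x)%R) => //.
    by apply: measurableT_comp mg _; apply: measurable_rV_addfun.
  congr (_ * _).
  rewrite -(nn_integral_translate (f := fun v => g (L v)) (L' x))//.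
  by apply: eq_integral => y _; rewrite LD LK.
rewrite (fubini_tonelli (fun z : 'rV[R]_n * 'rV[R]_n => f z.1 * g (L z.2 + z.1)%R))/=; last 2 first.
- apply: emeasurable_funM; first exact: measurableT_comp mf measurable_fst.
  by apply: measurableT_comp mg _; apply: measurable_rV_addfun.
- by move=> z; rewrite mule_ge0.
transitivity (\int[mu]_y \int[mu]_x (f (x - L y)%R * g x)).
  apply: eq_integral => y _.
  rewrite -(nn_integral_translate (f := fun x => f (x - L y)%R * g x) (L y)); last 2 first.
  - apply: emeasurable_funM => //.
    by apply: measurableT_comp mf _; apply: measurable_rV_addfun.
  - by move=> v; rewrite mule_ge0.
  by apply: eq_integral => x _; rewrite addrK addrC.
rewrite -(fubini_tonelli (fun z : 'rV[R]_n * 'rV[R]_n => f (z.1 - L z.2)%R * g z.1))/=; last 2 first.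
- apply: emeasurable_funM; last exact: measurableT_comp mg measurable_fst.
  apply: measurableT_comp mf _; apply: measurable_rV_addfun => //.
  exact: measurableT_comp measurable_rV_opp m2.
- by move=> z; rewrite mule_ge0.
rewrite muleC -ge0_integralZr//; last exact: integral_ge0.
apply: eq_integral => x _; rewrite ge0_integralZr//; last first.
  have : measurable_fun setT (fun y => f (x - L y)%R) => //.
  apply: measurableT_comp mf _; apply: measurable_rV_addfun => //.
  exact: measurableT_comp measurable_rV_opp mL.
rewrite muleC; congr (_ * _).
rewrite -(nn_integral_translate (f := fun y => f (L y)) (- L' x)%R)//.
by apply: eq_integral => y _; rewrite LD LN LK -fN opprB.
Qed.

End linear_change.

(** * Isometries, dilations and reflections *)

Lemma eq_indic (T T' : Type) (R : pzRingType) (A : set T) (B : set T') x y :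
  (A x <-> B y) -> \1_A x = \1_B y :> R.
Proof. by move=> AB; rewrite !indicE; congr (nat_of_bool _)%:R; apply/idP/idP; rewrite !inE AB. Qed.

Lemma emul2l_inj (R : realDomainType) (c x y : \bar R) :
  c \is a fin_num -> (0 < c -> c * x = c * y -> x = y)%E.
Proof.
move=> cfin c0 cxy; apply/eqP; rewrite eq_le; apply/andP; split;
by rewrite -(lee_pmul2l cfin c0) cxy.
Qed.

Section isometries_and_dilations.
Local Open Scope ereal_scope.
Context (R : realType) (n : nat).
Local Notation mu := (lebesgue_rV R n).

Let indic_integral (A : set 'rV[R]_n) : measurable A ->
  \int[mu]_v (\1_A v)%:E = mu A.
Proof. by move=> mA; rewrite integral_indic// setIT. Qed.

Let measurable_ball1 : measurable [set v : 'rV[R]_n | (enorm v <= 1)%R].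
Proof.
rewrite (_ : mkset _ = setT `&` @enorm R n @^-1` `]-oo, 1%R]); last first.
  by rewrite setTI; apply/seteqP; split=> v /=; rewrite in_itv.
exact: measurable_enorm.
Qed.

(** The test function in [integral_linear_change] is the indicator of the unit ball, which [L]
    preserves. The ball has finite positive measure, being between two cubes, so its measure
    cancels. *)
Lemma integral_isometry (L L' : 'rV[R]_n -> 'rV[R]_n) (g : 'rV[R]_n -> \bar R) :
  {morph L : x y / (x + y)%R} -> cancel L' L -> measurable_fun setT L ->
  (forall v, enorm (L v) = enorm v) ->
  measurable_fun setT g -> (forall v, 0 <= g v) ->
  \int[mu]_v g (L v) = \int[mu]_v g v.
Proof.
move=> LD LK mL Lnorm mg g0.
pose B : set 'rV[R]_n := [set v : 'rV[R]_n | (enorm v <= 1)%R].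
have mB : measurable B := measurable_ball1.
pose f (v : 'rV[R]_n) : \bar R := (\1_B v)%:E.
have fE v w : enorm v = enorm w -> f v = f w.
  by move=> vw; rewrite /f; congr EFin; apply: eq_indic; rewrite /B/= vw.
have := @integral_linear_change R n L L' f g LD LK mL.
have -> : \int[mu]_v f (L v) = \int[mu]_v f v.
  by apply: eq_integral => v _; exact: fE.
rewrite {1 2}/f indic_integral//.
have Boo : mu B < +oo.
  have : mu B <= mu (@cube R n 1%R).
    by apply: le_measure; rewrite ?inE//; [exact: measurable_cube|move=> v /enorm_cube].
  by rewrite lebesgue_cube// => /le_lt_trans; apply; rewrite ltry.
have B0 : 0 < mu B.
  have r0 : (0 < (n.+1%:R : R)^-1)%R by rewrite invr_gt0.
  have : mu (@cube R n n.+1%:R^-1) <= mu B.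
    apply: le_measure; rewrite ?inE//; first exact: measurable_cube.
    move=> v /(cube_enorm (ltW r0)); rewrite /B/= => /le_trans; apply.
    by rewrite ler_pdivrMr// mul1r ler_nat.
  rewrite lebesgue_cube ?(ltW r0)//; apply: lt_le_trans.
  by rewrite lte_fin exprn_gt0// mulr_gt0.
have Bfin : mu B \is a fin_num by rewrite ge0_fin_numE// ltW.
move=> /(_ _ _ _ mg g0) => H.
have BgL : mu B * \int[mu]_v g (L v) = mu B * \int[mu]_v g v.
  apply: H => //.
  - exact/measurable_EFinP/measurable_indic.
  - by move=> v; apply: fE; rewrite enormN.
exact: emul2l_inj Bfin B0 BgL.
Qed.

(** The test function is the indicator of a cube: its preimage under the dilation is again a cube,
    so both measures are explicit. *)
Lemma integral_dilation (a : R) (g : 'rV[R]_n -> \bar R) : (0 < a)%R ->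
  measurable_fun setT g -> (forall v, 0 <= g v) ->
  \int[mu]_v g (a *: v)%R = (a ^- n)%:E * \int[mu]_v g v.
Proof.
move=> a0 mg g0.
pose f (v : 'rV[R]_n) : \bar R := (\1_(@cube R n 1%R) v)%:E.
have mC (r : R) := @measurable_cube R n r.
have fE v : f (a *: v)%R = (\1_(@cube R n a^-1%R) v)%:E.
  rewrite /f; congr EFin; apply: eq_indic; split=> H i; have := H i;
  by rewrite mxE !in_itv/= -!ler_norml normrM (gtr0_norm a0) -[(a^-1)%R]mul1r
    ler_pdivlMr// mulrC.
have := @integral_linear_change R n (fun v => a *: v)%R (fun v => a^-1 *: v)%R f g.
have -> : \int[mu]_v f (a *: v)%R = \int[mu]_v (\1_(@cube R n a^-1%R) v)%:E.
  by apply: eq_integral => v _; exact: fE.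
rewrite {1 2}/f !indic_integral// !lebesgue_cube ?invr_ge0 ?(ltW a0)//.
rewrite mulr1 => H.
have : (2 ^+ n)%:E * \int[mu]_v g (a *: v)%R =
    ((2 / a) ^+ n)%:E * \int[mu]_v g v.
  apply: H => //.
  - by move=> x y; rewrite scalerDr.
  - by move=> x; rewrite scalerA divff ?gt_eqF// scale1r.
  - exact: measurable_rV_scalefun.
  - exact/measurable_EFinP/measurable_indic.
  - move=> v; rewrite /f; congr EFin; apply: eq_indic; split=> H' i; have := H' i;
    by rewrite mxE !in_itv/= -!ler_norml normrN.
rewrite exprMn EFinM exprVn -muleA => H2.
by apply: emul2l_inj H2 => //; rewrite lte_fin exprn_gt0.
Qed.

End isometries_and_dilations.

Section reflection.
Context (R : realType) (n : nat) (w e : 'rV[R]_n).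
Hypothesis e0 : e != 0.
Local Notation mu := (lebesgue_rV R n).
Implicit Types x y z : 'rV[R]_n.

(** Signed distance to the hyperplane through [w] with normal [e], times the length of [e], which is
    not normalized. *)
Definition side y := dot (y - w) e.
Definition refl y := y - (2 * side y / dot e e) *: e.

Let ee0 : dot e e != 0. Proof. by rewrite gt_eqF ?dot_gt0. Qed.

Lemma side_refl y : side (refl y) = - side y.
Proof. by rewrite /side/refl !dotE /side !dotE; field. Qed.

Lemma reflK : involutive refl.
Proof.
move=> y; rewrite {1}/refl side_refl {1}/refl -addrA -opprD -scalerDl.
by rewrite mulrN mulNr subrr scale0r subr0.
Qed.

Lemma enorm_reflB x y : enorm (refl x - refl y) = enorm (x - y).
Proof.
rewrite !enormE; congr Num.sqrt; rewrite /refl /side !dotE !(dotC e) (dotC y x).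
by field.
Qed.

(** For [x] and [y] strictly on one side, reflecting [y] increases the distance to [x]; the
    monotonicity of the kernel used in polarization comes from here. *)
Lemma sqr_dist_refl x y :
  enorm (x - refl y) ^+ 2 = enorm (x - y) ^+ 2 + 4 * side x * side y / dot e e.
Proof.
rewrite !sqr_enorm /refl /side !dotE !(dotC e) (dotC y x).
by field.
Qed.

Lemma measurable_side : measurable_fun setT side.
Proof.
apply: measurable_sum => i; apply: measurable_funM => //.
rewrite (_ : (fun _ => _) = fun y => rV_coord i y - w ord0 i); last first.
  by apply/funext => y; rewrite /rV_coord !mxE.
by apply: measurable_funB => //; exact: measurable_rV_coord.
Qed.

Lemma measurable_refl : measurable_fun setT refl.
Proof.
have -> : refl = fun y => y + (- (2 * side y / dot e e)) *: e.
  by apply/funext => y; rewrite /refl scaleNr.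
apply: measurable_rV_addfun => //; apply: measurable_rV_scalefun => //.
apply: measurableT_comp => //; apply: measurable_funM => //.
by apply: measurable_funM => //; exact: measurable_side.
Qed.

(** The reflection is affine: its linear part [L] is an isometric involution, and translation by
    [refl 0] accounts for the rest. *)
Lemma integral_refl (g : 'rV[R]_n -> \bar R) :
  measurable_fun setT g -> (forall v, 0 <= g v)%E ->
  (\int[mu]_v g (refl v) = \int[mu]_v g v)%E.
Proof.
move=> mg g0; pose L y := refl y - refl 0.
have LE y : L y = y - (2 * dot y e / dot e e) *: e.
  by apply/rowP => i; rewrite /L /refl /side !mxE sub0r !dotE dot0l; field.
have LD : {morph L : x y / x + y}.
  by move=> x y; apply/rowP => i; rewrite !LE !mxE dotDl; field.
have LK : cancel L L.
  by move=> y; apply/rowP => i; rewrite !LE !mxE !dotE; field.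
have mL : measurable_fun setT L.
  apply: measurable_rV_addfun => //; exact: measurable_refl.
rewrite -(nn_integral_translate (refl 0) mg g0).
rewrite -(integral_isometry (L := L) (L' := L) (g := fun v => g (v + refl 0)))//.
- by apply: eq_integral => v _; rewrite /L subrK.
- by move=> v; rewrite enorm_reflB subr0.
- by apply: measurableT_comp mg _; exact: measurable_rV_add.
Qed.

End reflection.

(** * The half-space *)

Lemma rV_cons0 (R : realType) n (p : measurableTypeR R * 'rV[R]_n) :
  rV_cons p ord0 ord0 = p.1.
Proof. by have /(congr1 fst) := rV_consK p. Qed.

Lemma rV_consS (R : realType) n (p : measurableTypeR R * 'rV[R]_n) i :
  rV_cons p ord0 (lift ord0 i) = p.2 ord0 i.
Proof.
by have /(congr1 snd)/rowP/(_ i) := rV_consK p; rewrite mxE rshift1.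
Qed.

Section distance.
Context (R : realType) (n : nat).
Local Notation Y := 'rV[R]_n.
Local Notation X := ('rV[R]_n * measurableTypeR R)%type.

(** This is [bdist] of the statement, with the dimension of the boundary itself as parameter. *)
Definition dist (x : X) (y : Y) : R := Num.sqrt (enorm (x.1 - y) ^+ 2 + x.2 ^+ 2).

Lemma dist_ge0 x y : 0 <= dist x y. Proof. exact: sqrtr_ge0. Qed.

Lemma sqr_dist x y : dist x y ^+ 2 = enorm (x.1 - y) ^+ 2 + x.2 ^+ 2.
Proof. by rewrite sqr_sqrtr// addr_ge0// sqr_ge0. Qed.

Lemma ger_dist_enorm x y : enorm (x.1 - y) <= dist x y.
Proof.
rewrite -(@ler_pXn2r _ 2) ?nnegrE ?dist_ge0 ?enorm_ge0// sqr_dist.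
by rewrite lerDl sqr_ge0.
Qed.

Lemma ger_dist_height x y : `|x.2| <= dist x y.
Proof.
rewrite -(@ler_pXn2r _ 2) ?nnegrE ?dist_ge0// sqr_dist real_normK ?num_real//.
by rewrite lerDr sqr_ge0.
Qed.

Lemma dist_gt0 x y : 0 < x.2 -> 0 < dist x y.
Proof.
by move=> x0; apply: lt_le_trans (ger_dist_height x y); rewrite gtr0_norm.
Qed.

Lemma enorm_cons (a : measurableTypeR R) (v : Y) : enorm (rV_cons (a, v)) = Num.sqrt (enorm v ^+ 2 + a ^+ 2).
Proof.
rewrite sqr_enorm enormE; congr Num.sqrt.
rewrite /dot big_ord_recl addrC; congr (_ + _).
  by apply: eq_bigr => i _; rewrite rV_consS.
by rewrite rV_cons0 expr2.
Qed.

Lemma dist_enorm x y : dist x y = enorm (rV_cons (x.2, x.1 - y)).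
Proof. by rewrite enorm_cons. Qed.

(** The distance is the Euclidean norm of the vector [(x_n, x' - y)] in one more dimension, where
    the triangle inequality is available. *)
Lemma dist_triangle x y z : dist x y <= dist x z + enorm (y - z).
Proof.
have -> : enorm (y - z) = enorm (rV_cons (0 : measurableTypeR R, z - y)).
  by rewrite enorm_cons expr0n addr0 sqrtr_sqr ger0_norm ?enorm_ge0// -enormN opprB.
rewrite !dist_enorm; apply: le_trans (ler_enormD _ _).
rewrite le_eqVlt; apply/orP; left; apply/eqP; congr enorm.
apply/rowP => i; rewrite [RHS]mxE; have [j ->|->] := unliftP ord0 i.
  by rewrite !rV_consS !mxE addrA subrK.
by rewrite !rV_cons0 addr0.
Qed.

Lemma ler_dist_origin x y : dist x y <= dist x 0 + enorm y.
Proof. by rewrite -[in enorm y](subr0 y); exact: dist_triangle. Qed.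

Lemma ger_dist_origin x y : dist x 0 <= dist x y + enorm y.
Proof. by rewrite -(enormN y) -sub0r; exact: dist_triangle. Qed.

(** The product form separates the variables: the factor in [y] leaves the integrals over [x]. *)
Lemma ler_dist_mul x y : dist x y <= (1 + dist x 0) * (1 + enorm y).
Proof.
apply: le_trans (ler_dist_origin x y) _.
have := dist_ge0 x 0; have := enorm_ge0 y; nra.
Qed.

Lemma measurable_dist : measurable_fun setT (fun z : X * Y => dist z.1 z.2).
Proof.
rewrite (_ : (fun _ => _) =
  fun z : X * Y => (enorm (z.1.1 - z.2) ^+ 2 + z.1.2 ^+ 2) `^ 2^-1); last first.
  by apply/funext => z; rewrite powR12_sqrt// addr_ge0// sqr_ge0.
apply: measurable_fun_powRl; apply: measurable_funD; apply: measurable_funX.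
  apply: measurableT_comp (@measurable_enorm R n) _.
  apply: measurable_rV_addfun.
    exact: measurableT_comp measurable_fst measurable_fst.
  exact: measurableT_comp (@measurable_rV_opp R n) measurable_snd.
exact: measurableT_comp measurable_snd measurable_fst.
Qed.

End distance.

Section half_space_integral.
Local Open Scope ereal_scope.
Context (R : realType) (n : nat).
Local Notation Y := 'rV[R]_n.
Local Notation X := ('rV[R]_n * measurableTypeR R)%type.
Local Notation mu := (lebesgue_rV R n).
Local Notation leb := (@lebesgue_measure R).
Local Notation nu := (lebesgue_rV R n \x @lebesgue_measure R).

Definition upper : set X := [set x | (0 < x.2)%R].

Lemma measurable_upper : measurable upper.
Proof.
rewrite (_ : upper = setT `*` `]0%R, +oo[); first exact: measurableX.
by apply/seteqP; split=> [x x0|x []] /=; rewrite ?in_itv/= andbT //; split => //; rewrite /= in_itv/= andbT.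
Qed.

Lemma upper_fibers (F : X -> \bar R) :
  measurable_fun setT F -> (forall x, 0 <= F x) ->
  \int[nu]_(x in upper) F x = \int[leb]_(t in `]0%R, +oo[) \int[mu]_v F (v, t).
Proof.
move=> mF F0; rewrite integral_mkcond fubini_tonelli2; last 2 first.
- apply/(measurable_restrictT _ _).1 => //; first exact: measurable_upper.
  exact: measurable_funS mF.
- by move=> x; rewrite patchE; case: ifP.
rewrite [RHS]integral_mkcond; apply: eq_integral => t _; rewrite /fubini_G patchE.
case: ifPn; rewrite (inE, notin_setE)/= in_itv/= andbT => t0.
  by apply: eq_integral => v _; rewrite patchE ifT// inE.
apply: integral0_eq => v _; rewrite patchE ifF//.
by apply/negP; rewrite inE.
Qed.

Let nu_measure : {measure set X -> \bar R} := nu.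

Let nu_sigma_finite : sigma_finite setT nu.
Proof.
have /sigma_finiteP[F [TF ndF Foo]] := sigma_finiteT mu.
have /sigma_finiteP[G [TG ndG Goo]] := sigma_finiteT leb.
exists (fun k => F k `*` G k).
  rewrite -setXTT TF TG predeqE => -[x y]; split.
    move=> [/= [k _ Fnx] [j _ Gky]]; exists (maxn k j) => //; split.
    - by move: x Fnx; exact/subsetPset/ndF/leq_maxl.
    - by move: y Gky; exact/subsetPset/ndG/leq_maxr.
  by move=> [k _ []/= ? ?]; split; exists k.
move=> k; have [? ?] := Foo k; have [? ?] := Goo k.
split; first exact: measurableX.
by rewrite product_measure1E// lte_mul_pinfty// ge0_fin_numE.
Qed.

Let nu_mixin := @Measure_isSigmaFinite.Build _ X R nu_measure nu_sigma_finite.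
(** The measure [nu] with its sigma-finite structure, as Tonelli's theorem between half-space and
    boundary takes it. Statements keep [nu]; the two agree by conversion. *)
Let nuS : {sigma_finite_measure set X -> \bar R} := HB.pack (Measure.sort nu_measure) nu_mixin.

Lemma upper_tonelli (F : X -> Y -> \bar R) :
  measurable_fun setT (fun z : X * Y => F z.1 z.2) -> (forall x y, 0 <= F x y) ->
  \int[nu]_(x in upper) \int[mu]_y F x y = \int[mu]_y \int[nu]_(x in upper) F x y.
Proof.
move=> mF F0.
have H := tonelli_in nuS mu measurable_upper mF
  (fun z => F0 z.1 z.2).
exact: H.
Qed.

Lemma measurable_upper_integral (F : X -> Y -> \bar R) :
  measurable_fun setT (fun z : X * Y => F z.1 z.2) -> (forall x y, 0 <= F x y) ->
  measurable_fun setT (fun y => \int[nu]_(x in upper) F x y).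
Proof.
move=> mF F0.
have H := measurable_integral_in nuS measurable_upper mF (fun z => F0 z.1 z.2).
exact: H.
Qed.

Lemma upper_change (T : Y -> Y) (F : X -> \bar R) :
  measurable_fun setT T ->
  (forall g : Y -> \bar R, measurable_fun setT g -> (forall v, 0 <= g v) ->
     \int[mu]_v g (T v) = \int[mu]_v g v) ->
  measurable_fun setT F -> (forall x, 0 <= F x) ->
  \int[nu]_(x in upper) F (T x.1, x.2) = \int[nu]_(x in upper) F x.
Proof.
move=> mT invT mF F0.
have mG : measurable_fun setT (fun x : X => F (T x.1, x.2)).
  apply: measurableT_comp mF _; apply/measurable_fun_pairP; split.
    exact: measurableT_comp mT measurable_fst.
  exact: measurable_snd.
rewrite (upper_fibers mG (fun x => F0 _)) (upper_fibers mF F0).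
apply: eq_integral => t _; rewrite -[RHS]invT//.
by have : measurable_fun setT (F \o pair^~ t) by apply: measurableT_comp mF _; exact: pair2_measurable.
Qed.

Lemma upper_translate (w : Y) (F : X -> \bar R) :
  measurable_fun setT F -> (forall x, 0 <= F x) ->
  \int[nu]_(x in upper) F (x.1 + w, x.2)%R = \int[nu]_(x in upper) F x.
Proof.
apply: (upper_change (T := fun v => v + w)%R); first exact: measurable_rV_add.
by move=> g mg g0; exact: nn_integral_translate.
Qed.

Lemma upper_refl (w e : Y) (F : X -> \bar R) : e != 0%R ->
  measurable_fun setT F -> (forall x, 0 <= F x) ->
  \int[nu]_(x in upper) F (refl w e x.1, x.2)%R = \int[nu]_(x in upper) F x.
Proof.
move=> e0; apply: upper_change; first exact: measurable_refl.
by move=> g mg g0; exact: integral_refl.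
Qed.

(** Lets [integral_dilation] in dimension one treat the last coordinate. *)
Let integral_rV1 (h : measurableTypeR R -> \bar R) :
  measurable_fun setT h -> (forall t, 0 <= h t) ->
  \int[lebesgue_rV R 1]_v h (v ord0 ord0) = \int[leb]_t h t.
Proof.
move=> mh h0; rewrite nn_integral_rVS//; last first.
  exact: measurableT_comp mh (measurable_rV_coord ord0).
apply: eq_integral => a _.
rewrite [LHS](_ : _ = \int[lebesgue_rV R 0]_v (cst (h a) v)); last first.
  apply: eq_integral => v _ /=; congr h.
  exact: rV_cons0.
by rewrite integral_cst// /= diracE in_setT mule1.
Qed.

Lemma upper_dilation (a : R) (F : X -> \bar R) : (0 < a)%R ->
  measurable_fun setT F -> (forall x, 0 <= F x) ->
  \int[nu]_(x in upper) F (a *: x.1, a * x.2)%R =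
  (a ^- n.+1)%:E * \int[nu]_(x in upper) F x.
Proof.
move=> a0 mF F0; rewrite !upper_fibers//; last first.
  have : measurable_fun setT (fun x : X => F (a *: x.1, a * x.2)%R) => //.
  apply: measurableT_comp mF _; apply/measurable_fun_pairP; split.
    exact: measurable_rV_scalefun.
  by apply: measurable_funM => //; exact: measurable_snd.
pose h (t : measurableTypeR R) := \int[mu]_v F (v, t).
have mh : measurable_fun setT h by exact: (measurable_fun_fubini_tonelli_G (m1 := mu) F mF F0).
have h0 t : 0 <= h t by exact: integral_ge0.
transitivity (\int[leb]_(t in `]0%R, +oo[) ((a ^- n)%:E * h (a * t)%R)).
  apply: eq_integral => t _; rewrite -integral_dilation//.
  by have : measurable_fun setT (F \o pair^~ (a * t)%R) by apply: measurableT_comp mF _; exact: pair2_measurable.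
pose hp := h \_ `]0%R, +oo[.
have hp0 t : 0 <= hp t by rewrite /hp patchE; case: ifP.
have mhp : measurable_fun setT hp.
  apply/(measurable_restrictT _ _).1 => //; exact: measurable_funS mh.
transitivity ((a ^- n)%:E * \int[leb]_t hp (a * t)%R).
  rewrite ge0_integralZl//; last 2 first.
  - by apply: (measurable_funS measurableT) => //; apply: measurableT_comp mh _; exact: measurable_funM.
  - by rewrite lee_fin invr_ge0 exprn_ge0// ltW.
  congr (_ * _); rewrite [LHS]integral_mkcond; apply: eq_integral => t _.
  rewrite /hp !patchE; congr (if _ then _ else _).
  by apply/idP/idP; rewrite !inE/= !in_itv/= !andbT pmulr_rgt0.
rewrite -(@integral_rV1 (fun t => hp (a * t)%R))//; last first.
  by apply: measurableT_comp mhp _; exact: measurable_funM.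
transitivity ((a ^- n)%:E * \int[lebesgue_rV R 1]_v hp ((a *: v)%R ord0 ord0)).
  by congr (_ * _); apply: eq_integral => v _; rewrite mxE.
rewrite (integral_dilation (g := fun v : 'rV[R]_1 => hp (v ord0 ord0)))//; last first.
  exact: measurableT_comp mhp (measurable_rV_coord ord0).
rewrite integral_rV1// muleA -EFinM -invfM expr1 -exprSr.
by rewrite [in RHS]integral_mkcond.
Qed.

End half_space_integral.

(** * Integrable decay at infinity in the half-space *)

Section decay.
Context (R : realType) (n : nat).
Local Notation Y := 'rV[R]_n.
Local Notation X := ('rV[R]_n * measurableTypeR R)%type.
Local Notation nu := (lebesgue_rV R n \x @lebesgue_measure R)%E.

Definition box (r : R) : set X := @cube R n r `*` `[- r, r]%classic.

Lemma measurable_box r : measurable (box r).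
Proof. by apply: measurableX => //; exact: measurable_cube. Qed.

Lemma measure_box r : 0 <= r -> nu (box r) = ((2 * r) ^+ n.+1)%:E.
Proof.
move=> r0; rewrite product_measure1E//; last exact: measurable_cube.
rewrite exprSr EFinM; congr (_ * _)%E; first exact: lebesgue_cube.
transitivity (@lebesgue_measure R `[- r, r]%classic) => //.
rewrite lebesgue_measure_itv/=; case: ltP.
  by move=> _; rewrite -EFinD; congr EFin; lra.
by rewrite lee_fin => ?; congr EFin; lra.
Qed.

Lemma box_dist (x : X) r : dist x 0 <= r -> box r x.
Proof.
move=> xr; split => /=.
  by apply: enorm_cube; apply: le_trans xr; rewrite -[x.1]subr0; exact: ger_dist_enorm.
by rewrite in_itv/= -ler_norml; apply: le_trans xr; exact: ger_dist_height.
Qed.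

(* Dyadic decomposition: on [2^k <= 1 + |x| < 2^(k+1)] the integrand is at most 2^(-pk), and
   this shell lies in a box of volume 4^(n+1) 2^(k(n+1)). *)
Lemma integral_decay_lty (p : R) : n.+1%:R < p ->
  (\int[nu]_(x in @upper R n) ((1 + dist x 0) `^ (- p))%:E < +oo)%E.
Proof.
move=> np.
pose c k : R := (2 `^ (- p)) ^+ k.
pose B k := box (2 ^+ k.+1).
have c0 k : 0 <= c k by rewrite exprn_ge0// powR_ge0.
(* Ratio of the geometric series: the weight [2 ^ (- p)] times the growth [2 ^ (n + 1)] of the
   volume from one shell to the next, below 1 because [p > n + 1]. *)
pose z : R := 2 `^ (- p) * 2 ^+ n.+1.
have z0 : 0 < z by rewrite mulr_gt0 ?powR_gt0// exprn_gt0.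
have z1 : z < 1.
  rewrite /z -powR_mulrn// -powRD ?pnatr_eq0 ?implybT//.
  rewrite -[ltRHS](powRr0 2) /powR pnatr_eq0/= ltr_expR ltr_pM2r ?ln_gt0 ?ltr1n//.
  by rewrite addrC subr_lt0.
apply: (@le_lt_trans _ _ (\int[nu]_x (\sum_(0 <= k <oo) (c k * \1_(B k) x)%:E))%E).
  rewrite integral_mkcond; apply: nn_le_integral.
    by move=> x _; rewrite patchE; case: ifP => // _; rewrite lee_fin powR_ge0.
  have S0 x : (0 <= \sum_(0 <= k <oo) (c k * \1_(B k) x)%:E)%E.
    by apply: nneseries_ge0 => k _ _; rewrite lee_fin mulr_ge0.
  move=> x _; rewrite patchE; case: ifP => // _.
  have d0 : 0 <= dist x 0 by exact: dist_ge0.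
  have [k0 hk0] : exists k, 1 + dist x 0 < 2 ^+ k.+1.
    by exists (Num.bound (1 + dist x 0)); exact: upper_nthrootP.
  pose k := ex_minn (ex_intro (fun k => 1 + dist x 0 < 2 ^+ k.+1) k0 hk0).
  have [hk kmin] : 1 + dist x 0 < 2 ^+ k.+1 /\ 2 ^+ k <= 1 + dist x 0.
    rewrite /k; case: ex_minnP => k' hk' kmin; split => //.
    case: k' hk' kmin => [|k'] hk' kmin; first by rewrite expr0 lerDl.
    by rewrite leNgt; apply/negP => /kmin; rewrite ltnn.
  clearbody k.
  apply: (@le_trans _ _ (\sum_(0 <= i < k.+1) (c i * \1_(B i) x)%:E)%E); last first.
    by apply: nneseries_lim_ge => i _ _; rewrite lee_fin mulr_ge0.
  rewrite sumEFin lee_fin big_nat_recr//=.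
  have -> : \1_(B k) x = 1 :> R.
    rewrite indicE mem_set//; apply: box_dist; apply: le_trans (ltW hk).
    by rewrite lerDr.
  rewrite mulr1.
  apply: (@le_trans _ _ (c k)); last first.
    by rewrite lerDr sumr_ge0// => i _; rewrite mulr_ge0.
  rewrite /c -powR_mulrn ?powR_ge0// -powRrM mulrC powRrM powR_mulrn//.
  have h : 0 < 2 ^+ k :> R by rewrite exprn_gt0.
  rewrite !powRN lef_pV2 ?posrE ?powR_gt0//; last lra.
  by apply: ge0_ler_powR; rewrite ?nnegrE; [apply: le_trans (ltW np)| lra..|].
have mB k : measurable (B k) := measurable_box _.
rewrite integral_nneseries//; last 2 first.
- move=> k; apply/measurable_EFinP; apply: measurable_funM => //; exact: measurable_indic.
- by move=> k x _; rewrite lee_fin mulr_ge0.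
apply: (@le_lt_trans _ _ ((4 ^+ n.+1) / (1 - z))%:E); last by rewrite ltry.
apply: lime_le.
  by apply: is_cvg_nneseries => k _ _; apply: integral_ge0 => x _; rewrite lee_fin mulr_ge0.
apply: nearW => N.
rewrite (eq_bigr (fun k => (4 ^+ n.+1 * z ^+ k)%:E)); last first.
  move=> k _; under eq_integral do rewrite EFinM.
  rewrite ge0_integralZl//; [|by apply/measurable_EFinP; exact: measurable_indic
    |by rewrite lee_fin].
  rewrite integral_indic// setIT.
  transitivity ((c k)%:E * ((2 * 2 ^+ k.+1) ^+ n.+1)%:E)%E.
    by congr (_ * _)%E; apply: measure_box; rewrite exprn_ge0.
  rewrite -EFinM; congr EFin.
  have -> : 2 * 2 ^+ k.+1 = 4 * 2 ^+ k :> R by rewrite exprS mulrA -natrM.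
  by rewrite /z /c ![in RHS]exprMn [in LHS]exprMn mulrCA -![2 ^+ _ ^+ _]exprM mulnC.
have := @geometric_le_lim R N (4 ^+ n.+1) z.
rewrite sumEFin lee_fin => H.
by apply: H; rewrite ?exprn_ge0// gtr0_norm.
Qed.

End decay.

(** * Inequalities for real powers *)

Section power_inequalities.
Context (R : realType).
Implicit Types a b r s x : R.

Let powR1x x : 1 `^ x = 1 :> R. Proof. by rewrite powR1. Qed.

Lemma ler_powRN a b s : 0 <= s -> 0 < a -> a <= b -> b `^ (- s) <= a `^ (- s).
Proof.
move=> s0 a0 ab; have b0 := lt_le_trans a0 ab.
rewrite !powRN lef_pV2 ?posrE ?powR_gt0//.
by apply: ge0_ler_powR; rewrite ?nnegrE ?(ltW a0) ?(ltW b0).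
Qed.

(** Tangent line of the convex power at 1, from [1 + x <= exp x] and [ln r <= r - 1]. *)
Lemma powRN_tangent1 r s : 0 < s -> 0 < r -> 1 - s * (r - 1) <= r `^ (- s).
Proof.
move=> s0 r0; rewrite /powR gt_eqF//.
apply: le_trans (expR_ge1Dx _); rewrite mulNr lerD2l lerN2 ler_pM2l//.
have := @le_ln1Dx R (r - 1); rewrite (_ : 1 + (r - 1) = r); [by apply; lra|ring].
Qed.

Lemma powRN_tangent1_lt r s : 0 < s -> 0 < r -> r != 1 -> 1 - s * (r - 1) < r `^ (- s).
Proof.
move=> s0 r0 r1; rewrite /powR gt_eqF//.
apply: (@le_lt_trans _ _ (1 + (- s) * ln r)).
  rewrite mulNr lerD2l lerN2 ler_pM2l//.
  have := @le_ln1Dx R (r - 1); rewrite (_ : 1 + (r - 1) = r); [by apply; lra|ring].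
by apply: expR_gt1Dx; rewrite mulf_neq0 ?ln_eq0// oppr_eq0 gt_eqF.
Qed.

Let powRN_ratio a b s : 0 < a -> 0 < b ->
  (a / b) `^ (- s) = a `^ (- s) / b `^ (- s).
Proof.
move=> a0 b0; rewrite powRM ?invr_ge0 ?(ltW a0) ?(ltW b0)//; congr (_ * _).
by rewrite -[b^-1]powR_inv1 ?(ltW b0)// -powRrM mulN1r opprK powRN invrK.
Qed.

Lemma mulr_powRNB1 b s : 0 < b -> b * b `^ (- s - 1) = b `^ (- s).
Proof.
move=> b0; rewrite -{1}[b]powRr1 ?ltW// -powRD; last by apply/implyP => _; rewrite gt_eqF.
by congr (_ `^ _); ring.
Qed.

(** Tangent line of [a ^ (- s)] at [b], arranged with nonnegative terms on both sides so that it can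
    be integrated in the extended reals. *)
Lemma powRN_tangent a b s : 0 < s -> 0 < a -> 0 < b ->
  (1 + s) * b `^ (- s) <= s * (a * b `^ (- s - 1)) + a `^ (- s).
Proof.
move=> s0 a0 b0; have bs : 0 < b `^ (- s) by rewrite powR_gt0.
have := powRN_tangent1 s0 (divr_gt0 a0 b0).
rewrite powRN_ratio// ler_pdivlMr// -(mulr_powRNB1 s b0) => H.
have -> : s * (a * b `^ (- s - 1)) = s * (a / b) * (b * b `^ (- s - 1)).
  by field; rewrite gt_eqF.
lra.
Qed.

Lemma powRN_tangent_lt a b s : 0 < s -> 0 < a -> 0 < b -> a != b ->
  (1 + s) * b `^ (- s) < s * (a * b `^ (- s - 1)) + a `^ (- s).
Proof.
move=> s0 a0 b0 ab; have bs : 0 < b `^ (- s) by rewrite powR_gt0.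
have ab1 : a / b != 1 by apply: contra ab => /eqP abE; rewrite -[a](divfK (lt0r_neq0 b0)) abE mul1r.
have := powRN_tangent1_lt s0 (divr_gt0 a0 b0) ab1.
rewrite powRN_ratio// ltr_pdivlMr// -(mulr_powRNB1 s b0) => H.
have -> : s * (a * b `^ (- s - 1)) = s * (a / b) * (b * b `^ (- s - 1)).
  by field; rewrite gt_eqF.
lra.
Qed.

(* Strict convexity of [x ^ (- s)] under majorisation. *)
Lemma powRN_majorization (A B a b s : R) : 0 < s -> 0 < A ->
  A <= a -> A <= b -> A + B = a + b ->
  a `^ (- s) + b `^ (- s) <= A `^ (- s) + B `^ (- s) /\
  (A < a -> A < b -> a `^ (- s) + b `^ (- s) < A `^ (- s) + B `^ (- s)).
Proof.
move=> s0 A0; wlog ab : a b / a <= b => [th Aa Ab AB|Aa Ab AB].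
  have [ab|/ltW ba] := leP a b; first exact: th.
  rewrite (addrC (a `^ _)); have [] := th _ _ ba Ab Aa; first by rewrite AB addrC.
  by move=> ? H; split => // ? ?; exact: H.
have a0 : 0 < a by exact: lt_le_trans A0 Aa.
have b0 : 0 < b by exact: lt_le_trans A0 Ab.
have B0 : 0 < B by lra.
(* [A] is tested against the tangent at [a], and [B] against the tangent at [b]. As [a <= b], the
   difference of the slopes leaves the term [k], which has the right sign. *)
have ha := powRN_tangent s0 A0 a0.
have hb := powRN_tangent s0 B0 b0.
have hs : b `^ (- s - 1) <= a `^ (- s - 1).
  by rewrite -opprD; apply: ler_powRN => //; lra.
have BE : B = a + b - A by lra.
have ea := mulr_powRNB1 s a0; have eb := mulr_powRNB1 s b0.
have k : 0 <= s * ((a - A) * (a `^ (- s - 1) - b `^ (- s - 1))).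
  by rewrite mulr_ge0 ?(ltW s0)// mulr_ge0 ?subr_ge0.
have E : s * (A * a `^ (- s - 1)) + s * (B * b `^ (- s - 1)) =
   s * (a * a `^ (- s - 1)) + s * (b * b `^ (- s - 1)) -
   s * ((a - A) * (a `^ (- s - 1) - b `^ (- s - 1))) by rewrite BE; ring.
split=> [|Aa' _]; first by move: E; rewrite ea eb; lra.
have := powRN_tangent_lt s0 A0 a0 (negbT (lt_eqF Aa')).
move: E; rewrite ea eb; lra.
Qed.

(** Tangent line of [a ^ p] at [b]: for [a > 0] it is the tangent inequality with exponent
    [- (p - 1)] at the ratio [b / a], multiplied by [a b ^ (p - 1)]. *)
Lemma powR_tangent a b p : 1 < p -> 0 <= a -> 0 < b ->
  b `^ p + p * b `^ (p - 1) * (a - b) <= a `^ p.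
Proof.
move=> p1 a0 b0.
have bE : b `^ p = b * b `^ (p - 1) by rewrite mulr_powRB1 ?ltW//; lra.
have bp : 0 < b `^ (p - 1) by rewrite powR_gt0.
move: a0; rewrite le_eqVlt => /predU1P[<-|a0].
  rewrite powR0 ?gt_eqF//; last lra.
  rewrite bE; have : 0 < b * b `^ (p - 1) by rewrite mulr_gt0.
  nra.
have p10 : 0 < p - 1 by lra.
have aE : a `^ p = a * a `^ (p - 1) by rewrite mulr_powRB1 ?(ltW a0)//; lra.
have := powRN_tangent1 p10 (divr_gt0 b0 a0).
rewrite powRN_ratio// !powRN invrK => H.
have ap : 0 < a `^ (p - 1) by rewrite powR_gt0.
have H2 : (1 - (p - 1) * (b / a - 1)) * b `^ (p - 1) <= a `^ (p - 1).
  by rewrite -ler_pdivlMr// [leRHS]mulrC.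
have : a * ((1 - (p - 1) * (b / a - 1)) * b `^ (p - 1)) <= a * a `^ (p - 1).
  by rewrite ler_pM2l.
rewrite aE; apply: le_trans; rewrite bE le_eqVlt; apply/orP; left; apply/eqP.
by field; rewrite gt_eqF.
Qed.

(** The cases are [v >= K] and [v <= K]. With [v] a value of the extension, this bounds the energy
    density by a small constant plus [K] times the weight that appears in the potential. *)
Lemma powRN_interpolate (K v s : R) : 0 < s -> 0 < K -> 0 < v ->
  v `^ (- s) <= K `^ (- s) + K * v `^ (- s - 1).
Proof.
move=> s0 K0 v0; have [Kv|/ltW vK] := leP K v.
  by apply: le_trans (ler_powRN (ltW s0) K0 Kv) _; rewrite lerDl mulr_ge0 ?powR_ge0// ltW.
rewrite -(mulr_powRNB1 s v0); apply: (@le_trans _ _ (K * v `^ (- s - 1))).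
  by rewrite ler_wpM2r ?powR_ge0.
by rewrite lerDr powR_ge0.
Qed.

(* Uniform in [r]: equicontinuity of the kernels rests on this modulus. *)
Lemma powR_modulus (b eps : R) : 0 < b -> 0 < eps ->
  exists2 del, 0 < del & forall r r', 0 <= r -> 0 <= r' -> r <= r' + del ->
    r `^ b <= r' `^ b + eps * (1 + r') `^ b.
Proof.
move=> b0 e0.
(* If [r' <= eta] then [r <= 2 eta], and [(2 eta) ^ b = eps]. If [r' > eta], the increment is
   absorbed in the factor [u] below, for which [u ^ b = 1 + eps]. *)
pose eta : R := eps `^ b^-1 / 2.
have eta0 : 0 < eta by rewrite divr_gt0// powR_gt0.
have rt (x : R) : 0 <= x -> (x `^ b^-1) `^ b = x.
  by move=> x0; rewrite -powRrM mulVf ?gt_eqF// powRr1.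
pose u : R := (1 + eps) `^ b^-1.
have u1 : 1 < u.
  rewrite /u -[ltLHS](powR1x b^-1) gt0_ltr_powR ?invr_gt0 ?nnegrE//; lra.
exists (Order.min eta (eta * (u - 1))).
  by rewrite lt_min eta0 mulr_gt0// subr_gt0.
move=> r r' r0 r'0; set del := Order.min _ _ => rr'.
have d1 : del <= eta by rewrite /del ge_min lexx.
have d2 : del <= eta * (u - 1) by rewrite /del ge_min lexx orbT.
have one : 1 <= (1 + r') `^ b.
  by rewrite -[leLHS](powR1x b) ge0_ler_powR ?nnegrE ?(ltW b0)//; lra.
have [h|h] := leP r' eta.
  have : r `^ b <= eps.
    rewrite -[leRHS]rt ?(ltW e0)//; apply: ge0_ler_powR; rewrite ?nnegrE ?powR_ge0 ?(ltW b0)//.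
    have : eps `^ b^-1 = 2 * eta by rewrite /eta; field.
    lra.
  have := powR_ge0 r' b; nra.
have : r <= r' * u.
  apply: le_trans rr' _; have : del <= r' * (u - 1); last lra.
  by apply: le_trans d2 _; rewrite ler_wpM2r ?subr_ge0 ?(ltW u1)// ltW.
move=> rru; have u0 : 0 <= u by rewrite ltW// (lt_trans ltr01 u1).
have : r `^ b <= (r' * u) `^ b.
  by apply: ge0_ler_powR; rewrite ?nnegrE ?mulr_ge0 ?(ltW b0).
rewrite powRM// /u rt; last lra.
have : r' `^ b <= (1 + r') `^ b by apply: ge0_ler_powR; rewrite ?nnegrE ?(ltW b0)//; lra.
nra.
Qed.

Lemma powR_half_add r b : 0 <= b -> 0 <= r ->
  ((1 + r) / 2) `^ b <= Order.max 1 (r `^ b).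
Proof.
move=> b0 r0; have [r1|r1] := leP r 1.
  rewrite le_max; apply/orP; left; rewrite -[leRHS](powR1x b).
  by apply: ge0_ler_powR; rewrite ?nnegrE; lra.
rewrite le_max; apply/orP; right; apply: ge0_ler_powR; rewrite ?nnegrE; lra.
Qed.

(* The factor [L ^ (- (1 - th) s)] makes the integrals below vanish as [L] grows. *)
Lemma powRN_add_le (L r b s th : R) : 0 < b -> 0 < s -> 0 <= th <= 1 -> 1 <= L -> 0 <= r ->
  (L + r `^ b) `^ (- s) <=
  2 `^ (b * th * s) * L `^ (- ((1 - th) * s)) * (1 + r) `^ (- (b * th * s)).
Proof.
move=> b0 s0 /andP[th0 th1] L1 r0.
have L0 : 0 < L by lra.
pose M := Order.max L (r `^ b).
have ML : L <= M by rewrite le_max lexx.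
have M0 : 0 < M by exact: lt_le_trans ML.
have h0 : 0 < (1 + r) / 2 by lra.
have Mr : ((1 + r) / 2) `^ b <= M.
  apply: le_trans (powR_half_add (ltW b0) r0) _.
  by rewrite ge_max !le_max L1 lexx orbT.
have : M `^ (- s) <= (L `^ (1 - th) * (((1 + r) / 2) `^ b) `^ th) `^ (- s).
  apply: ler_powRN; rewrite ?(ltW s0)// ?mulr_gt0 ?powR_gt0//.
  have -> : M = M `^ (1 - th) * M `^ th.
    by rewrite -powRD ?subrK ?powRr1 ?(ltW M0)//; apply/implyP => _; rewrite gt_eqF.
  apply: ler_pM; rewrite ?powR_ge0//; apply: ge0_ler_powR; rewrite ?nnegrE ?powR_ge0 ?(ltW L0) ?(ltW M0)//.
  by rewrite subr_ge0.
move=> H; apply: (@le_trans _ _ (M `^ (- s))).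
  apply: ler_powRN; rewrite ?(ltW s0)//.
  by rewrite /M ge_max lerDl powR_ge0 lerDr ltW.
apply: le_trans H _; rewrite le_eqVlt; apply/orP; left; apply/eqP.
rewrite powRM ?powR_ge0// -!powRrM !mulrN powRN_ratio//; last lra.
by rewrite !mulrA (powRN 2) invrK; ring.
Qed.

End power_inequalities.

(** * The extension operator *)

Section extension_operator.
Context (R : realType) (n : nat) (b : R).
Hypothesis b0 : 0 < b.
Local Notation Y := 'rV[R]_n.
Local Notation X := ('rV[R]_n * measurableTypeR R)%type.
Local Notation mu := (lebesgue_rV R n).
Local Notation nu := (lebesgue_rV R n \x @lebesgue_measure R)%E.
Local Notation D := (@upper R n).
Implicit Types (f g : Y -> R) (x : X) (y z : Y).

(** The exponent [b] stands for [alpha] minus the dimension of the half-space, here [n.+1]. *)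
Definition ker x y : R := dist x y `^ b.

Definition ext f x : \bar R := (\int[mu]_y (ker x y * f y)%:E)%E.

Definition mass f : \bar R := (\int[mu]_y (f y)%:E)%E.

Lemma ker_ge0 x y : 0 <= ker x y. Proof. exact: powR_ge0. Qed.

Lemma ker_gt0 x y : D x -> 0 < ker x y.
Proof. by move=> Dx; rewrite powR_gt0// dist_gt0. Qed.

Lemma measurable_ker : measurable_fun setT (fun z : X * Y => ker z.1 z.2).
Proof. by apply: measurable_fun_powRl; exact: measurable_dist. Qed.

Lemma measurable_ker1 x : measurable_fun setT (ker x).
Proof.
by have : measurable_fun setT ((fun z : X * Y => ker z.1 z.2) \o pair x)
  by apply: measurableT_comp measurable_ker _; exact: pair1_measurable.
Qed.

Lemma measurable_ker2 y : measurable_fun setT (ker^~ y).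
Proof.
by have : measurable_fun setT ((fun z : X * Y => ker z.1 z.2) \o pair^~ y)
  by apply: measurableT_comp measurable_ker _; exact: pair2_measurable.
Qed.

Lemma measurable_kerM f : measurable_fun setT f ->
  measurable_fun setT (fun z : X * Y => (ker z.1 z.2 * f z.2)%:E).
Proof.
move=> mf; apply/measurable_EFinP; apply: measurable_funM; first exact: measurable_ker.
exact: measurableT_comp mf measurable_snd.
Qed.

Lemma measurable_kerM1 f x : measurable_fun setT f ->
  measurable_fun setT (fun y => (ker x y * f y)%:E).
Proof.
by move=> mf; apply/measurable_EFinP; apply: measurable_funM => //; exact: measurable_ker1.
Qed.

Lemma ext_ge0 f x : (forall y, 0 <= f y) -> (0 <= ext f x)%E.
Proof. by move=> f0; apply: integral_ge0 => y _; rewrite lee_fin mulr_ge0 ?ker_ge0. Qed.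

Lemma mass_ge0 f : (forall y, 0 <= f y) -> (0 <= mass f)%E.
Proof. by move=> f0; apply: integral_ge0 => y _; rewrite lee_fin. Qed.

Lemma measurable_ext f : measurable_fun setT f -> (forall y, 0 <= f y) ->
  measurable_fun setT (ext f).
Proof.
move=> mf f0.
apply: (measurable_fun_fubini_tonelli_F (m2 := mu) _ (measurable_kerM mf)) => z.
by rewrite lee_fin mulr_ge0 ?ker_ge0.
Qed.

Lemma ler_powR_add (r r' : R) : 0 <= r -> 0 <= r' ->
  (r + r') `^ b <= 2 `^ b * (r `^ b + r' `^ b).
Proof.
move=> r0 r'0; wlog rr' : r r' r0 r'0 / r <= r'.
  move=> H; have [rr'|/ltW rr'] := leP r r'; first exact: H.
  by rewrite addrC [X in _ * X]addrC; exact: H.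
apply: (@le_trans _ _ ((2 * r') `^ b)).
  by apply: ge0_ler_powR; rewrite ?nnegrE ?(ltW b0)//; lra.
by rewrite powRM// ler_wpM2l ?powR_ge0// lerDr powR_ge0.
Qed.

(** The kernels at two points compare up to constants, [ker x y <= 2 ^ b (A ^ b + ker x0 y)]. Hence
    the extension of a function of finite mass is finite everywhere or nowhere. *)
Lemma ext_lty f x0 x : measurable_fun setT f -> (forall y, 0 <= f y) ->
  (mass f < +oo)%E -> (ext f x0 < +oo)%E -> (ext f x < +oo)%E.
Proof.
move=> mf f0 Mf Ef.
pose A := dist x 0 + dist x0 0.
have A0 : 0 <= A by rewrite addr_ge0 ?dist_ge0.
have kx y : ker x y <= 2 `^ b * (A `^ b + ker x0 y).
  apply: le_trans (ler_powR_add A0 (dist_ge0 x0 y)).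
  apply: ge0_ler_powR; rewrite ?nnegrE ?addr_ge0 ?dist_ge0 ?(ltW b0)//.
  apply: le_trans (ler_dist_origin x y) _; rewrite /A -addrA lerD2l.
  have yE : enorm y <= enorm x0.1 + enorm (x0.1 - y).
    rewrite -[enorm (_ - _)]enormN -[leLHS](_ : enorm (x0.1 + - (x0.1 - y)) = _).
      exact: ler_enormD.
    by rewrite opprB addrC subrK.
  apply: le_trans yE _; rewrite lerD ?ger_dist_enorm//.
  by rewrite -{1}[x0.1]subr0; exact: ger_dist_enorm.
apply: (@le_lt_trans _ _ (\int[mu]_y ((2 `^ b * A `^ b)%:E * (f y)%:E +
    (2 `^ b)%:E * (ker x0 y * f y)%:E))%E).
  apply: nn_le_integral => y _; first by rewrite lee_fin mulr_ge0 ?ker_ge0.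
  rewrite -!EFinM -EFinD lee_fin.
  by have := ler_wpM2r (f0 y) (kx y); lra.
have mkf := measurable_kerM1 x0 mf.
have mf' : measurable_fun setT (fun y => (f y)%:E) by exact/measurable_EFinP.
have p2 : 0 <= 2 `^ b :> R by exact: powR_ge0.
have pA : 0 <= 2 `^ b * A `^ b by rewrite mulr_ge0 ?powR_ge0.
have kf0 y : (0 <= (ker x0 y * f y)%:E)%E by rewrite lee_fin mulr_ge0 ?ker_ge0.
have fE0 y : (0 <= (f y)%:E)%E by rewrite lee_fin.
rewrite ge0_integralD//; [|by move=> y _; rewrite mule_ge0|
  exact: measurable_funeM|by move=> y _; rewrite mule_ge0|exact: measurable_funeM].
rewrite !ge0_integralZl//.
by apply: lte_add_pinfty; apply: lte_mul_pinfty.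
Qed.

(** An admissible function agrees almost everywhere with a nonnegative Borel one; either that one is
    [good] or the left-hand side of the inequality is infinite. The analysis is therefore confined
    to this class. *)
Definition good f := [/\ measurable_fun setT f, forall y, 0 <= f y,
  (0 < mass f)%E, (mass f < +oo)%E & forall x, (ext f x < +oo)%E].

Lemma ext_gt0 f x : D x -> good f -> (0 < ext f x)%E.
Proof.
move=> Dx [mf f0 Mf _ _]; rewrite lt_neqAle ext_ge0// andbT eq_sym.
apply: contraTneq Mf => Ex0; rewrite -leNgt.
have := integral_eq0_ae measurableT (measurable_kerM1 x mf) _ Ex0.
move=> /(_ (fun y _ => _)) H.
have fae : {ae mu, forall y, [set: Y] y -> (f y)%:E = cst 0%E y}.
  apply: filterS (H _) => [y /(_ I) [] /eqP|y]; last first.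
    by rewrite lee_fin mulr_ge0 ?ker_ge0.
  by rewrite mulf_eq0 gt_eqF ?ker_gt0//= => /eqP -> _.
rewrite /mass (nn_ae_eq_integral measurableT _ _ fae)//; last first.
  by move=> y _; rewrite lee_fin.
by rewrite integral0.
Qed.

Lemma extK f x : good f -> (fine (ext f x))%:E = ext f x.
Proof. by move=> [_ f0 _ _ Ef]; rewrite fineK// ge0_fin_numE ?ext_ge0. Qed.

Lemma fine_ext_gt0 f x : D x -> good f -> 0 < fine (ext f x).
Proof. by move=> Dx gf; rewrite -lte_fin extK// ext_gt0. Qed.

Lemma massK f : good f -> (fine (mass f))%:E = mass f.
Proof. by move=> [_ f0 _ Mf _]; rewrite fineK// ge0_fin_numE ?mass_ge0. Qed.

Lemma fine_mass_gt0 f : good f -> 0 < fine (mass f).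
Proof. by move=> gf; rewrite -lte_fin massK//; case: gf. Qed.

Lemma le_ext f g x : (forall y, 0 <= f y) -> (forall y, f y <= g y) -> (ext f x <= ext g x)%E.
Proof.
move=> f0 fg; apply: nn_le_integral => y _; first by rewrite lee_fin mulr_ge0 ?ker_ge0.
by rewrite lee_fin ler_wpM2l ?ker_ge0.
Qed.

Lemma good_minr1 f : good f -> good (fun y => Order.min (f y) 1).
Proof.
move=> gf; have [mf f0 Mf Mfo Ef] := gf.
have m0 y : 0 <= Order.min (f y) 1 by rewrite le_min f0/=.
have mle y : Order.min (f y) 1 <= f y by rewrite ge_min lexx.
have mm : measurable_fun setT (fun y => Order.min (f y) 1) by exact: measurable_minr.
split => //.
- rewrite lt_neqAle mass_ge0// andbT eq_sym; apply: contraTneq Mf => M0.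
  have H := integral_eq0_ae measurableT _ _ M0.
  rewrite -leNgt /mass (@nn_ae_eq_integral _ _ _ mu setT _ (cst 0%E))//.
  + by rewrite integral0.
  + by move=> y _; rewrite lee_fin.
  + apply: filterS (H _ _) => [y /(_ I)|  |y _].
    * move=> [] h _; have := f0 y; move: h; rewrite /Order.min.
      by case: ltP => [_ ->//|_ /eqP]; rewrite oner_eq0.
    * exact/measurable_EFinP.
    * by rewrite lee_fin.
- by apply: le_lt_trans Mfo; apply: nn_le_integral => y _; rewrite lee_fin.
- by move=> x; apply: le_lt_trans (Ef x); exact: le_ext.
Qed.

End extension_operator.

(** * The energy *)

Section energy.
Context (R : realType) (n : nat) (b s : R).
Hypotheses (b0 : 0 < b) (s0 : 0 < s) (bs : n.+1%:R < b * s).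
Local Notation Y := 'rV[R]_n.
Local Notation X := ('rV[R]_n * measurableTypeR R)%type.
Local Notation mu := (lebesgue_rV R n).
Local Notation nu := (lebesgue_rV R n \x @lebesgue_measure R)%E.
Local Notation D := (@upper R n).
Local Notation ker := (@ker R n b).
Local Notation ext := (@ext R n b).
Local Notation good := (@good R n b).
Implicit Types (f g : Y -> R) (x : X) (y z : Y).

(** With [t' = - s] this is the integral of [(E f) ^ t']. Taking [fine] loses nothing on [good]
    functions, whose extension is finite. *)
Definition energy f : \bar R := (\int[nu]_(x in D) (fine (ext f x) `^ (- s))%:E)%E.

(** The reference integral that dominates the energy of a function whose mass is spread out at scale
    [r], with [L = r ^ b / 2]. *)
Definition Zint (L : R) : \bar R := (\int[nu]_(x in D) ((L + ker x 0) `^ (- s))%:E)%E.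

Let mD : measurable D := @measurable_upper R n.

Let measurable_decay p : measurable_fun setT (fun x : X => ((1 + dist x 0) `^ (- p))%:E).
Proof.
apply/measurable_EFinP; apply: measurable_fun_powRl; apply: measurable_funD => //.
by have : measurable_fun setT ((fun z : X * Y => dist z.1 z.2) \o pair^~ 0)
  by apply: measurableT_comp (@measurable_dist R n) _; exact: pair2_measurable.
Qed.

(** An exponent strictly between [n.+1] and [b * s]: the weight of exponent [p] is integrable, and
    since [th < 1] a decay [L ^ (- ((1 - th) s))] remains. *)
Let p := (n.+1%:R + b * s) / 2.
Let th := p / (b * s).

Let np : n.+1%:R < p. Proof. by rewrite /p; move: bs; lra. Qed.

Let bs0 : 0 < b * s. Proof. exact: mulr_gt0. Qed.

Let th01 : 0 < th < 1.
Proof.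
rewrite /th divr_gt0//; last by apply: lt_trans np.
by rewrite ltr_pdivrMr// mul1r /p; move: bs; lra.
Qed.

Let Zint_decay : exists2 K, 0 <= K & forall L, 1 <= L ->
  (Zint L <= (K * L `^ (- ((1 - th) * s)))%:E)%E.
Proof.
have Koo := @integral_decay_lty R n p np.
set J := (\int[nu]_(x in D) ((1 + dist x 0) `^ (- p))%:E)%E in Koo.
have J0 : (0 <= J)%E by apply: integral_ge0 => x _; rewrite lee_fin powR_ge0.
exists (2 `^ p * fine J); first by rewrite mulr_ge0 ?powR_ge0// fine_ge0.
move=> L L1.
apply: (@le_trans _ _ (\int[nu]_(x in D) ((2 `^ p * L `^ (- ((1 - th) * s)))%:E *
    ((1 + dist x 0) `^ (- p))%:E))%E).
  apply: nn_le_integral => x _; first by rewrite lee_fin powR_ge0.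
  have pE : p = b * th * s by rewrite /th; field; rewrite !gt_eqF.
  rewrite -EFinM lee_fin pE; apply: powRN_add_le => //; last exact: dist_ge0.
  by case/andP: th01 => /ltW -> /ltW ->.
rewrite (ge0_integralZl_EFin _ mD); last 3 first.
- by move=> x _; rewrite lee_fin powR_ge0.
- by apply: measurable_funTS; exact: measurable_decay.
- by rewrite mulr_ge0 ?powR_ge0.
by rewrite -[X in (_ * X <= _)%E]fineK ?ge0_fin_numE// -EFinM lee_fin mulrAC.
Qed.

Lemma Zint_ge0 L : (0 <= Zint L)%E.
Proof. by apply: integral_ge0 => x _; rewrite lee_fin powR_ge0. Qed.

Lemma le_Zint L L' : 0 < L -> L <= L' -> (Zint L' <= Zint L)%E.
Proof.
move=> L0 LL'; apply: nn_le_integral => x _; rewrite lee_fin ?powR_ge0//.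
by apply: ler_powRN; rewrite ?(ltW s0) ?ltr_wpDr ?ker_ge0// lerD2r.
Qed.

Lemma Zint_small eps : 0 < eps ->
  exists2 L, 0 < L & forall L', L <= L' -> (Zint L' <= eps%:E)%E.
Proof.
move=> e0; have [K K0 ZK] := Zint_decay.
have c0 : 0 < (1 - th) * s by rewrite mulr_gt0// subr_gt0; case/andP: th01.
pose T := Order.max 1 ((K / eps) `^ ((1 - th) * s)^-1).
have T1 : 1 <= T by rewrite le_max lexx.
exists T; first by apply: lt_le_trans T1.
move=> L' TL'; apply: le_trans (ZK _ (le_trans T1 TL')) _.
have L'0 : 0 < L' by apply: lt_le_trans (le_trans T1 TL').
rewrite lee_fin powRN ler_pdivrMr ?powR_gt0// mulrC -ler_pdivrMr//.
have -> : K / eps = ((K / eps) `^ ((1 - th) * s)^-1) `^ ((1 - th) * s).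
  by rewrite -powRrM mulVf ?gt_eqF// powRr1// divr_ge0// ltW.
apply: ge0_ler_powR; rewrite ?nnegrE ?powR_ge0 ?(ltW c0) ?(ltW L'0)//.
by apply: le_trans TL'; rewrite le_max lexx orbT.
Qed.

Lemma Zint_lty L : 0 < L -> (Zint L < +oo)%E.
Proof.
move=> L0; have [K K0 ZK] := Zint_decay.
have Z1 : (Zint 1 < +oo)%E by apply: le_lt_trans (ZK _ (lexx 1)) _; rewrite ltry.
have [L1|L1] := leP 1 L; first by apply: le_lt_trans Z1; exact: le_Zint.
(* For [L < 1], [L + k >= L (1 + k)], which reduces to the case [L = 1]. *)
apply: (@le_lt_trans _ _ (\int[nu]_(x in D) ((L `^ (- s))%:E * ((1 + ker x 0) `^ (- s))%:E))%E).
  apply: nn_le_integral => x _; first by rewrite lee_fin powR_ge0.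
  have k0 := ker_ge0 b x 0.
  rewrite -EFinM lee_fin -powRM ?(ltW L0)//; last lra.
  by apply: ler_powRN; rewrite ?(ltW s0)// ?mulr_gt0//; nra.
rewrite (ge0_integralZl_EFin _ mD); last 3 first.
- by move=> x _; rewrite lee_fin powR_ge0.
- apply: measurable_funTS; apply/measurable_EFinP.
  by apply: measurable_fun_powRl; apply: measurable_funD => //; exact: measurable_ker2.
- by rewrite powR_ge0.
by apply: lte_mul_pinfty => //; rewrite lee_fin powR_ge0.
Qed.

Lemma Zint_translate L y :
  (\int[nu]_(x in D) ((L + ker x y) `^ (- s))%:E = Zint L)%E.
Proof.
pose F x := ((L + ker x y) `^ (- s))%:E.
have mF : measurable_fun setT F.
  apply/measurable_EFinP; apply: measurable_fun_powRl; apply: measurable_funD => //.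
  exact: measurable_ker2.
have F0 x : (0 <= F x)%E by rewrite lee_fin powR_ge0.
have FE x : F (x.1 + y, x.2) = ((L + ker x 0) `^ (- s))%:E.
  by rewrite /F /ker /dist /= addrK subr0.
apply: etrans (esym (upper_translate y mF F0)) _.
by apply: eq_integral => x _; rewrite FE.
Qed.

Lemma mass_fine_ext f x L : good f -> 0 <= L ->
  (\int[mu]_y ((L + ker x y) * f y)%:E = (L * fine (mass f) + fine (ext f x))%:E)%E.
Proof.
move=> gf L0; have [mf f0 _ _ _] := gf.
rewrite EFinD EFinM (massK gf) (extK _ gf) -(ge0_integralZl_EFin _ measurableT)//; last 2 first.
- by move=> y _; rewrite lee_fin.
- exact/measurable_EFinP.
rewrite -ge0_integralD//.
- by apply: eq_integral => y _; rewrite -EFinM -EFinD; congr EFin; ring.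
- by move=> y _; rewrite -EFinM lee_fin mulr_ge0.
- by apply: measurable_funeM; exact/measurable_EFinP.
- by move=> y _; rewrite lee_fin mulr_ge0 ?ker_ge0.
- exact: measurable_kerM1.
Qed.

(* Jensen's inequality for [f dy / mass f], through the tangent inequality. *)
Lemma mass_jensen f x L : good f -> 0 < L ->
  ((fine (mass f) * ((L * fine (mass f) + fine (ext f x)) / fine (mass f)) `^ (- s))%:E <=
   \int[mu]_y ((L + ker x y) `^ (- s) * f y)%:E)%E.
Proof.
move=> gf L0; have [mf f0 _ _ _] := gf.
have M0 := fine_mass_gt0 gf; set M := fine (mass f) in M0 *.
have A0 : 0 <= fine (ext f x) by rewrite fine_ge0// ext_ge0.
set W := L * M + fine (ext f x).
have W0 : 0 < W by rewrite /W ltr_wpDr// mulr_gt0.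
(* [P] is the mean of [L + ker x y] against [f dy / M]; the tangent is taken at this point. *)
set P := W / M; have P0 : 0 < P by rewrite divr_gt0.
have mJ : measurable_fun setT (fun y => ((L + ker x y) `^ (- s) * f y)%:E).
  apply/measurable_EFinP; apply: measurable_funM => //; apply: measurable_fun_powRl.
  by apply: measurable_funD => //; exact: measurable_ker1.
have mW : measurable_fun setT (fun y => ((L + ker x y) * f y)%:E).
  apply/measurable_EFinP; apply: measurable_funM => //.
  by apply: measurable_funD => //; exact: measurable_ker1.
have mfE : measurable_fun setT (fun y => (f y)%:E) by exact/measurable_EFinP.
have k0 y : 0 <= ker x y := ker_ge0 b x y.
have Lk y : 0 < L + ker x y by rewrite ltr_wpDr.
have Lkf y : 0 <= (L + ker x y) * f y by rewrite mulr_ge0// ltW.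
have c1 : 0 <= (1 + s) * P `^ (- s) by rewrite mulr_ge0 ?powR_ge0//; move: s0; lra.
have c2 : 0 <= s * P `^ (- s - 1) by rewrite mulr_ge0 ?powR_ge0// ltW.
have : (((1 + s) * P `^ (- s))%:E * mass f <=
   (s * P `^ (- s - 1))%:E * \int[mu]_y ((L + ker x y) * f y)%:E +
   \int[mu]_y ((L + ker x y) `^ (- s) * f y)%:E)%E.
  rewrite -(ge0_integralZl_EFin _ measurableT _ mfE c1); last by move=> y _; rewrite lee_fin.
  rewrite -(ge0_integralZl_EFin _ measurableT _ mW c2); last by move=> y _; rewrite lee_fin.
  rewrite -ge0_integralD//.
  - apply: nn_le_integral => y _; rewrite -!EFinM -?EFinD lee_fin.
      by rewrite mulr_ge0.
    have := ler_wpM2r (f0 y) (powRN_tangent s0 (Lk y) P0); lra.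
  - by move=> y _; rewrite -EFinM lee_fin mulr_ge0.
  - exact: measurable_funeM.
  - by move=> y _; rewrite lee_fin mulr_ge0 ?powR_ge0.
rewrite mass_fine_ext ?(ltW L0)// -(massK gf) -/M -/W -!EFinM.
have WM : W = P * M by rewrite /P divfK ?gt_eqF.
have -> : s * P `^ (- s - 1) * W = s * (M * P `^ (- s)).
  by rewrite WM -(mulr_powRNB1 s P0); ring.
have : (0 <= \int[mu]_y ((L + ker x y) `^ (- s) * f y)%:E)%E.
  by apply: integral_ge0 => y _; rewrite lee_fin mulr_ge0 ?powR_ge0.
case: (integral _ _ _) => [r _| _ _|]//; last by rewrite leey.
by rewrite -EFinD !lee_fin; lra.
Qed.

Definition ballmass f y r : \bar R :=
  (\int[mu]_z (f z * \1_[set z | (enorm (y - z) <= r)%R] z)%:E)%E.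

Lemma measurable_ballmass f y r : measurable_fun setT f ->
  measurable_fun setT (fun z => (f z * \1_[set z | (enorm (y - z) <= r)%R] z)%:E).
Proof.
move=> mf; have mB : measurable [set z | (enorm (y - z) <= r)%R].
  rewrite (_ : mkset _ = setT `&` (fun z => enorm (y - z)) @^-1` `]-oo, r]); last first.
    by rewrite setTI; apply/seteqP; split=> v /=; rewrite in_itv.
  have : measurable_fun setT (fun z : Y => enorm (y - z)); last by apply.
  apply: measurableT_comp (@measurable_enorm R n) _.
  by apply: measurable_rV_addfun => //; exact: measurable_rV_opp.
by apply/measurable_EFinP; apply: measurable_funM => //; exact: measurable_indic.
Qed.

(** At least half of the mass lies farther than [r] from [x.1], where the kernel is at least
    [r ^ b]. *)
Lemma ext_far f x r : good f -> 0 < r -> (ballmass f x.1 r <= (fine (mass f) / 2)%:E)%E ->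
  r `^ b / 2 * fine (mass f) <= fine (ext f x).
Proof.
move=> gf r0 Hball; have [mf f0 _ _ _] := gf.
set M := fine (mass f); set L := r `^ b / 2.
have mfE : measurable_fun setT (fun y => (f y)%:E) by exact/measurable_EFinP.
have m1 := measurable_ballmass x.1 r mf.
have H : ((r `^ b)%:E * mass f <= ext f x +
    (r `^ b)%:E * \int[mu]_z (f z * \1_[set z | (enorm (x.1 - z) <= r)%R] z)%:E)%E.
  have rb : 0 <= r `^ b by exact: powR_ge0.
  rewrite -(ge0_integralZl_EFin _ measurableT _ mfE rb); last by move=> z _; rewrite lee_fin.
  rewrite -(ge0_integralZl_EFin _ measurableT _ m1 rb); last first.
    by move=> z _; rewrite lee_fin mulr_ge0.
  rewrite -ge0_integralD//.
  - apply: nn_le_integral => z _; rewrite -!EFinM -?EFinD lee_fin.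
      by rewrite mulr_ge0 ?powR_ge0.
    have [zr|zr] := leP (enorm (x.1 - z)) r.
      by rewrite indicE mem_set//= mulr1 lerDr mulr_ge0 ?ker_ge0.
    rewrite indicE memNset/= ?mulr0 ?addr0; last by apply/negP; rewrite -ltNge.
    rewrite ler_wpM2r//; apply: ge0_ler_powR; rewrite ?nnegrE ?dist_ge0 ?(ltW b0) ?(ltW r0)//.
    exact: le_trans (ltW zr) (ger_dist_enorm _ _).
  - by move=> z _; rewrite lee_fin mulr_ge0 ?ker_ge0.
  - exact: measurable_kerM1.
  - by move=> z _; rewrite -EFinM lee_fin !mulr_ge0 ?powR_ge0.
  - exact: measurable_funeM.
have rb : (0 <= (r `^ b)%:E)%E by rewrite lee_fin powR_ge0.
have := le_trans H (leeD2l (ext f x) (lee_wpmul2l rb Hball)).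
rewrite -(massK gf) -(extK _ gf) -!EFinM -EFinD lee_fin -/M /L/=; lra.
Qed.

(** By [ext_far], [ext f x >= L M] for [L = r ^ b / 2], so [ext f x] is at least [M / 2] times the
    mean of [L + ker x y]. Jensen's inequality bounds its power [- s] by the mean of
    [(L + ker x y) ^ (- s)], whose integral over [x] is [Zint L] whatever [y] is. *)
Lemma energy_le_Zint f r : good f -> 0 < r ->
  (forall y, (ballmass f y r <= (fine (mass f) / 2)%:E)%E) ->
  (energy f <= ((fine (mass f) / 2) `^ (- s))%:E * Zint (r `^ b / 2))%E.
Proof.
move=> gf r0 Hball; have [mf f0 _ _ _] := gf.
have M0 := fine_mass_gt0 gf; set M := fine (mass f) in M0 *.
set L := r `^ b / 2; have L0 : 0 < L by rewrite divr_gt0// powR_gt0.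
have mfE : measurable_fun setT (fun y => (f y)%:E) by exact/measurable_EFinP.
have far x : L * M <= fine (ext f x) by exact: ext_far.
have M2 : 0 < M / 2 by rewrite divr_gt0.
have key x : D x -> ((M * fine (ext f x) `^ (- s))%:E <= ((M / 2) `^ (- s))%:E *
    \int[mu]_y ((L + ker x y) `^ (- s) * f y)%:E)%E.
  move=> Dx; have A0 := fine_ext_gt0 Dx gf.
  have c0 : (0 <= ((M / 2) `^ (- s))%:E)%E by rewrite lee_fin powR_ge0.
  apply: le_trans (lee_wpmul2l c0 (mass_jensen x gf L0)).
  have W0 : 0 < L * M + fine (ext f x) by rewrite addr_gt0// mulr_gt0.
  rewrite -/M -EFinM lee_fin mulrCA ler_pM2l// -powRM; [|exact: ltW|by rewrite divr_ge0// ltW].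
  apply: ler_powRN; [exact: ltW|exact: mulr_gt0 M2 (divr_gt0 W0 M0)|].
  have -> : M / 2 * ((L * M + fine (ext f x)) / M) = (L * M + fine (ext f x)) / 2.
    by field; rewrite gt_eqF.
  by have := far x; lra.
have mF : measurable_fun setT (fun z : X * Y => ((L + ker z.1 z.2) `^ (- s) * f z.2)%:E).
  apply/measurable_EFinP; apply: measurable_funM; last exact: measurableT_comp mf measurable_snd.
  by apply: measurable_fun_powRl; apply: measurable_funD => //; exact: measurable_ker.
have F0 (z : X * Y) : (0 <= ((L + ker z.1 z.2) `^ (- s) * f z.2)%:E)%E.
  by rewrite lee_fin mulr_ge0 ?powR_ge0.
have mE : measurable_fun D (fun x => (fine (ext f x) `^ (- s))%:E).
  apply: measurable_funTS; apply/measurable_EFinP.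
  apply: measurable_fun_powRl; apply: measurableT_comp => //; exact: measurable_ext.
have : (M%:E * energy f <= M%:E * (((M / 2) `^ (- s))%:E * Zint L))%E.
  rewrite -(ge0_integralZl_EFin _ mD _ mE (ltW M0)); last by move=> ? _; rewrite lee_fin powR_ge0.
  apply: (@le_trans _ _ (\int[nu]_(x in D) (((M / 2) `^ (- s))%:E *
    \int[mu]_y ((L + ker x y) `^ (- s) * f y)%:E))%E).
    apply: nn_le_integral => x Dx; last by rewrite -EFinM; exact: key.
    by rewrite -EFinM lee_fin mulr_ge0 ?powR_ge0// ltW.
  rewrite (ge0_integralZl_EFin _ mD); last 3 first.
  - by move=> x _; apply: integral_ge0 => y _; exact: (F0 (x, y)).
  - apply: measurable_funTS.
    exact: (measurable_fun_fubini_tonelli_F (m2 := mu) _ mF F0).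
  - exact: powR_ge0.
  rewrite (upper_tonelli (F := fun x y => ((L + ker x y) `^ (- s) * f y)%:E) mF); last first.
    by move=> x y; exact: (F0 (x, y)).
  rewrite muleCA; apply: lee_wpmul2l; first by rewrite lee_fin powR_ge0.
  rewrite /M (massK gf) -(ge0_integralZr _ measurableT mfE); last 2 first.
  - by move=> y _; rewrite lee_fin.
  - exact: Zint_ge0.
  rewrite le_eqVlt; apply/orP; left; apply/eqP; apply: eq_integral => y _.
  rewrite -(Zint_translate L y) muleC -(ge0_integralZr _ mD); last 3 first.
  - apply: measurable_funTS; apply/measurable_EFinP.
    by apply: measurable_fun_powRl; apply: measurable_funD => //; exact: measurable_ker2.
  - by move=> x _; rewrite lee_fin powR_ge0.
  - by rewrite lee_fin.
  by apply: eq_integral => x _; rewrite EFinM.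
by rewrite lee_pmul2l// lte_fin.
Qed.

End energy.

(** The tangent inequality for [a / v] at [b / u] with the powers expanded. In the reverse Hoelder
    inequality [u] and [v] are the norms by which the two functions are normalized. *)
Lemma powRN_tangent_scaled (R : realType) (a b u v s : R) :
  0 < s -> 0 < a -> 0 < b -> 0 < u -> 0 < v ->
  (1 + s) * u `^ s * b `^ (- s) <=
  s * (u `^ (1 + s) / v) * (a * b `^ (- s - 1)) + v `^ s * a `^ (- s).
Proof.
move=> s0 a0 b0 u0 v0.
have pw (x y c : R) : 0 < x -> 0 < y -> (x / y) `^ c = x `^ c * y `^ (- c).
  move=> x0 y0; rewrite powRM ?invr_ge0 ?(ltW x0) ?(ltW y0)//; congr (_ * _).
  by rewrite -[y^-1]powR_inv1 ?(ltW y0)// -powRrM mulN1r.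
have := powRN_tangent s0 (divr_gt0 a0 v0) (divr_gt0 b0 u0).
rewrite (pw _ _ (- s - 1) b0 u0) (pw _ _ (- s) b0 u0) (pw _ _ (- s) a0 v0).
rewrite opprB !opprK => H.
by apply: le_trans (le_trans _ H) _; rewrite le_eqVlt; apply/orP; left; apply/eqP; ring.
Qed.

(** * Finiteness of the energy, concavity and supergradient of the norm *)

Section variational.
Context (R : realType) (n : nat) (b s : R).
Hypotheses (b0 : 0 < b) (s0 : 0 < s) (bs : n.+1%:R < b * s) (n0 : (0 < n)%N).
Local Notation Y := 'rV[R]_n.
Local Notation X := ('rV[R]_n * measurableTypeR R)%type.
Local Notation mu := (lebesgue_rV R n).
Local Notation nu := (lebesgue_rV R n \x @lebesgue_measure R)%E.
Local Notation D := (@upper R n).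
Local Notation ker := (@ker R n b).
Local Notation ext := (@ext R n b).
Local Notation good := (@good R n b).
Local Notation energy := (@energy R n b s).
Implicit Types (f g : Y -> R) (x : X) (y z : Y).

Let mD : measurable D := @measurable_upper R n.

Let cubeat (v : Y) r := [set y : Y | cube r (y - v)].

Let measurable_cube_at (v : Y) r : measurable (cubeat v r).
Proof.
have := measurable_rV_add (- v) measurableT (@measurable_cube R n r).
by rewrite setTI.
Qed.

(** Turns a property that holds almost everywhere into a point close to a prescribed one. *)
Lemma ae_cube_exists (P : Y -> Prop) v r : 0 < r -> {ae mu, forall y, P y} ->
  exists2 y, P y & cube r (y - v).
Proof.
move=> r0 [A [mA A0 PA]]; apply: contrapT => H.
have sub : cubeat v r `<=` A.
  by move=> y /= cy; apply: PA => /= Py; apply: H; exists y.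
have mC := measurable_cube_at v r.
have : (mu (cubeat v r) <= 0)%E.
  by rewrite -A0; apply: le_measure; rewrite ?inE.
rewrite -(setIT (cubeat v r)) -integral_indic//.
have -> : (\int[mu]_y (\1_(cubeat v r) y)%:E =
    \int[mu]_y (\1_(@cube R n r) (y - v)%R)%:E)%E.
  by apply: eq_integral => y _; congr EFin; apply: eq_indic.
rewrite (nn_integral_translate (f := fun y => (\1_(@cube R n r) y)%:E)); last 2 first.
- by apply/measurable_EFinP; apply: measurable_indic; exact: measurable_cube.
- by move=> y; rewrite lee_fin.
rewrite integral_indic//; last exact: measurable_cube.
have : (0 < mu (@cube R n r))%E.
  by rewrite lebesgue_cube ?ltW// lte_fin exprn_gt0// mulr_gt0.
by rewrite setIT ltNge => /negP.
Qed.

Lemma ae_upper_exists (P : X -> Prop) v r : 0 < r -> {ae nu, forall x, D x -> P x} ->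
  exists x, [/\ D x, P x & cube r (x.1 - v)].
Proof.
move=> r0 [A [mA A0 PA]]; apply: contrapT => H.
pose C : set X := (cubeat v r) `*` `]0%R, 1%R]%classic.
have mC' := measurable_cube_at v r.
have mC : measurable C by exact: measurableX.
have sub : C `<=` A.
  move=> x [/= cx]; rewrite in_itv/= => /andP[x0 _].
  by apply: PA => /= Px; apply: H; exists x; split => //; exact: Px.
have : (nu C <= 0)%E by rewrite -A0; apply: le_measure; rewrite ?inE.
rewrite leNgt => /negP; apply; rewrite product_measure1E//; apply: mule_gt0.
  rewrite lt_neqAle measure_ge0 andbT eq_sym; apply/negP => /eqP C0.
  have ae0 : {ae mu, forall y, ~ cube r (y - v)}.
    exists (cubeat v r); split => // y /=; exact: contrapT.
  by have [y] := ae_cube_exists v r0 ae0.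
have : (0 < @lebesgue_measure R `]0%R, 1%R]%classic)%E.
  by rewrite lebesgue_measure_itv/= lte_fin ltr01 oppr0 adde0 lte_fin.
exact.
Qed.

Lemma energy_ge0 f : (0 <= energy f)%E.
Proof. by apply: integral_ge0 => x _; rewrite lee_fin powR_ge0. Qed.

Lemma measurable_fine_ext f c : good f ->
  measurable_fun D (fun x => (fine (ext f x) `^ c)%:E).
Proof.
move=> [mf f0 _ _ _]; apply: measurable_funTS; apply/measurable_EFinP.
by apply: measurable_fun_powRl; apply: measurableT_comp => //; exact: measurable_ext.
Qed.

Lemma energy_gt0 f : good f -> (0 < energy f)%E.
Proof.
move=> gf; rewrite lt_neqAle energy_ge0 andbT eq_sym; apply/negP => /eqP E0.
have := integral_eq0_ae mD (measurable_fine_ext (- s) gf) _ E0.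
move=> /(_ (fun x _ => _)) H.
have [x|x [Dx [xE] _]] := ae_upper_exists 0 ltr01 (H _); first by rewrite lee_fin powR_ge0.
by have := powR_gt0 (- s) (fine_ext_gt0 Dx gf); rewrite xE ltxx.
Qed.

Lemma ball_mass_le f r y : measurable_fun setT f -> (forall y, 0 <= f y <= 1) -> 0 <= r ->
  (ballmass f y r <= ((2 * r) ^+ n)%:E)%E.
Proof.
move=> mf f01 r0.
have -> : ((2 * r) ^+ n)%:E = (\int[mu]_z (\1_(@cube R n r) (z - y)%R)%:E)%E.
  rewrite (nn_integral_translate (f := fun y => (\1_(@cube R n r) y)%:E)); last 2 first.
  - by apply/measurable_EFinP; apply: measurable_indic; exact: measurable_cube.
  - by move=> z; rewrite lee_fin.
  rewrite integral_indic//; last exact: measurable_cube.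
  by rewrite setIT; apply/esym; exact: lebesgue_cube.
have f0 z : 0 <= f z by case/andP: (f01 z).
apply: nn_le_integral => z _; rewrite lee_fin ?mulr_ge0//.
have [/set_mem/= h|h] := boolP (z \in [set z | (enorm (y - z) <= r)%R]).
  rewrite !indicE mem_set// mem_set; last by apply: enorm_cube; rewrite -enormN opprB.
  by rewrite mulr1; case/andP: (f01 z).
by rewrite indicE (negbTE h) mulr0.
Qed.

(** Truncation at height 1 raises the energy, the exponent being negative, and a function bounded by
    1 cannot concentrate: balls of radius [r] with [(2 r) ^ n = M / 2] carry at most half of its
    mass. *)
Lemma energy_lty f : good f -> (energy f < +oo)%E.
Proof.
move=> gf0; pose f1 y := Order.min (f y) 1.
have gf : good f1 by exact: good_minr1.
apply: (@le_lt_trans _ _ (energy f1)).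
  apply: nn_le_integral => x Dx; first by rewrite lee_fin powR_ge0.
  rewrite lee_fin; apply: ler_powRN; [exact: ltW|exact: fine_ext_gt0|].
  rewrite -lee_fin (extK _ gf0) (extK _ gf); apply: le_ext; first by case: gf.
  by move=> y; rewrite ge_min lexx.
have [mf f0 _ _ _] := gf.
have M0 := fine_mass_gt0 gf; set M := fine (mass f1) in M0 *.
pose r := (M / 2) `^ (n%:R)^-1 / 2.
have r0 : 0 < r by apply: divr_gt0 => //; apply: powR_gt0; apply: divr_gt0.
have rM : (2 * r) ^+ n = M / 2.
  have -> : 2 * r = (M / 2) `^ (n%:R)^-1 by rewrite /r; field.
  rewrite -powR_mulrn ?powR_ge0// -powRrM mulVf ?pnatr_eq0 -?lt0n// powRr1//.
  by rewrite divr_ge0// ltW.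
apply: (@le_lt_trans _ _ (((M / 2) `^ (- s))%:E * Zint n b s (r `^ b / 2))%E).
  apply: energy_le_Zint => // y; rewrite -/M -rM; apply: ball_mass_le => //; last exact: ltW.
  by move=> z; rewrite f0 ge_min lexx orbT.
apply: lte_mul_pinfty; rewrite ?lee_fin ?powR_ge0//.
by apply: Zint_lty => //; rewrite divr_gt0// powR_gt0.
Qed.

Lemma energyK f : good f -> (fine (energy f))%:E = energy f.
Proof. by move=> gf; rewrite fineK// ge0_fin_numE ?energy_ge0// energy_lty. Qed.

Lemma fine_energy_gt0 f : good f -> 0 < fine (energy f).
Proof. by move=> gf; rewrite -lte_fin energyK// energy_gt0. Qed.

Definition nrm f : R := fine (energy f) `^ (- s^-1).

Lemma nrm_gt0 f : good f -> 0 < nrm f.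
Proof. by move=> gf; rewrite powR_gt0// fine_energy_gt0. Qed.

Lemma nrm_powN f : good f -> nrm f `^ (- s) = fine (energy f).
Proof.
move=> gf; rewrite /nrm -powRrM mulrNN mulVf ?gt_eqF// powRr1// ltW//.
exact: fine_energy_gt0.
Qed.

(** Up to the factor [- s], the derivative of [energy] at [f] in the direction of a unit mass at
    [y]. Multiplied by [nrm f ^ (1 + s)] it becomes the supergradient of [nrm]. *)
Definition pot f y : \bar R := (\int[nu]_(x in D) (ker x y * fine (ext f x) `^ (- s - 1))%:E)%E.

Lemma pot_ge0 f y : (0 <= pot f y)%E.
Proof. by apply: integral_ge0 => x _; rewrite lee_fin mulr_ge0 ?powR_ge0. Qed.

Lemma measurable_pot_integrand f : good f ->
  measurable_fun setT (fun z : X * Y => (ker z.1 z.2 * fine (ext f z.1) `^ (- s - 1))%:E).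
Proof.
move=> [mf f0 _ _ _]; apply/measurable_EFinP; apply: measurable_funM.
  exact: measurable_ker.
apply: measurable_fun_powRl; apply: measurableT_comp => //.
by apply: (measurableT_comp (measurable_ext b mf f0)); exact: measurable_fst.
Qed.

Lemma measurable_pot f : good f -> measurable_fun setT (pot f).
Proof.
move=> gf; apply: measurable_upper_integral; first exact: measurable_pot_integrand.
by move=> x y; rewrite lee_fin mulr_ge0 ?powR_ge0.
Qed.

Lemma integral_pot f g : good f -> good g ->
  (\int[mu]_y ((g y)%:E * pot f y) =
   \int[nu]_(x in D) (fine (ext g x) * fine (ext f x) `^ (- s - 1))%:E)%E.
Proof.
move=> gf gg; have [mg g0 _ _ _] := gg.
pose F x y := (g y * (ker x y * fine (ext f x) `^ (- s - 1)))%:E.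
have mpi := measurable_pot_integrand gf.
have mF : measurable_fun setT (fun z : X * Y => F z.1 z.2).
  apply/measurable_EFinP; apply: measurable_funM.
    exact: measurableT_comp mg measurable_snd.
  exact/measurable_EFinP.
have F0 x y : (0 <= F x y)%E by rewrite lee_fin !mulr_ge0 ?powR_ge0.
transitivity (\int[mu]_y \int[nu]_(x in D) F x y)%E.
  apply: eq_integral => y _; rewrite -(ge0_integralZl_EFin _ mD)//.
  - by move=> x _; rewrite lee_fin mulr_ge0 ?powR_ge0.
  - apply: measurable_funTS.
    by have : measurable_fun setT ((fun z : X * Y => (ker z.1 z.2 * fine (ext f z.1) `^ (- s - 1))%:E) \o pair^~ y)
      by apply: measurableT_comp mpi _; exact: pair2_measurable.
rewrite -(upper_tonelli mF F0); apply: eq_integral => x _.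
rewrite [RHS]EFinM (extK _ gg) -(ge0_integralZr _ measurableT); last 3 first.
- exact: measurable_kerM1.
- by move=> y _; rewrite lee_fin mulr_ge0 ?powR_ge0.
- by rewrite lee_fin powR_ge0.
by apply: eq_integral => y _; rewrite -EFinM /F; congr EFin; ring.
Qed.

(** Euler's identity for a functional homogeneous of degree one; it is the equality case of the
    supergradient inequality. *)
Lemma nrm_mass_pot f : good f ->
  ((nrm f)%:E = (nrm f `^ (1 + s))%:E * \int[mu]_y ((f y)%:E * pot f y))%E.
Proof.
move=> gf; rewrite integral_pot//.
have -> : (\int[nu]_(x in D) (fine (ext f x) * fine (ext f x) `^ (- s - 1))%:E = energy f)%E.
  apply: eq_integral => x /set_mem Dx; rewrite mulr_powRNB1//.
  exact: fine_ext_gt0.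
rewrite -energyK// -nrm_powN// -EFinM -powRD; last first.
  by apply/implyP => _; rewrite gt_eqF// nrm_gt0.
by rewrite addrK powRr1// ltW// nrm_gt0.
Qed.

(* Reverse Hoelder inequality: [nrm] is concave, and [pot f] is its supergradient at [f]. *)
Lemma nrm_le_pot f g : good f -> good g ->
  ((nrm g)%:E <= (nrm f `^ (1 + s))%:E * \int[mu]_y ((g y)%:E * pot f y))%E.
Proof.
move=> gf gg; rewrite integral_pot//.
have Nf := nrm_gt0 gf; have Ng := nrm_gt0 gg.
have If := fine_energy_gt0 gf; have Ig := fine_energy_gt0 gg.
have [mf f0 _ _ _] := gf; have [mg g0 _ _ _] := gg.
have e0 x : 0 <= fine (ext g x) by rewrite fine_ge0// ext_ge0.
set T := (\int[nu]_(x in D) _)%E.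
have T0 : (0 <= T)%E by apply: integral_ge0 => x _; rewrite lee_fin mulr_ge0 ?powR_ge0.
have mT : measurable_fun D (fun x => (fine (ext g x) * fine (ext f x) `^ (- s - 1))%:E).
  apply: measurable_funTS; apply/measurable_EFinP; apply: measurable_funM.
    by apply: measurableT_comp => //; exact: measurable_ext.
  by apply: measurable_fun_powRl; apply: measurableT_comp => //; exact: measurable_ext.
pose cf := nrm f `^ s; pose cg := nrm g `^ s.
pose ct := s * (nrm f `^ (1 + s) / nrm g).
have cf0 : 0 <= (1 + s) * cf by rewrite mulr_ge0 ?powR_ge0// addr_ge0// ltW.
have cg0 : 0 <= cg by exact: powR_ge0.
have ct0 : 0 <= ct by rewrite mulr_ge0 ?divr_ge0 ?powR_ge0 ?(ltW s0) ?(ltW Ng).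
have : (((1 + s) * cf)%:E * energy f <= ct%:E * T + cg%:E * energy g)%E.
  rewrite -(ge0_integralZl_EFin _ mD _ (measurable_fine_ext _ gf) cf0); last first.
    by move=> x _; rewrite lee_fin powR_ge0.
  rewrite -(ge0_integralZl_EFin _ mD _ mT ct0); last first.
    by move=> x _; rewrite lee_fin mulr_ge0 ?powR_ge0.
  rewrite -(ge0_integralZl_EFin _ mD _ (measurable_fine_ext _ gg) cg0); last first.
    by move=> x _; rewrite lee_fin powR_ge0.
  have h1 x : D x -> (0 <= ct%:E * (fine (ext g x) * fine (ext f x) `^ (- s - 1))%:E)%E.
    by move=> _; rewrite -EFinM lee_fin mulr_ge0// mulr_ge0 ?powR_ge0.
  have h2 x : D x -> (0 <= cg%:E * (fine (ext g x) `^ (- s))%:E)%E.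
    by move=> _; rewrite -EFinM lee_fin mulr_ge0 ?powR_ge0.
  have m2 := measurable_funeM cg%:E (measurable_fine_ext (- s) gg).
  rewrite -(ge0_integralD _ mD h1 (measurable_funeM ct%:E mT) h2 m2).
  apply: nn_le_integral => x Dx; rewrite -!EFinM -?EFinD lee_fin.
    by rewrite mulr_ge0 ?powR_ge0.
  have A0 := fine_ext_gt0 Dx gg; have B0 := fine_ext_gt0 Dx gf.
  exact: powRN_tangent_scaled.
(* After division by the norms both energies equal 1, and the integrated tangent inequality reads
   [1 + s <= ct T + 1]. *)
have cE h : good h -> nrm h `^ s * fine (energy h) = 1.
  move=> gh; have N0 := nrm_gt0 gh; rewrite -(nrm_powN gh) powRN.
  exact: mulfV (lt0r_neq0 (powR_gt0 s N0)).
have Ef : (((1 + s) * cf)%:E * energy f = (1 + s)%:E)%E.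
  by rewrite -(energyK gf) -EFinM -mulrA (cE f gf) mulr1.
have Eg : (cg%:E * energy g = 1)%E.
  by rewrite -(energyK gg) -EFinM (cE g gg).
rewrite [X in (X <= _)%E]Ef [X in (_ <= _ + X)%E]Eg; clearbody T.
have c1 : 0 < nrm f `^ (1 + s) by rewrite powR_gt0.
case: T T0 => [t t0| |]//; last first.
  by move=> _ _; rewrite gt0_muley ?lte_fin// leey.
rewrite -!EFinM -EFinD !lee_fin /ct => H.
have H2 : s * 1 <= s * (nrm f `^ (1 + s) * t / nrm g).
  rewrite mulr1 -(lerD2l 1); apply: le_trans H _; rewrite addrC lerD2l.
  by rewrite le_eqVlt; apply/orP; left; apply/eqP; rewrite -!mulrA [_^-1 * _]mulrC.
by move: H2; rewrite ler_pM2l// ler_pdivlMr// mul1r.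
Qed.

End variational.

(** * Concentration and equicontinuity *)

Lemma ler_mulAC (R : realDomainType) (x y z t u : R) :
  0 <= z -> x * y <= t * u -> x * z * y <= t * z * u.
Proof. by move=> z0 h; rewrite mulrAC (mulrAC t) ler_wpM2r. Qed.

Section near_maximizers.
Context (R : realType) (n : nat) (b s : R).
Hypotheses (b0 : 0 < b) (s0 : 0 < s) (bs : n.+1%:R < b * s) (n0 : (0 < n)%N).
Local Notation Y := 'rV[R]_n.
Local Notation X := ('rV[R]_n * measurableTypeR R)%type.
Local Notation mu := (lebesgue_rV R n).
Local Notation nu := (lebesgue_rV R n \x @lebesgue_measure R)%E.
Local Notation D := (@upper R n).
Local Notation ker := (@ker R n b).
Local Notation ext := (@ext R n b).
Local Notation good := (@good R n b).
Local Notation energy := (@energy R n b s).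
Local Notation nrm := (@nrm R n b s).
Local Notation pot := (@pot R n b s).
Implicit Types (f g : Y -> R) (x : X) (y z w : Y).

Let mD : measurable D := @measurable_upper R n.

Definition shift f w y := f (y + w).

Lemma measurable_shift f w : measurable_fun setT f -> measurable_fun setT (shift f w).
Proof. by move=> mf; apply: measurableT_comp mf _; exact: measurable_rV_add. Qed.

Lemma mass_shift f w : measurable_fun setT f -> (forall y, 0 <= f y) ->
  mass (shift f w) = mass f.
Proof.
move=> mf f0; apply: (nn_integral_translate (f := fun y => (f y)%:E) w).
  exact/measurable_EFinP.
by move=> y; rewrite lee_fin.
Qed.

Lemma ext_shift f w x : measurable_fun setT f -> (forall y, 0 <= f y) ->
  ext (shift f w) x = ext f (x.1 + w, x.2).
Proof.
move=> mf f0; pose F y := (ker (x.1 + w, x.2) y * f y)%:E.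
have mF : measurable_fun setT F by exact: measurable_kerM1.
have F0 y : (0 <= F y)%E by rewrite lee_fin mulr_ge0 ?ker_ge0.
rewrite -[RHS](nn_integral_translate w mF F0).
have FE y : F (y + w) = (ker x y * shift f w y)%:E.
  by rewrite /F /shift /ker /dist /= opprD addrACA subrr addr0.
by apply: eq_integral => y _; rewrite FE.
Qed.

Lemma good_shift f w : good f -> good (shift f w).
Proof.
move=> [mf f0 M0 Mf Ef]; split.
- exact: measurable_shift.
- by move=> y; exact: f0.
- by rewrite mass_shift.
- by rewrite mass_shift.
- by move=> x; rewrite ext_shift.
Qed.

Lemma energy_shift f w : good f -> energy (shift f w) = energy f.
Proof.
move=> gf; have [mf f0 _ _ _] := gf.
pose F x := (fine (ext f x) `^ (- s))%:E.
have mF : measurable_fun setT F.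
  apply/measurable_EFinP; apply: measurable_fun_powRl; apply: measurableT_comp => //.
  exact: measurable_ext.
have F0 x : (0 <= F x)%E by rewrite lee_fin powR_ge0.
rewrite -[RHS](upper_translate w mF F0).
by apply: eq_integral => x _; rewrite ext_shift.
Qed.

Lemma nrm_shift f w : good f -> nrm (shift f w) = nrm f.
Proof. by move=> gf; rewrite /nrm energy_shift. Qed.

Lemma ballmass_shift f w y r : measurable_fun setT f -> (forall y, 0 <= f y) ->
  ballmass (shift f w) y r = ballmass f (y + w) r.
Proof.
move=> mf f0; pose F z := (f z * \1_[set z | (enorm (y + w - z) <= r)%R] z)%:E.
have mF : measurable_fun setT F by exact: measurable_ballmass.
have F0 z : (0 <= F z)%E by rewrite lee_fin mulr_ge0.
rewrite -[RHS](nn_integral_translate w mF F0).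
have FE z : F (z + w) = (shift f w z * \1_[set z | (enorm (y - z) <= r)%R] z)%:E.
  rewrite /F /shift; congr (_ * _)%:E.
  by apply: eq_indic => /=; rewrite opprD addrACA subrr addr0.
by apply: eq_integral => z _; rewrite FE.
Qed.

(* If no ball of radius [r] carries half of the mass, then [energy f] is at most
   [(mass f / 2) ^ (- s) Zint (r ^ b / 2)], too little for [nrm f <= mass f] when [r] is large. *)
Lemma concentration : exists2 r, 0 < r & forall f, good f -> nrm f <= fine (mass f) ->
  exists y, ((fine (mass f) / 2)%:E < ballmass f y r)%E.
Proof.
(* [M ^ (- s) = (M / 2) ^ (- s) 2 ^ (- s)], so once [Zint] is at most half of [2 ^ (- s)] the bound
   [nrm f <= M] fails. *)
have e0 : 0 < (2 : R) `^ (- s) / 2 by rewrite divr_gt0// powR_gt0.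
have [L L0 ZL] := Zint_small b0 s0 bs e0.
exists ((2 * L) `^ b^-1); first by rewrite powR_gt0// mulr_gt0.
move=> f gf Nf; apply: contrapT => H.
have M0 := fine_mass_gt0 gf; set M := fine (mass f) in M0 Nf H *.
have r0 : 0 < (2 * L) `^ b^-1 by rewrite powR_gt0// mulr_gt0.
have : (energy f <= ((M / 2) `^ (- s))%:E * Zint n b s (((2 * L) `^ b^-1) `^ b / 2))%E.
  apply: energy_le_Zint => // y; rewrite leNgt; apply/negP => Hy; apply: H.
  by exists y.
have -> : ((2 * L) `^ b^-1) `^ b / 2 = L.
  by rewrite -powRrM mulVf ?gt_eqF// powRr1 ?mulr_ge0 ?(ltW L0)// mulrC mulKf.
have p0 : (0 <= ((M / 2) `^ (- s))%:E)%E by rewrite lee_fin powR_ge0.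
move=> /le_trans /(_ (lee_wpmul2l p0 (ZL _ (lexx L)))).
rewrite -energyK// -nrm_powN// -EFinM lee_fin => H2.
have : M `^ (- s) <= (M / 2) `^ (- s) * (2 `^ (- s) / 2).
  by apply: le_trans H2; apply: ler_powRN; rewrite ?(ltW s0)// nrm_gt0.
have -> : M `^ (- s) = (M / 2) `^ (- s) * 2 `^ (- s).
  by rewrite -powRM ?divr_ge0 ?(ltW M0)// divfK.
rewrite ler_pM2l ?powR_gt0 ?divr_gt0//.
have : 0 < (2 : R) `^ (- s) by rewrite powR_gt0.
lra.
Qed.

Variables (c C r : R).
Hypotheses (c0 : 0 < c) (r0 : 0 < r).

(** What a near-maximizer satisfies after translation. The bounds on the extension, the norm and the
    potential that follow are uniform over this class. *)
Definition tight f := [/\ good f, forall y, f y <= 1, c <= fine (mass f) <= C,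
  nrm f <= fine (mass f) & ((fine (mass f) / 2)%:E < ballmass f 0 r)%E].

Lemma ext_near f x : good f -> ((fine (mass f) / 2)%:E < ballmass f 0 r)%E ->
  2 * r <= dist x 0 -> (dist x 0 / 2) `^ b * (fine (mass f) / 2) <= fine (ext f x).
Proof.
move=> gf Hb xr; have [mf f0 _ _ _] := gf.
have p0 : 0 <= (dist x 0 / 2) `^ b by exact: powR_ge0.
rewrite -lee_fin EFinM extK//.
apply: (le_trans (lee_wpmul2l _ (ltW Hb))); first by rewrite lee_fin.
rewrite -(ge0_integralZl_EFin _ measurableT _ (measurable_ballmass 0 r mf) p0); last first.
  by move=> z _; rewrite lee_fin mulr_ge0.
apply: nn_le_integral => z _; first by rewrite -EFinM lee_fin !mulr_ge0.
rewrite -EFinM lee_fin.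
have [zr|zr] := leP (enorm (0 - z)) r; last first.
  rewrite indicE memNset/= ?mulr0 ?mulr_ge0 ?ker_ge0//.
  by apply/negP; rewrite -ltNge.
rewrite indicE mem_set// mulr1 ler_wpM2r//.
apply: ge0_ler_powR; rewrite ?nnegrE ?divr_ge0 ?dist_ge0 ?(ltW b0)//.
have := ger_dist_origin x z; rewrite sub0r enormN in zr.
by lra.
Qed.

(** Far from the origin the concentrated half of the mass suffices. Near it, [f <= 1] prevents a
    ball of radius [del] from carrying more than half of the mass, so [ext_far] gives a positive
    constant. *)
Lemma ext_lower : exists2 c1, 0 < c1 & forall f x, tight f ->
  c1 * (1 + dist x 0) `^ b <= fine (ext f x).
Proof.
pose del := (c / 2) `^ (n%:R)^-1 / 2.
have del0 : 0 < del by apply: divr_gt0 => //; apply: powR_gt0; apply: divr_gt0.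
have delM : (2 * del) ^+ n = c / 2.
  have -> : 2 * del = (c / 2) `^ (n%:R)^-1 by rewrite /del; field.
  rewrite -powR_mulrn ?powR_ge0// -powRrM mulVf ?pnatr_eq0 -?lt0n// powRr1//.
  by rewrite divr_ge0// ltW.
pose k1 := del `^ b / 2 * c / (1 + 2 * r) `^ b.
pose k2 := c / 2 / (2 * (1 + (2 * r)^-1)) `^ b.
have h1 : 0 < (1 + 2 * r) `^ b by rewrite powR_gt0// addr_gt0// mulr_gt0.
have hr : 0 < 2 * (1 + (2 * r)^-1) by rewrite mulr_gt0// addr_gt0// invr_gt0 mulr_gt0.
have h2 : 0 < (2 * (1 + (2 * r)^-1)) `^ b by rewrite powR_gt0.
have c20 : 0 < c / 2 by apply: divr_gt0.
have k10 : 0 < k1.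
  by apply: divr_gt0 h1; apply: mulr_gt0 c0; apply: divr_gt0 => //; exact: powR_gt0.
have k20 : 0 < k2 by exact: divr_gt0.
exists (Order.min k1 k2); first by rewrite lt_min k10.
move=> f x [gf f1 /andP[cM MC] Nf Hb]; have [mf f0 _ _ _] := gf.
have d0 := dist_ge0 x 0; have p0 : 0 <= (1 + dist x 0) `^ b by exact: powR_ge0.
have [xr|xr] := leP (2 * r) (dist x 0).
  apply: le_trans (ext_near gf Hb xr).
  apply: (@le_trans _ _ (k2 * (1 + dist x 0) `^ b)).
    by rewrite ler_wpM2r// ge_min lexx orbT.
  have -> : k2 * (1 + dist x 0) `^ b =
      ((1 + dist x 0) / (2 * (1 + (2 * r)^-1))) `^ b * (c / 2).
    rewrite powRM ?addr_ge0 ?invr_ge0 ?(ltW hr)// -[(2 * _)^-1]powR_inv1 ?(ltW hr)//.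
    by rewrite -powRrM mulN1r powRN /k2; ring.
  apply: ler_pM; rewrite ?powR_ge0 ?divr_ge0 ?(ltW c0)//; last by rewrite ler_pM2r ?invr_gt0.
  apply: ge0_ler_powR; rewrite ?nnegrE ?divr_ge0 ?addr_ge0 ?(ltW b0) ?(ltW hr)//.
  rewrite ler_pdivrMr//.
  have -> : dist x 0 / 2 * (2 * (1 + (2 * r)^-1)) = dist x 0 + dist x 0 / (2 * r).
    by field; rewrite gt_eqF.
  by rewrite addrC lerD2l ler_pdivlMr ?mul1r// mulr_gt0.
have far : del `^ b / 2 * fine (mass f) <= fine (ext f x).
  apply: ext_far => //; apply: le_trans (ball_mass_le _ mf _ (ltW del0)) _.
    by move=> y; rewrite f0 f1.
  by rewrite delM lee_fin ler_pM2r ?invr_gt0.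
apply: le_trans far.
apply: (@le_trans _ _ (k1 * (1 + dist x 0) `^ b)).
  by rewrite ler_wpM2r// ge_min lexx.
apply: (@le_trans _ _ (k1 * (1 + 2 * r) `^ b)).
  rewrite ler_wpM2l ?(ltW k10)//.
  apply: ge0_ler_powR; rewrite ?nnegrE ?addr_ge0 ?mulr_ge0 ?(ltW b0) ?(ltW r0)//.
  by rewrite lerD2l ltW.
by rewrite /k1 divfK ?gt_eqF// ler_wpM2l// divr_ge0// powR_ge0.
Qed.

Definition decay p : R := fine (\int[nu]_(x in D) ((1 + dist x 0) `^ (- p))%:E)%E.

Lemma decay_ge0 p : 0 <= decay p.
Proof. by apply: fine_ge0; apply: integral_ge0 => x _; rewrite lee_fin powR_ge0. Qed.

Lemma decayE p : n.+1%:R < p ->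
  (\int[nu]_(x in D) ((1 + dist x 0) `^ (- p))%:E = (decay p)%:E)%E.
Proof.
move=> np; rewrite fineK// ge0_fin_numE ?integral_decay_lty//.
by apply: integral_ge0 => x _; rewrite lee_fin powR_ge0.
Qed.

Lemma measurable_decay p : measurable_fun setT (fun x : X => ((1 + dist x 0) `^ (- p))%:E).
Proof.
apply/measurable_EFinP; apply: measurable_fun_powRl; apply: measurable_funD => //.
by have : measurable_fun setT ((fun z : X * Y => dist z.1 z.2) \o pair^~ 0)
  by apply: measurableT_comp (@measurable_dist R n) _; exact: pair2_measurable.
Qed.

Lemma integral_decayZ p k : n.+1%:R < p -> 0 <= k ->
  (\int[nu]_(x in D) (k%:E * ((1 + dist x 0) `^ (- p))%:E) = (k * decay p)%:E)%E.
Proof.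
move=> np k0; rewrite (ge0_integralZl_EFin _ mD) ?decayE// => [x _|].
  by rewrite lee_fin powR_ge0.
by apply: measurable_funTS; exact: measurable_decay.
Qed.

Let one_dist x : 0 < 1 + dist x 0.
Proof. by rewrite ltr_wpDr// dist_ge0. Qed.

Lemma powRN_ext_le c1 f x e : 0 < c1 -> 0 <= e -> D x ->
  c1 * (1 + dist x 0) `^ b <= fine (ext f x) ->
  fine (ext f x) `^ (- e) <= c1 `^ (- e) * (1 + dist x 0) `^ (- (b * e)).
Proof.
move=> c10 e0 Dx H.
have p0 : 0 < c1 * (1 + dist x 0) `^ b by rewrite mulr_gt0// powR_gt0.
apply: le_trans (ler_powRN e0 p0 H) _.
by rewrite powRM ?powR_ge0 ?(ltW c10)// -powRrM mulrN.
Qed.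

Lemma nrm_bounds : exists2 v, 0 < v & forall f, tight f ->
  [/\ v <= nrm f, nrm f <= C & C `^ (- s) <= fine (energy f)].
Proof.
have [c1 c10 Hc1] := ext_lower.
pose J := c1 `^ (- s) * decay (b * s).
have J0 : 0 <= J by rewrite mulr_ge0 ?powR_ge0 ?decay_ge0.
exists ((J + 1) `^ (- s^-1)); first by rewrite powR_gt0// ltr_wpDl.
move=> f tf; have [gf f1 /andP[cM MC] Nf Hb] := tf.
have NC : nrm f <= C by exact: le_trans Nf MC.
have N0 := nrm_gt0 b0 s0 bs n0 gf.
split => //; last by rewrite -nrm_powN//; apply: ler_powRN; rewrite ?(ltW s0).
rewrite /nrm; apply: ler_powRN; first by rewrite invr_ge0 ltW.
  exact: fine_energy_gt0.
rewrite -lee_fin energyK//; apply: (@le_trans _ _ J%:E); last by rewrite lee_fin lerDl.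
rewrite -integral_decayZ ?powR_ge0//; apply: nn_le_integral => x Dx.
  by rewrite lee_fin powR_ge0.
by rewrite -EFinM lee_fin powRN_ext_le ?(ltW s0)//; exact: Hc1.
Qed.

Let pot_integrand_le c1 f x : 0 < c1 -> D x ->
  c1 * (1 + dist x 0) `^ b <= fine (ext f x) ->
  (1 + dist x 0) `^ b * fine (ext f x) `^ (- s - 1) <=
  c1 `^ (- s - 1) * (1 + dist x 0) `^ (- (b * s)).
Proof.
move=> c10 Dx H; have p0 : 0 <= (1 + dist x 0) `^ b by exact: powR_ge0.
have s1 : 0 <= s + 1 by rewrite addr_ge0// ltW.
have := ler_wpM2l p0 (powRN_ext_le c10 s1 Dx H).
rewrite opprD => /le_trans; apply; rewrite mulrCA ler_wpM2l ?powR_ge0//.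
rewrite -powRD; last by apply/implyP => _; rewrite gt_eqF.
by rewrite le_eqVlt; apply/orP; left; apply/eqP; congr (_ `^ _); ring.
Qed.

Lemma pot_upper : exists2 k, 0 <= k & forall f y, tight f ->
  (pot f y <= (k * (1 + enorm y) `^ b)%:E)%E.
Proof.
have [c1 c10 Hc1] := ext_lower.
exists (c1 `^ (- s - 1) * decay (b * s)); first by rewrite mulr_ge0 ?powR_ge0 ?decay_ge0.
move=> f y tf.
have y0 : 0 <= (1 + enorm y) `^ b by exact: powR_ge0.
rewrite mulrAC -(integral_decayZ bs (mulr_ge0 (powR_ge0 c1 (- s - 1)) y0)).
apply: nn_le_integral => x Dx; first by rewrite lee_fin mulr_ge0 ?powR_ge0.
rewrite -EFinM lee_fin.
have h : ker x y <= (1 + dist x 0) `^ b * (1 + enorm y) `^ b.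
  rewrite -powRM ?addr_ge0 ?dist_ge0 ?enorm_ge0//.
  apply: ge0_ler_powR; rewrite ?nnegrE ?mulr_ge0 ?addr_ge0 ?dist_ge0 ?enorm_ge0 ?(ltW b0)//.
  exact: ler_dist_mul.
apply: le_trans (ler_wpM2r (powR_ge0 _ _) h) _.
exact: ler_mulAC y0 (pot_integrand_le c10 Dx (Hc1 f x tf)).
Qed.

(** [powR_modulus] applied to the distances and integrated in [x]: the error splits as
    [(1 + dist x 0) ^ b (1 + enorm z) ^ b], and the first factor is integrable against the weight of
    the potential, uniformly over [tight] functions. *)
Lemma pot_modulus eps : 0 < eps -> exists2 del, 0 < del &
  forall f y z, tight f -> enorm (y - z) <= del ->
  (pot f y <= pot f z + (eps * (1 + enorm z) `^ b)%:E)%E.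
Proof.
move=> e0; have [c1 c10 Hc1] := ext_lower.
pose k := c1 `^ (- s - 1) * decay (b * s).
have k0 : 0 <= k by rewrite mulr_ge0 ?powR_ge0 ?decay_ge0.
have ek : 0 < eps / (k + 1) by apply: divr_gt0 => //; rewrite ltr_wpDl.
have [del del0 Hdel] := powR_modulus b0 ek.
exists del => // f y z tf yz.
have [gf _ _ _ _] := tf.
have z0 : 0 <= (1 + enorm z) `^ b by exact: powR_ge0.
have cst0 : 0 <= eps / (k + 1) * (c1 `^ (- s - 1) * (1 + enorm z) `^ b).
  by apply: mulr_ge0; [exact: ltW|rewrite mulr_ge0 ?powR_ge0].
have step : (pot f y <= pot f z +
    \int[nu]_(x in D) ((eps / (k + 1) * (c1 `^ (- s - 1) * (1 + enorm z) `^ b))%:E *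
      ((1 + dist x 0) `^ (- (b * s)))%:E))%E.
  rewrite -(ge0_integralD _ mD); first last.
  - by apply: measurable_funeM; apply: measurable_funTS; exact: measurable_decay.
  - by move=> x _; rewrite -EFinM lee_fin; apply: mulr_ge0; rewrite ?powR_ge0.
  - apply: measurable_funTS.
    by have : measurable_fun setT ((fun z : X * Y => (ker z.1 z.2 * fine (ext f z.1) `^ (- s - 1))%:E) \o pair^~ z)
      by apply: measurableT_comp (measurable_pot_integrand s gf) _; exact: pair2_measurable.
  - by move=> x _; rewrite lee_fin mulr_ge0 ?powR_ge0.
  apply: nn_le_integral => x Dx; first by rewrite lee_fin mulr_ge0 ?powR_ge0.
  rewrite -EFinM -EFinD lee_fin.
  have d : ker x y <= ker x z + eps / (k + 1) * ((1 + dist x 0) `^ b * (1 + enorm z) `^ b).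
    apply: (le_trans (Hdel _ _ (dist_ge0 x y) (dist_ge0 x z) _)).
      by apply: le_trans (dist_triangle x y z) _; rewrite lerD2l.
    rewrite lerD2l ler_wpM2l ?(ltW ek)// -powRM ?addr_ge0 ?dist_ge0 ?enorm_ge0//.
    apply: ge0_ler_powR; rewrite ?nnegrE ?mulr_ge0 ?addr_ge0 ?dist_ge0 ?enorm_ge0 ?(ltW b0)//.
    have := ler_dist_origin x z; have := dist_ge0 x 0; have := enorm_ge0 z.
    by move: (dist x z) (dist x 0) (enorm z) => u v w'; nra.
  apply: le_trans (ler_wpM2r (powR_ge0 _ _) d) _.
  rewrite mulrDl lerD2l -[leLHS]mulrA -[leRHS]mulrA; apply: (ler_wpM2l (ltW ek)).
  exact: ler_mulAC z0 (pot_integrand_le c10 Dx (Hc1 f x tf)).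
apply: le_trans step _; apply: leeD2l.
rewrite integral_decayZ// lee_fin.
have -> : eps / (k + 1) * (c1 `^ (- s - 1) * (1 + enorm z) `^ b) * decay (b * s) =
  eps * (1 + enorm z) `^ b * (k / (k + 1)) by rewrite /k; ring.
rewrite ler_piMr ?mulr_ge0 ?(ltW e0)//.
by rewrite ler_pdivrMr ?mul1r ?ltr_wpDl// lerDl.
Qed.

End near_maximizers.

Lemma powRN_small (R : realType) (A e t : R) : 0 <= A -> 0 < e -> 0 < t ->
  exists2 K, 0 < K & A * K `^ (- t) <= e.
Proof.
move=> A0 e0 t0; pose K := (A / e) `^ t^-1 + 1.
have K0 : 0 < K by rewrite ltr_wpDl ?powR_ge0.
exists K => //; rewrite powRN ler_pdivrMr ?powR_gt0// mulrC -ler_pdivrMr//.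
have {1}-> : A / e = ((A / e) `^ t^-1) `^ t.
  by rewrite -powRrM mulVf ?gt_eqF// powRr1// divr_ge0// ltW.
by apply: ge0_ler_powR; rewrite ?nnegrE ?powR_ge0 ?(ltW K0) ?(ltW t0)// /K lerDl.
Qed.

(** * Growth and continuity of the supergradient *)

Section gradient.
Context (R : realType) (n : nat) (b s : R).
Hypotheses (b0 : 0 < b) (s0 : 0 < s) (bs : n.+1%:R < b * s) (n0 : (0 < n)%N).
Local Notation Y := 'rV[R]_n.
Local Notation X := ('rV[R]_n * measurableTypeR R)%type.
Local Notation mu := (lebesgue_rV R n).
Local Notation nu := (lebesgue_rV R n \x @lebesgue_measure R)%E.
Local Notation D := (@upper R n).
Local Notation ker := (@ker R n b).
Local Notation ext := (@ext R n b).
Local Notation good := (@good R n b).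
Local Notation energy := (@energy R n b s).
Local Notation nrm := (@nrm R n b s).
Local Notation pot := (@pot R n b s).
Variables (c C r : R).
Hypotheses (c0 : 0 < c) (C0 : 0 < C) (r0 : 0 < r).
Local Notation tight := (@tight R n b s c C r).
Implicit Types (f g : Y -> R) (x : X) (y z w : Y).

Let mD : measurable D := @measurable_upper R n.

(** The energy is at least [C ^ (- s)]. Little of it comes from outside the ball of radius [r3], by
    uniform decay, and little from points where [ext f] exceeds [K]. So the weight of the potential
    has integral at least [e / K] over the ball, and from there the kernel at [y] is at least
    [(enorm y - r3) ^ b]. *)
Lemma pot_growth : exists2 k, 0 < k & exists2 r3, 0 < r3 & forall f y, tight f ->
  r3 <= enorm y -> ((k * (enorm y - r3) `^ b)%:E <= pot f y)%E.
Proof.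
have [c1 c10 Hc1] := ext_lower s b0 n0 C c0 r0.
pose p := (n.+1%:R + b * s) / 2.
have np : n.+1%:R < p by rewrite /p; move: bs; lra.
have pbs : 0 < b * s - p by rewrite /p; move: bs; lra.
pose J := decay n p; have J0 : 0 <= J by exact: decay_ge0.
(* One quarter of the least energy: the two discarded contributions are at most [e] each, which
   leaves [2 e]. *)
pose e := C `^ (- s) / 4; have e0 : 0 < e by rewrite divr_gt0// powR_gt0.
have A0 : 0 <= c1 `^ (- s) * J by rewrite mulr_ge0 ?powR_ge0.
have [r3 r30 Hr3] := powRN_small A0 e0 pbs.
have B0 : 0 <= (1 + r3) `^ p * J by rewrite mulr_ge0 ?powR_ge0.
(* [K] is chosen after [r3]: the constant [K ^ (- s)] is integrated over the ball through the weight
   [(1 + r3) ^ p (1 + dist x 0) ^ (- p)]. *)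
have [K K0 HK] := powRN_small B0 e0 s0.
exists (e / K); first exact: divr_gt0.
exists r3 => // f y tf yr; have [gf f1 _ _ _] := tf.
have [_ _ En] : [/\ True, True & C `^ (- s) <= fine (energy f)].
  by have [v _ /(_ f tf) [_ _ ?]] := nrm_bounds b0 s0 bs n0 C c0 r0.
pose near x : R := \1_[set x : X | dist x 0 <= r3] x.
have near0 x : 0 <= near x by [].
have mnear : measurable_fun setT near.
  apply: measurable_indic.
  rewrite (_ : mkset _ = setT `&` (fun x : X => dist x 0) @^-1` `]-oo, r3]); last first.
    by rewrite setTI; apply/seteqP; split=> v /=; rewrite in_itv.
  suff : measurable_fun setT (fun x : X => dist x 0) by apply.
  by have : measurable_fun setT ((fun z : X * Y => dist z.1 z.2) \o pair^~ 0)
    by apply: measurableT_comp (@measurable_dist R n) _; exact: pair2_measurable.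
pose T := (\int[nu]_(x in D) (near x * fine (ext f x) `^ (- s - 1))%:E)%E.
have mT : measurable_fun D (fun x => (near x * fine (ext f x) `^ (- s - 1))%:E).
  apply/measurable_EFinP; apply: measurable_funM; first exact: measurable_funTS.
  by apply/measurable_EFinP; exact: measurable_fine_ext.
have T0 : (0 <= T)%E by apply: integral_ge0 => x _; rewrite lee_fin mulr_ge0 ?powR_ge0.
pose kap := K `^ (- s) * (1 + r3) `^ p + c1 `^ (- s) * (1 + r3) `^ (- (b * s - p)).
have kap0 : 0 <= kap by rewrite addr_ge0// mulr_ge0 ?powR_ge0.
have dp x : 0 < 1 + dist x 0 by rewrite ltr_wpDr// dist_ge0.
have split_le x : D x -> fine (ext f x) `^ (- s) <=
    K * (near x * fine (ext f x) `^ (- s - 1)) + kap * (1 + dist x 0) `^ (- p).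
  move=> Dx; have E0 := fine_ext_gt0 Dx gf.
  have [xr|xr] := leP (dist x 0) r3.
    rewrite /near indicE mem_set// mul1r.
    apply: le_trans (powRN_interpolate s0 K0 E0) _; rewrite addrC lerD2l.
    apply: (@le_trans _ _ (K `^ (- s) * (1 + r3) `^ p * (1 + dist x 0) `^ (- p))).
      rewrite -mulrA ler_peMr ?powR_ge0// powRN ler_pdivlMr ?powR_gt0// mul1r.
      apply: ge0_ler_powR; rewrite ?nnegrE ?(ltW (dp x)) ?addr_ge0 ?(ltW r30)//.
        by apply: le_trans (ltW np).
      by rewrite lerD2l.
    by rewrite ler_wpM2r ?powR_ge0// lerDl mulr_ge0 ?powR_ge0.
  rewrite /near indicE memNset/=; last by apply/negP; rewrite -ltNge.
  rewrite mul0r mulr0 add0r.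
  apply: le_trans (powRN_ext_le c10 (ltW s0) Dx (Hc1 f x tf)) _.
  apply: (@le_trans _ _ (c1 `^ (- s) * (1 + r3) `^ (- (b * s - p)) * (1 + dist x 0) `^ (- p))); last first.
    by rewrite ler_wpM2r ?powR_ge0// lerDr mulr_ge0 ?powR_ge0.
  rewrite -mulrA ler_wpM2l ?powR_ge0//.
  have -> : - (b * s) = - (b * s - p) + - p by ring.
  rewrite powRD; last by apply/implyP => _; rewrite gt_eqF.
  rewrite ler_wpM2r ?powR_ge0//; apply: ler_powRN; first exact: ltW.
    by rewrite addr_gt0.
  by rewrite lerD2l ltW.
have big : (energy f <= K%:E * T + (kap * J)%:E)%E.
  rewrite -integral_decayZ// -(ge0_integralZl_EFin _ mD _ mT (ltW K0)); last first.
    by move=> x _; rewrite lee_fin mulr_ge0 ?powR_ge0.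
  rewrite -(ge0_integralD _ mD); first last.
  - by apply: measurable_funeM; apply: measurable_funTS; exact: measurable_decay.
  - by move=> x _; rewrite -EFinM lee_fin mulr_ge0 ?powR_ge0.
  - exact: measurable_funeM.
  - by move=> x _; rewrite -EFinM lee_fin !mulr_ge0 ?powR_ge0 ?(ltW K0).
  apply: nn_le_integral => x Dx; first by rewrite lee_fin powR_ge0.
  by rewrite -!EFinM -EFinD lee_fin; exact: split_le.
have kapJ : kap * J <= 2 * e.
  have h1 : K `^ (- s) * (1 + r3) `^ p * J <= e.
    by rewrite -mulrA mulrC.
  have h2 : c1 `^ (- s) * (1 + r3) `^ (- (b * s - p)) * J <= e.
    apply: le_trans Hr3; rewrite mulrAC ler_wpM2l//.
    by apply: ler_powRN; rewrite ?(ltW pbs)// lerDr.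
  by rewrite /kap mulrDl; move: (_ * J) (_ * J) h1 h2 => u v; lra.
have TK : ((e / K)%:E <= T)%E.
  have KJ : (K%:E * T + (kap * J)%:E <= K%:E * T + (2 * e)%:E)%E.
    by apply: leeD2l; rewrite lee_fin.
  have := le_trans big KJ; rewrite -(energyK b0 s0 bs n0 gf).
  have e4 : 4 * e <= fine (energy f) by rewrite /e mulrC divfK.
  suff H (t : \bar R) (E : R) : (0 <= t)%E -> 4 * e <= E ->
      (E%:E <= K%:E * t + (2 * e)%:E)%E -> ((e / K)%:E <= t)%E by apply: H.
  case: t => [t _| _ _ _|//]; last by rewrite leey.
  rewrite -EFinM -EFinD !lee_fin => h4 H.
  by rewrite ler_pdivrMr// mulrC; move: (K * t) H => u; lra.
rewrite mulrC EFinM.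
apply: le_trans (lee_wpmul2l _ TK) _; first by rewrite lee_fin powR_ge0.
rewrite -(ge0_integralZl_EFin _ mD _ mT (powR_ge0 _ _)); last first.
  by move=> x _; rewrite lee_fin mulr_ge0 ?powR_ge0.
apply: nn_le_integral => x Dx; first by rewrite -EFinM lee_fin !mulr_ge0 ?powR_ge0.
rewrite -EFinM lee_fin.
have [xr|xr] := leP (dist x 0) r3; last first.
  rewrite /near indicE memNset/=; last by apply/negP; rewrite -ltNge.
  by rewrite mul0r mulr0 mulr_ge0 ?powR_ge0.
rewrite /near indicE mem_set// mul1r ler_wpM2r ?powR_ge0//.
apply: ge0_ler_powR; rewrite ?nnegrE ?dist_ge0 ?subr_ge0 ?(ltW b0)//.
rewrite lerBlDr; apply: (@le_trans _ _ (dist x y + dist x 0)); last by rewrite lerD2l.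
have yE : enorm y <= enorm x.1 + enorm (x.1 - y).
  rewrite -[enorm (_ - _)]enormN -[leLHS](_ : enorm (x.1 + - (x.1 - y)) = _).
    exact: ler_enormD.
  by rewrite opprB addrC subrK.
apply: le_trans yE _; rewrite addrC lerD ?ger_dist_enorm//.
by rewrite -{1}[x.1]subr0; exact: ger_dist_enorm.
Qed.

Definition grad f y : R := nrm f `^ (1 + s) * fine (pot f y).

Lemma pot_fin_num f y : tight f -> pot f y \is a fin_num.
Proof.
move=> tf; have [k k0 Hk] := pot_upper b0 s0 bs n0 C c0 r0.
by rewrite ge0_fin_numE ?pot_ge0//; apply: le_lt_trans (Hk f y tf) _; rewrite ltry.
Qed.

Lemma grad_ge0 f y : 0 <= grad f y.
Proof. by rewrite mulr_ge0 ?powR_ge0// fine_ge0// pot_ge0. Qed.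

Lemma grad_upper : exists2 k, 0 <= k & forall f y, tight f -> grad f y <= k * (1 + enorm y) `^ b.
Proof.
have [k k0 Hk] := pot_upper b0 s0 bs n0 C c0 r0.
exists (C `^ (1 + s) * k) => [|f y tf]; first by rewrite mulr_ge0 ?powR_ge0.
have [v v0 /(_ f tf) [vN NC _]] := nrm_bounds b0 s0 bs n0 C c0 r0.
rewrite /grad -mulrA; apply: ler_pM; rewrite ?powR_ge0 ?fine_ge0 ?pot_ge0//.
  apply: ge0_ler_powR; rewrite ?nnegrE ?addr_ge0 ?(ltW s0) ?(ltW C0)//.
  by apply: le_trans vN; exact: ltW.
by rewrite -lee_fin fineK ?pot_fin_num//; exact: Hk.
Qed.

Lemma grad_modulus eps : 0 < eps -> exists2 del, 0 < del &
  forall f y z, tight f -> enorm (y - z) <= del ->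
  grad f y <= grad f z + eps * (1 + enorm z) `^ b.
Proof.
move=> e0; have Cs : 0 < C `^ (1 + s) by rewrite powR_gt0.
have [del del0 Hd] := pot_modulus b0 s0 bs n0 C c0 r0 (divr_gt0 e0 Cs).
exists del => // f y z tf yz.
have [v v0 /(_ f tf) [vN NC _]] := nrm_bounds b0 s0 bs n0 C c0 r0.
have N0 : 0 <= nrm f by apply: le_trans vN; exact: ltW.
have NCs : nrm f `^ (1 + s) <= C `^ (1 + s).
  by apply: ge0_ler_powR; rewrite ?nnegrE ?addr_ge0 ?(ltW s0) ?(ltW C0).
have := Hd f y z tf yz.
rewrite -[pot f y]fineK ?pot_fin_num// -[pot f z]fineK ?pot_fin_num// -EFinD lee_fin.
move=> /(ler_wpM2l (powR_ge0 (nrm f) (1 + s))) /le_trans; apply.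
rewrite mulrDr lerD2l mulrA ler_wpM2r ?powR_ge0//.
by rewrite mulrCA ler_piMr ?(ltW e0)// ler_pdivrMr// mul1r.
Qed.

(** Beyond [r4] the function [Phi (grad f)] vanishes, which gives a support bound common to the
    whole maximizing sequence. *)
Lemma grad_growth : exists2 r4, 0 < r4 & forall f y, tight f -> r4 <= enorm y -> 1 <= grad f y.
Proof.
have [k k0 [r3 r30 Hk]] := pot_growth.
have [v v0 Hv] := nrm_bounds b0 s0 bs n0 C c0 r0.
have vk : 0 < v `^ (1 + s) * k by rewrite mulr_gt0// powR_gt0.
pose t := (v `^ (1 + s) * k)^-1 `^ b^-1.
exists (r3 + t); first by rewrite ltr_wpDr// powR_ge0.
move=> f y tf yr; have [vN _ _] := Hv f tf.
have yr3 : r3 <= enorm y by apply: le_trans yr; rewrite lerDl powR_ge0.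
have P : k * (enorm y - r3) `^ b <= fine (pot f y).
  by rewrite -lee_fin fineK ?pot_fin_num//; exact: Hk.
have tb : (v `^ (1 + s) * k)^-1 <= (enorm y - r3) `^ b.
  rewrite -[leLHS](_ : t `^ b = _); last first.
    by rewrite /t -powRrM mulVf ?gt_eqF// powRr1// invr_ge0 ltW.
  apply: ge0_ler_powR; rewrite ?nnegrE ?powR_ge0 ?subr_ge0 ?(ltW b0)//.
  by rewrite lerBrDl.
rewrite -(mulfV (lt0r_neq0 vk)) /grad -mulrA; apply: ler_pM; rewrite ?powR_ge0//.
- by rewrite mulr_ge0 ?invr_ge0 ?(ltW vk) ?(ltW k0).
- by apply: ge0_ler_powR; rewrite ?nnegrE ?addr_ge0 ?(ltW s0) ?(ltW v0)//; apply: le_trans vN; exact: ltW.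
- by apply: le_trans P; rewrite ler_wpM2l ?(ltW k0).
Qed.

End gradient.

(** * Compactness *)

Section compactness.
Context (R : realType).

(** A cluster point in a product of segments, compact by Tychonoff's theorem, stands in for the
    limit of a subsequence: the product over all points need not be metrizable, but its
    neighbourhoods see finitely many points at a time. *)
Lemma pointwise_cluster (T : choiceType) (G : nat -> T -> R) (B : T -> R) :
  (forall j y, `|G j y| <= B y) ->
  exists G0 : T -> R, forall eps J (l : seq T), 0 < eps ->
    exists2 j, (J <= j)%N & forall y, y \in l -> `|G j y - G0 y| <= eps.
Proof.
move=> GB; pose K := [set g : prod_topology (fun _ : T => R) | forall y, `[- B y, B y]%classic (g y)].
have cK : compact K.
  exact: (@tychonoff T (fun _ => R) (fun y => `[- B y, B y]%classic)
    (fun y => @segment_compact R _ _)).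
pose Gp j : prod_topology (fun _ : T => R) := G j.
have FK : (Gp @ \oo) K.
  by exists 0%N => // j _ y /=; rewrite in_itv/= -ler_norml.
have [G0 [_ clG0]] := cK (Gp @ \oo) _ FK.
exists G0 => eps J l e0.
have nU : nbhs G0 [set g : prod_topology (fun _ : T => R) |
    forall y, y \in l -> `|g y - G0 y| <= eps].
  elim: l => [|z l IH]; first by apply: filterS filterT => g _ y.
  have nz : nbhs G0 [set g : prod_topology (fun _ : T => R) | `|g z - G0 z| <= eps].
    apply: (@proj_continuous T (fun _ => R) z G0 [set u : R | `|u - G0 z| <= eps]).
    apply/nbhs_ballP; exists eps => //= u; rewrite /ball/= distrC => /ltW.
    by [].
  apply: filterS2 nz IH => g gz gl y; rewrite inE => /predU1P[->//|]; exact: gl.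
have FJ : (Gp @ \oo) [set Gp j | j in [set j | (J <= j)%N]].
  by exists J => // j /= Jj; exists j.
have [_ [[j /= Jj <-] Hj]] := clG0 _ _ FJ nU.
by exists j.
Qed.

Lemma finite_net n (r eta : R) : 0 < eta -> exists l : seq 'rV[R]_n,
  forall y, enorm y <= r -> exists2 z, z \in l & enorm (y - z) <= eta.
Proof.
(* The Euclidean norm is at most [n] times the largest coordinate; dividing by [n.+1] also covers
   [n = 0]. *)
move=> eta0; pose h := eta / n.+1%:R.
have h0 : 0 < h by rewrite divr_gt0.
pose N := (Num.truncn (2 * r / h)).+1.
pose grid (k : {ffun 'I_n -> 'I_N}) : 'rV[R]_n := \row_i ((k i)%:R * h - r).
exists [seq grid k | k : {ffun 'I_n -> 'I_N}] => y yr.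
have yi i : 0 <= y ord0 i + r <= 2 * r.
  have := le_trans (coord_le_enorm y i) yr; rewrite ler_norml => /andP[]; lra.
have ki i : (Num.truncn ((y ord0 i + r) / h) < N)%N.
  rewrite ltnS; apply: le_truncn; rewrite ler_pM2r ?invr_gt0//.
  by case/andP: (yi i).
pose k := [ffun i => Ordinal (ki i)].
exists (grid k); first by apply/mapP; exists k => //; rewrite mem_enum.
apply: (@le_trans _ _ (n%:R * h)).
  apply: enorm_le_coord; first exact: ltW.
  move=> i; rewrite !mxE ffunE/=.
  have /andP[y0 _] := yi i.
  have : 0 <= (y ord0 i + r) / h by rewrite divr_ge0// ltW.
  move=> /truncn_itv/andP[]; rewrite ler_pdivlMr// ltr_pdivrMr// => h1 h2.
  move: h2; rewrite -natr1 mulrDl mul1r => h2.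
  by rewrite ler_norml; apply/andP; split; lra.
rewrite /h mulrCA ler_piMr ?(ltW eta0)// ler_pdivrMr// mul1r ler_nat.
exact: leqnSn.
Qed.

(* Arzela-Ascoli on balls: the cluster point [G0] is pointwise, its uniformity comes from the
   common modulus of continuity. *)
Lemma uniform_cluster n (b : R) (G : nat -> 'rV[R]_n -> R) (B : 'rV[R]_n -> R) :
  0 < b -> (forall j y, `|G j y| <= B y) ->
  (forall eps, 0 < eps -> exists2 del, 0 < del & forall j y z, enorm (y - z) <= del ->
     G j y <= G j z + eps * (1 + enorm z) `^ b) ->
  exists G0 : 'rV[R]_n -> R,
  [/\ forall eps J (l : seq 'rV[R]_n), 0 < eps ->
        exists2 j, (J <= j)%N & forall y, y \in l -> `|G j y - G0 y| <= eps,
      forall eps, 0 < eps -> exists2 del, 0 < del & forall y z, enorm (y - z) <= del ->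
        G0 y <= G0 z + eps * (1 + enorm z) `^ b &
      forall r eps J, 0 < eps -> exists2 j, (J <= j)%N &
        forall y, enorm y <= r -> `|G j y - G0 y| <= eps].
Proof.
move=> b0 GB Gmod; have [G0 HG0] := pointwise_cluster GB.
exists G0.
have mod0 eps : 0 < eps -> exists2 del, 0 < del & forall y z, enorm (y - z) <= del ->
    G0 y <= G0 z + eps * (1 + enorm z) `^ b.
  move=> e0; have [del del0 Hd] := Gmod eps e0; exists del => // y z yz.
  apply/ler_addgt0Pr => e e0'.
  have e2 : 0 < e / 2 by rewrite divr_gt0.
  have [j _ Hj] := HG0 (e / 2) 0%N [:: y; z] e2.
  have := Hj y; rewrite inE eqxx => /(_ isT); rewrite ler_norml => /andP[h1 _].
  have := Hj z; rewrite !inE eqxx orbT => /(_ isT); rewrite ler_norml => /andP[_ h2].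
  have := Hd j y z yz; lra.
split => // r eps J e0.
have [r0|r0] := ltP r 0.
  by exists J => // y yr; have := le_lt_trans (le_trans (enorm_ge0 y) yr) r0; rewrite ltxx.
(* [W] bounds the weight [(1 + |u|) ^ b] for [|u| <= 1 + r]. Points of the net may lie outside the
   ball of radius [r], but those used are within [del <= 1] of it. *)
pose W := (2 + r) `^ b; have W0 : 0 < W by rewrite powR_gt0// ltr_wpDr.
have eW : 0 < eps / (4 * W) by rewrite divr_gt0// mulr_gt0.
have [d1 d10 Hd1] := Gmod _ eW; have [d2 d20 Hd2] := mod0 _ eW.
pose del := Order.min 1 (Order.min d1 d2).
have del0 : 0 < del by rewrite !lt_min ltr01 d10 d20.
have dl : del <= 1 by rewrite ge_min lexx.
have dl1 : del <= d1 by rewrite !ge_min lexx orbT.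
have dl2 : del <= d2 by rewrite !ge_min lexx !orbT.
have [l Hl] := @finite_net n r del del0.
have e4 : 0 < eps / 4 by rewrite divr_gt0.
have [j Jj Hj] := HG0 (eps / 4) J l e4; exists j => // y yr.
have [z zl yz] := Hl y yr.
have zr : enorm z <= 1 + r.
  have -> : z = y - (y - z) by rewrite opprB addrC subrK.
  apply: le_trans (ler_enormD _ _) _; rewrite enormN addrC; apply: lerD => //.
  exact: le_trans yz dl.
have zy : enorm (z - y) <= del by rewrite -enormN opprB.
have small (u : 'rV[R]_n) : enorm u <= 1 + r -> eps / (4 * W) * (1 + enorm u) `^ b <= eps / 4.
  move=> ur; have : (1 + enorm u) `^ b <= W.
    apply: ge0_ler_powR; rewrite ?nnegrE ?(ltW b0) ?addr_ge0 ?enorm_ge0//.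
    by move: ur; lra.
  move=> /(ler_wpM2l (ltW eW)) /le_trans; apply.
  by rewrite invfM mulrA divfK// gt_eqF.
have yr1 : enorm y <= 1 + r by rewrite (le_trans yr)// lerDr.
have hz := small z zr; have hy := small y yr1.
have a1 := le_trans (Hd1 j y z (le_trans yz dl1)) (lerD (lexx _) hz).
have a2 := le_trans (Hd1 j z y (le_trans zy dl1)) (lerD (lexx _) hy).
have a3 := le_trans (Hd2 y z (le_trans yz dl2)) (lerD (lexx _) hz).
have a4 := le_trans (Hd2 z y (le_trans zy dl2)) (lerD (lexx _) hy).
have := Hj z zl; rewrite ler_norml => /andP[h1 h2].
move: (G j y) (G j z) (G0 y) (G0 z) h1 h2 a1 a2 a3 a4 => p1 p2 p3 p4 h1 h2 a1 a2 a3 a4.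
by rewrite ler_norml; apply/andP; split; clear -h1 h2 a1 a2 a3 a4 e0; lra.
Qed.

End compactness.

(** * Existence of a maximizer *)

Section maximizer.
Context (R : realType) (n : nat) (b s q : R).
Hypotheses (b0 : 0 < b) (s0 : 0 < s) (bs : n.+1%:R < b * s) (n0 : (0 < n)%N) (q1 : 1 < q).
Local Notation Y := 'rV[R]_n.
Local Notation X := ('rV[R]_n * measurableTypeR R)%type.
Local Notation mu := (lebesgue_rV R n).
Local Notation nu := (lebesgue_rV R n \x @lebesgue_measure R)%E.
Local Notation D := (@upper R n).
Local Notation ker := (@ker R n b).
Local Notation ext := (@ext R n b).
Local Notation good := (@good R n b).
Local Notation energy := (@energy R n b s).
Local Notation nrm := (@nrm R n b s).
Local Notation pot := (@pot R n b s).
Local Notation grad := (@grad R n b s).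
Implicit Types (f g : Y -> R) (x : X) (y z w : Y).

Let q0 : 0 < q. Proof. by move: q1; lra. Qed.

Definition powmass f : \bar R := mass (fun y => f y `^ q).

Definition Lam f : R := fine (mass f) - fine (powmass f) - nrm f.

(** The bound 1 makes [powmass] finite, as [f ^ q <= f], and keeps the mass from concentrating in
    small balls. *)
Definition adm f := good f /\ forall y, f y <= 1.

Lemma powR_le1 (a : R) : 0 <= a <= 1 -> a `^ q <= a.
Proof.
move=> /andP[a0 a1]; rewrite -(mulr_powRB1 a0 q0) ler_piMr//.
rewrite -[leRHS](powRr0 a); move: a0; rewrite le_eqVlt => /predU1P[<-|a0].
  by rewrite powR0 ?powRr0//; move: q1; lra.
by apply: ger_powR; [rewrite a0|move: q1; lra].
Qed.

Lemma powmass_ge0 f : (0 <= powmass f)%E.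
Proof. by apply: mass_ge0 => y; exact: powR_ge0. Qed.

Lemma powmass_fin_num f : adm f -> powmass f \is a fin_num.
Proof.
move=> [[mf f0 _ Mf _] f1]; rewrite ge0_fin_numE ?powmass_ge0//.
apply: le_lt_trans Mf; apply: nn_le_integral => y _; rewrite lee_fin ?powR_ge0//.
by apply: powR_le1; rewrite f0 f1.
Qed.

(** Solution of the stationarity condition [q a ^ (q - 1) = 1 - t] for [t <= 1], and 0 beyond. *)
Definition Phi (t : R) : R := (Order.max (1 - t) 0 / q) `^ (q - 1)^-1.

Lemma Phi_ge0 t : 0 <= Phi t. Proof. exact: powR_ge0. Qed.

Let arg_ge0 (t : R) : 0 <= Order.max (1 - t) 0 / q.
Proof. by rewrite divr_ge0 ?le_max ?lexx ?orbT// ltW. Qed.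

Let qi : 0 < (q - 1)^-1. Proof. by rewrite invr_gt0; move: q1; lra. Qed.

Lemma Phi_le1 t : 0 <= t -> Phi t <= 1.
Proof.
move=> t0; rewrite /Phi -[leRHS](_ : 1 `^ (q - 1)^-1 = 1); last by rewrite powR1.
apply: ge0_ler_powR; rewrite ?nnegrE ?arg_ge0 ?(ltW qi)//.
by rewrite ler_pdivrMr// mul1r ge_max; apply/andP; split; move: q1; lra.
Qed.

Lemma Phi_eq0 t : 1 <= t -> Phi t = 0.
Proof.
move=> t1; rewrite /Phi max_r ?mul0r ?powR0 ?gt_eqF//.
by rewrite subr_le0.
Qed.

Lemma Phi_lt t u : t < 1 -> t < u -> Phi u < Phi t.
Proof.
move=> t1 tu; apply: gt0_ltr_powR; rewrite ?nnegrE ?arg_ge0//.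
rewrite ltr_pM2r ?invr_gt0// lt_max; apply/orP; left.
by rewrite gt_max ltrD2l ltrN2 tu subr_gt0.
Qed.

Lemma measurable_Phi d (T : measurableType d) (h : T -> R) :
  measurable_fun setT h -> measurable_fun setT (Phi \o h).
Proof.
move=> mh; apply: measurable_fun_powRl; apply: measurable_funM => //.
by apply: measurable_maxr => //; apply: measurable_funB.
Qed.

(** For [t < 1] the tangent to [a ^ q] at [Phi t] has slope [1 - t]. *)
Lemma Phi_max (a t : R) : 0 <= a ->
  a * (1 - t) - a `^ q <= Phi t * (1 - t) - Phi t `^ q.
Proof.
move=> a0; have [t1|t1] := leP 1 t.
  rewrite Phi_eq0// mul0r powR0 ?gt_eqF// subrr.
  have := powR_ge0 a q; have : a * (1 - t) <= 0 by rewrite mulr_ge0_le0// subr_le0.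
  by move: (a * _) (a `^ q) => u v; lra.
have p0 : 0 < Phi t.
  by apply: powR_gt0; apply: divr_gt0 => //; rewrite lt_max subr_gt0 t1.
have pE : q * Phi t `^ (q - 1) = 1 - t.
  rewrite /Phi -powRrM mulVf; last by rewrite gt_eqF//; move: q1; lra.
  rewrite powRr1 ?arg_ge0// max_l ?subr_ge0 ?(ltW t1)//.
  by rewrite mulrC divfK ?gt_eqF.
have := powR_tangent q1 a0 p0; rewrite pE.
by move: (Phi t) (Phi t `^ q) (a `^ q) => u v w; lra.
Qed.

Lemma good_bounded g r : measurable_fun setT g -> (forall y, 0 <= g y <= 1) ->
  0 <= r -> (forall y, r < enorm y -> g y = 0) -> (0 < mass g)%E -> good g.
Proof.
move=> mg g01 r0 gr M0.
have g0 y : 0 <= g y by case/andP: (g01 y).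
have gle y : g y <= \1_(@cube R n r) y.
  have [yr|yr] := leP (enorm y) r; last by rewrite gr.
  by rewrite indicE mem_set; [case/andP: (g01 y)|exact: enorm_cube].
have Mf : (mass g < +oo)%E.
  apply: (@le_lt_trans _ _ (\int[mu]_y (\1_(@cube R n r) y)%:E)%E).
    by apply: nn_le_integral => y _; rewrite lee_fin.
  rewrite integral_indic//; last exact: measurable_cube.
  rewrite setIT; have : (mu (@cube R n r) < +oo)%E by rewrite lebesgue_cube// ltry.
  by [].
split => // x.
apply: (@le_lt_trans _ _ (\int[mu]_y (((dist x 0 + r) `^ b)%:E * (g y)%:E))%E).
  apply: nn_le_integral => y _; first by rewrite lee_fin mulr_ge0 ?ker_ge0.
  rewrite -EFinM lee_fin; have [yr|yr] := leP (enorm y) r; last by rewrite gr// !mulr0.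
  rewrite ler_wpM2r//; apply: ge0_ler_powR; rewrite ?nnegrE ?addr_ge0 ?dist_ge0 ?(ltW b0)//.
  by apply: le_trans (ler_dist_origin x y) _; rewrite lerD2l.
rewrite (ge0_integralZl_EFin _ measurableT); last 3 first.
- by move=> y _; rewrite lee_fin.
- exact/measurable_EFinP.
- exact: powR_ge0.
by apply: lte_mul_pinfty; rewrite ?lee_fin ?powR_ge0.
Qed.

Section existence.
Hypothesis Lam_pos : exists2 f, adm f & 0 < Lam f.

Let nrm_gt0' f : good f -> 0 < nrm f. Proof. exact: nrm_gt0. Qed.

Let Lam_mass f : adm f -> 0 <= Lam f -> nrm f <= fine (mass f).
Proof.
move=> af L0; have : 0 <= fine (powmass f) by rewrite fine_ge0// powmass_ge0.
by move: L0; rewrite /Lam; move: (fine _) (fine _) (nrm f) => u v w; lra.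
Qed.

Let Lam_le_mass f : adm f -> Lam f <= fine (mass f).
Proof.
move=> [gf f1]; have : 0 <= fine (powmass f) by rewrite fine_ge0// powmass_ge0.
have := nrm_gt0' gf; rewrite /Lam; move: (fine _) (fine _) (nrm f) => u v w; lra.
Qed.

Lemma adm_shift f w : adm f -> adm (shift f w).
Proof. by move=> [gf f1]; split=> [|y]; [exact: good_shift|exact: f1]. Qed.

Lemma Lam_shift f w : good f -> Lam (shift f w) = Lam f.
Proof.
move=> gf; have [mf f0 _ _ _] := gf.
have E1 : nrm (shift f w) = nrm f by exact: nrm_shift.
have E2 : mass (shift f w) = mass f by exact: mass_shift.
have E3 : powmass (shift f w) = powmass f.
  apply: (@mass_shift R n (fun y => f y `^ q) w); first exact: measurable_fun_powRl.
  by move=> y; exact: powR_ge0.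
by rewrite /Lam E1 E2 E3.
Qed.

Let arith1 (m p N mg S x : R) : S - x <= m - p - N ->
  m <= mg + N + p + S / 2 / 4 -> 0 < S -> x <= S / 2 / 2 -> 0 < mg.
Proof. lra. Qed.

Let arith2 (m p N mg pg Ng S x e : R) : S - x <= m - p - N ->
  m + Ng + pg <= mg + N + p + e / 2 -> x <= e / 2 -> S <= mg - pg - Ng + e.
Proof. lra. Qed.

(** Here [t] is a value of the limit gradient and [w] a nearby value of an approximating one. Since
    [v] beats [u] for [t], it beats [u] for [w] up to [2 eps]. *)
Let arith3 (u v w t uq vq eps : R) : - eps <= w - t -> w - t <= eps ->
  u * (1 - t) - uq <= v * (1 - t) - vq -> 0 <= v -> v <= 1 -> 0 <= u -> u <= 1 -> 0 <= eps ->
  u + v * w + vq <= v + u * w + uq + 2 * eps.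
Proof.
move=> h1 h2 opt v0 v1 u0 u1 e0.
have p1 : 0 <= v * (eps - (w - t)) by rewrite mulr_ge0// subr_ge0.
have p2 : 0 <= u * ((w - t) + eps) by rewrite mulr_ge0//; lra.
have p3 : 0 <= (1 - v) * eps by rewrite mulr_ge0// subr_ge0.
have p4 : 0 <= (1 - u) * eps by rewrite mulr_ge0// subr_ge0.
lra.
Qed.

Let fine_le (m p mg pg : \bar R) (N Ng d : R) :
  m \is a fin_num -> p \is a fin_num -> mg \is a fin_num -> pg \is a fin_num ->
  (m + Ng%:E + pg <= mg + N%:E + p + d%:E)%E ->
  fine m + Ng + fine pg <= fine mg + N + fine p + d.
Proof.
by case: m => [m| |]// _; case: p => [p| |]// _; case: mg => [mg| |]// _;
  case: pg => [pg| |]// _; rewrite -!EFinD lee_fin.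
Qed.

Let mass_fin_num f : good f -> mass f \is a fin_num.
Proof. by move=> [_ f0 _ Mf _]; rewrite ge0_fin_numE// mass_ge0. Qed.

(** The maximizer is [Phi] of a cluster point [G0] of the gradients. [key] expresses that [g] is
    nearly optimal for the gradient at [F j]; combined with the supergradient inequality it yields
    [Lam (F j) <= Lam g] up to a small error, and [Lam (F j)] tends to the supremum. *)
Lemma maximizer_exists : exists g (G0 : Y -> R),
  [/\ adm g, forall f, adm f -> Lam f <= Lam g, 0 < Lam g,
      forall y, g y = Phi (G0 y) &
      (exists2 r, 0 < r & forall y, r < enorm y -> g y = 0) /\
      forall eps, 0 < eps -> exists2 del, 0 < del & forall y z, enorm (y - z) <= del ->
        G0 y <= G0 z + eps * (1 + enorm z) `^ b].
Proof.
have [r r0 Hr] := concentration b0 s0 bs n0.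
(* More than half of the mass lies in a ball of radius [r], which holds at most [(2 r) ^ n] of it
   since [f <= 1]. *)
pose C := 2 * (2 * r) ^+ n.
have C0 : 0 < C by rewrite mulr_gt0// exprn_gt0// mulr_gt0.
have massC f : adm f -> 0 <= Lam f ->
    fine (mass f) <= C /\ exists y, ((fine (mass f) / 2)%:E < ballmass f y r)%E.
  move=> af L0; have [gf f1] := af; have [mf f0 _ _ _] := gf.
  have [y Hy] := Hr f gf (Lam_mass af L0); split; last by exists y.
  have : ((fine (mass f) / 2)%:E < ((2 * r) ^+ n)%:E)%E.
    apply: lt_le_trans Hy _; apply: ball_mass_le => //; last exact: ltW.
    by move=> z; rewrite f0 f1.
  by rewrite lte_fin /C => /ltW; move: (_ ^+ n) (fine _) => u v; lra.
pose E := [set Lam f | f in adm].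
have hE : has_sup E.
  have [f af Lf] := Lam_pos; split; first by exists (Lam f), f.
  exists C => _ [g ag <-]; have [L0|/ltW L0] := leP 0 (Lam g); last exact: le_trans L0 (ltW C0).
  by apply: le_trans (Lam_le_mass ag) _; case: (massC g ag L0).
pose S := sup E.
have LS f : adm f -> Lam f <= S by move=> af; apply: ub_le_sup; [case: hE|exists f].
have S0 : 0 < S by have [f af Lf] := Lam_pos; exact: lt_le_trans Lf (LS f af).
(* Serves both as the lower bound on the mass, since [Lam f <= mass f], and as the unit in which the
   gap to the supremum is measured. *)
pose c := S / 2; have c0 : 0 < c by rewrite divr_gt0.
have approx j : exists f, [/\ adm f, tight b s c C r f & S - c / j.+1%:R <= Lam f].
  have cj : 0 < c / j.+1%:R by rewrite divr_gt0.
  have [_ [f af <-] Lf] := sup_adherent cj hE.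
  have Lc : c <= Lam f.
    have : c / j.+1%:R <= c by rewrite ler_piMr ?(ltW c0)// invf_le1// ler1n.
    by move: Lf; rewrite -/S /c; move: (_ / j.+1%:R) => u; lra.
  have L0 : 0 <= Lam f by exact: le_trans (ltW c0) Lc.
  have [MC [y Hy]] := massC f af L0; have [gf f1] := af; have [mf f0 _ _ _] := gf.
  exists (shift f y); split; [exact: adm_shift| |by rewrite Lam_shift// ltW].
  have E2 := mass_shift y mf f0; have E3 := ballmass_shift y 0 r mf f0.
  have E1 := nrm_shift s y gf; rewrite add0r in E3.
  split; [exact: good_shift|by move=> z; exact: f1| | |].
  - by rewrite E2 MC andbT; apply: le_trans Lc (Lam_le_mass af).
  - by rewrite E2 E1; exact: Lam_mass.
  - by rewrite E2 E3.
(* By [approx] the default value 0 is never the result of an empty choice. *)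
pose F j := xget (fun=> 0) [set f | [/\ adm f, tight b s c C r f & S - c / j.+1%:R <= Lam f]].
have HF j : [/\ adm (F j), tight b s c C r (F j) & S - c / j.+1%:R <= Lam (F j)].
  rewrite /F; case: xgetP => [f _ //|H]; have [f Hf] := approx j.
  by case: (H f Hf).
have tF j : tight b s c C r (F j) by case: (HF j).
pose G j := grad (F j).
have [k k0 Gub] := grad_upper b0 s0 bs n0 c0 C0 r0.
have GB j y : `|G j y| <= k * (1 + enorm y) `^ b.
  by rewrite ger0_norm ?grad_ge0//; exact: Gub.
have Gmod eps : 0 < eps -> exists2 del, 0 < del & forall j y z, enorm (y - z) <= del ->
    G j y <= G j z + eps * (1 + enorm z) `^ b.
  move=> e0; have [del del0 Hd] := grad_modulus b0 s0 bs n0 c0 C0 r0 e0.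
  by exists del => // j y z; exact: Hd.
have [G0 [Gpt Gm0 Gunif]] := uniform_cluster b0 GB Gmod.
have [r4 r40 Hr4] := grad_growth b0 s0 bs n0 c0 C0 r0.
have G00 y : 0 <= G0 y.
  apply/ler_addgt0Pr => e e0; have [j _ /(_ y)] := Gpt e 0%N [:: y] e0.
  rewrite inE eqxx => /(_ isT); rewrite ler_norml => /andP[_ h].
  by have := grad_ge0 b s (F j) y; move: h; rewrite -/(G j y); lra.
have G01 y : r4 <= enorm y -> 1 <= G0 y.
  move=> yr; apply/ler_addgt0Pr => e e0; have [j _ /(_ y)] := Gpt e 0%N [:: y] e0.
  rewrite inE eqxx => /(_ isT); rewrite ler_norml => /andP[_ h].
  by have := Hr4 (F j) y (tF j) yr; move: h; rewrite -/(G j y); lra.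
pose g y := Phi (G0 y).
have g01 y : 0 <= g y <= 1 by rewrite Phi_ge0 Phi_le1.
have g0 y : 0 <= g y by exact: Phi_ge0.
have gr y : r4 <= enorm y -> g y = 0 by move=> /G01; exact: Phi_eq0.
pose B : set Y := [set y | enorm y <= r4].
have mB : measurable B.
  rewrite (_ : B = setT `&` @enorm R n @^-1` `]-oo, r4]); last first.
    by rewrite setTI; apply/seteqP; split=> v /=; rewrite in_itv.
  exact: measurable_enorm.
(* [G0] is merely a cluster point. On the ball [B] it is the limit of measurable functions
   [G (jk i)] picked with error [1 / (i + 1)], and off [B] the function [g] vanishes. *)
have mg : measurable_fun setT g.
  have /choice[jk Hjk] : forall i, exists j, forall y, enorm y <= r4 ->
      `|G j y - G0 y| <= i.+1%:R^-1.
    by move=> i; have [|j _ Hj] := Gunif r4 i.+1%:R^-1 0%N; [rewrite invr_gt0|exists j].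
  have mG j : measurable_fun setT (G j).
    have [[gF _] _ _] := HF j.
    apply: (measurable_funM (measurable_cst _)); apply: measurableT_comp => //.
    exact: measurable_pot.
  have mG0 : measurable_fun setT (fun y => G0 y * \1_B y).
    apply: (@measurable_fun_cvg _ _ _ _ (fun i y => G (jk i) y * \1_B y)) => //.
      by move=> i; apply: measurable_funM => //; exact: measurable_indic.
    move=> y _; have [yr|yr] := leP (enorm y) r4; last first.
      have y0 : \1_B y = 0 :> R by rewrite indicE memNset//=; apply/negP; rewrite -ltNge.
      by rewrite y0 mulr0; under eq_fun do rewrite mulr0; exact: cvg_cst.
    have y1 : \1_B y = 1 :> R by rewrite indicE mem_set.
    rewrite y1 mulr1; under eq_fun do rewrite mulr1.
    apply/cvgrPdist_le => e e0; near=> i.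
    rewrite distrC; apply: le_trans (Hjk i y yr) _; apply: ltW.
    by near: i; exact: near_infty_natSinv_lt (PosNum e0).
  have -> : g = fun y => Phi (G0 y * \1_B y) * \1_B y.
    apply/funext => y; have [yr|yr] := leP (enorm y) r4.
      by have -> : \1_B y = 1 :> R; [rewrite indicE mem_set|rewrite !mulr1].
    rewrite gr ?(ltW yr)//; have -> : \1_B y = 0 :> R; last by rewrite mulr0.
    by rewrite indicE memNset//=; apply/negP; rewrite -ltNge.
  apply: measurable_funM; last exact: measurable_indic.
  exact: (measurable_Phi mG0).
have grs y : r4 < enorm y -> g y = 0 by move=> /ltW; exact: gr.
pose V := (2 * r4) ^+ n.
have V0 : 0 < V by rewrite exprn_gt0// mulr_gt0.
have mfE f : measurable_fun setT f -> measurable_fun setT (fun y => (f y)%:E).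
  by move=> mf; exact/measurable_EFinP.
(* Near-optimality of [g] for the gradient at [F j], integrated, with all terms moved to where they
   are nonnegative. The error lives on a cube containing the ball: outside the ball [g = 0] and
   [G j >= 1], so the pointwise inequality holds without error. *)
have key eps J : 0 < eps -> exists2 j, (J <= j)%N &
   (mass (F j) + (nrm (F j) `^ (1 + s))%:E * \int[mu]_y ((g y)%:E * pot (F j) y) + powmass g <=
    mass g + (nrm (F j))%:E + powmass (F j) + (2 * eps * V)%:E)%E.
  move=> e0; have [j Jj Hj] := Gunif r4 eps J e0; exists j => //.
  have [[gF f1] _ _] := HF j; have [mF f0 _ _ _] := gF.
  have pfin y : pot (F j) y \is a fin_num by exact: (pot_fin_num b0 s0 bs n0 c0 r0 y (tF j)).
  have potE (h : Y -> R) y : ((h y)%:E * pot (F j) y = (h y * fine (pot (F j) y))%:E)%E.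
    by rewrite -[X in (_ * X)%E](fineK (pfin y)) -EFinM.
  have p0 y : 0 <= fine (pot (F j) y) by rewrite fine_ge0// pot_ge0.
  have mp : measurable_fun setT (fun y => fine (pot (F j) y)).
    by apply: measurableT_comp => //; apply: measurable_pot => //; exact: n0.
  pose N1 := nrm (F j) `^ (1 + s).
  have N10 : 0 <= N1 by exact: powR_ge0.
  have gradI (h : Y -> R) : measurable_fun setT h -> (forall y, 0 <= h y) ->
      (N1%:E * \int[mu]_y ((h y)%:E * pot (F j) y) = \int[mu]_y (h y * G j y)%:E)%E.
    move=> mh h0; rewrite -(ge0_integralZl_EFin _ measurableT _ _ N10); last 2 first.
    - by move=> y _; rewrite potE lee_fin mulr_ge0.
    - under eq_fun do rewrite potE; apply: mfE; exact: measurable_funM.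
    by apply: eq_integral => y _; rewrite potE -EFinM /G /grad -/N1; congr EFin; ring.
  have mG : measurable_fun setT (G j) by exact: (measurable_funM (measurable_cst _) mp).
  have mgq : measurable_fun setT (fun y => g y `^ q) by exact: measurable_fun_powRl.
  have mfq : measurable_fun setT (fun y => F j y `^ q) by exact: measurable_fun_powRl.
  have Gj0 y : 0 <= G j y by exact: grad_ge0.
  rewrite (nrm_mass_pot b0 s0 bs n0 gF) -/N1 !gradI//.
  have -> : (2 * eps * V)%:E = (\int[mu]_y (2 * eps * \1_(@cube R n r4) y)%:E)%E.
    under eq_integral do rewrite EFinM.
    rewrite (ge0_integralZl_EFin _ measurableT); last 3 first.
    - by move=> y _; rewrite lee_fin.
    - by apply: mfE; apply: measurable_indic; exact: measurable_cube.
    - by rewrite mulr_ge0// ltW.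
    rewrite integral_indic//; last exact: measurable_cube.
    by rewrite setIT; rewrite EFinM; congr (_ * _)%E; apply/esym/lebesgue_cube/ltW.
  have mc : measurable_fun setT (fun y : Y => 2 * eps * \1_(@cube R n r4) y).
    by apply: measurable_funM => //; apply: measurable_indic; exact: measurable_cube.
  have c2 y : 0 <= 2 * eps * \1_(@cube R n r4) y by rewrite !mulr_ge0// ltW.
  have intD (h k' : Y -> R) : measurable_fun setT h -> measurable_fun setT k' ->
      (forall y, 0 <= h y) -> (forall y, 0 <= k' y) ->
      (\int[mu]_y (h y)%:E + \int[mu]_y (k' y)%:E = \int[mu]_y (h y + k' y)%:E)%E.
    move=> mh mk' h0 k'0.
    have hE' y : [set: Y] y -> (0 <= (h y)%:E)%E by rewrite lee_fin.
    have kE y : [set: Y] y -> (0 <= (k' y)%:E)%E by rewrite lee_fin.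
    rewrite -(ge0_integralD _ measurableT hE' (mfE _ mh) kE (mfE _ mk')).
    by apply: eq_integral => y _; rewrite EFinD.
  have mgG := measurable_funM mg mG; have mfG := measurable_funM mF mG.
  have gG0 y : 0 <= g y * G j y by exact: mulr_ge0.
  have fG0 y : 0 <= F j y * G j y by exact: mulr_ge0.
  have q0' (h : Y -> R) y : 0 <= h y `^ q by exact: powR_ge0.
  have fgG0 y : 0 <= F j y + g y * G j y by exact: addr_ge0.
  have gfG0 y : 0 <= g y + F j y * G j y by exact: addr_ge0.
  have mfgG := measurable_funD mF mgG; have mgfG := measurable_funD mg mfG.
  have gfq0 y : 0 <= g y + F j y * G j y + F j y `^ q.
    by apply: addr_ge0; [exact: gfG0|exact: powR_ge0].
  have L1 := intD (F j) (fun y => g y * G j y) mF mgG f0 gG0.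
  have L2 := intD _ _ mfgG mgq fgG0 (q0' g).
  have R1 := intD g (fun y => F j y * G j y) mg mfG g0 fG0.
  have R2 := intD _ _ mgfG mfq gfG0 (q0' (F j)).
  have R3 := intD _ _ (measurable_funD mgfG mfq) mc gfq0 c2.
  apply: (@le_trans _ _ (\int[mu]_y (F j y + g y * G j y + g y `^ q)%:E)%E).
    by rewrite -L2 -L1; exact: lexx.
  apply: (@le_trans _ _ (\int[mu]_y (g y + F j y * G j y + F j y `^ q +
      2 * eps * \1_(@cube R n r4) y)%:E)%E); last first.
    by rewrite -R3 -R2 -R1; exact: lexx.
  have pos y : 0 <= F j y + g y * G j y + g y `^ q.
    by apply: addr_ge0; [apply: addr_ge0; [exact: f0|exact: gG0]|exact: powR_ge0].
  apply: nn_le_integral => y _; rewrite lee_fin; first exact: pos.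
  have [yr|yr] := leP (enorm y) r4; last first.
    have G1 : 1 <= G j y by apply: Hr4 => //; exact: ltW.
    rewrite grs// mul0r powR0 ?gt_eqF// !addr0 add0r.
    have := f0 y; have := q0' (F j) y; have := c2 y.
    by move: (F j y) (F j y `^ q) (G j y) (2 * eps * _) G1 => u v w t *; nra.
  rewrite indicE mem_set; last exact: enorm_cube.
  have := Hj y yr; rewrite ler_norml => /andP[h1 h2].
  have := Phi_max (G0 y) (f0 y); rewrite -/(g y) => opt.
  have gy := g01 y; have fy1 := f1 y; have fy0 := f0 y.
  have /andP[gy0 gy1] := gy; rewrite mulr1.
  exact: (arith3 h1 h2 opt gy0 gy1 fy0 fy1 (ltW e0)).
have powg : (powmass g <= mass g)%E.
  apply: nn_le_integral => y _; rewrite lee_fin ?powR_ge0//.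
  exact: powR_le1.
have massg_fin : mass g \is a fin_num.
  rewrite ge0_fin_numE ?mass_ge0//.
  apply: (@le_lt_trans _ _ (\int[mu]_y (\1_(@cube R n r4) y)%:E)%E).
    apply: nn_le_integral => y _; rewrite lee_fin//.
    have [yr|yr] := leP (enorm y) r4; last by rewrite grs.
    by rewrite indicE mem_set; [case/andP: (g01 y)|exact: enorm_cube].
  rewrite integral_indic//; last exact: measurable_cube.
  rewrite setIT; have : (mu (@cube R n r4) < +oo)%E by rewrite lebesgue_cube ?ltry// ltW.
  by [].
have powg_fin : powmass g \is a fin_num.
  rewrite ge0_fin_numE ?powmass_ge0//; apply: le_lt_trans powg _.
  by rewrite -ge0_fin_numE ?mass_ge0.
(* Positive mass is part of [good g], hence must precede [nrm_le_pot]. For [j >= 1], [Lam (F j)] is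
   at least [3 S / 4], while the error is [S / 8]. *)
have massg0 : (0 < mass g)%E.
  have e0 : 0 < c / (8 * V) by rewrite divr_gt0// mulr_gt0.
  have [j j1 Hj] := key _ 1%N e0; have [aF _ LF] := HF j.
  have [gF _] := aF.
  have I0 : (0 <= (nrm (F j) `^ (1 + s))%:E * \int[mu]_y ((g y)%:E * pot (F j) y))%E.
    rewrite mule_ge0 ?lee_fin ?powR_ge0//; apply: integral_ge0 => y _.
    by rewrite mule_ge0 ?pot_ge0 ?lee_fin.
  have : (mass (F j) <= mass g + (nrm (F j))%:E + powmass (F j) + (2 * (c / (8 * V)) * V)%:E)%E.
    apply: le_trans Hj; apply: (@le_trans _ _ (mass (F j) + (nrm (F j) `^ (1 + s))%:E *
      \int[mu]_y ((g y)%:E * pot (F j) y))%E); first exact: leeDl.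
    by apply: leeDl; exact: powmass_ge0.
  rewrite -(massK gF) -(fineK (powmass_fin_num aF)) -(fineK massg_fin) -!EFinD lee_fin lte_fin.
  have -> : 2 * (c / (8 * V)) * V = c / 4 by field; rewrite gt_eqF.
  have cj : c / j.+1%:R <= c / 2 by rewrite ler_pM2l// lef_pV2 ?posrE// ler_nat.
  by move=> H; exact: (arith1 LF H S0 cj).
have gg : good g by apply: (good_bounded mg g01 (ltW r40) grs).
have ag : adm g by split => // y; case/andP: (g01 y).
have LgS : S <= Lam g.
  apply/ler_addgt0Pr => e e0.
  have e1 : 0 < e / (4 * V) by rewrite divr_gt0// mulr_gt0.
  pose J := Num.truncn (2 * c / e).
  have [j Jj Hj] := key _ J e1; have [aF _ LF] := HF j.
  have [gF _] := aF.
  have Ng := nrm_le_pot b0 s0 bs n0 gF gg.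
  have H1 := le_trans (leeD (leeD (lexx (mass (F j))) Ng) (lexx (powmass g))) Hj.
  have := fine_le (mass_fin_num gF) (powmass_fin_num aF) massg_fin powg_fin H1.
  have -> : 2 * (e / (4 * V)) * V = e / 2 by field; rewrite gt_eqF.
  have cj : c / j.+1%:R <= e / 2.
    rewrite ler_pdivrMr// mulrC -ler_pdivrMr ?divr_gt0//.
    have -> : c / (e / 2) = 2 * c / e by field; rewrite gt_eqF.
    by apply: ltW; apply: lt_le_trans (truncnS_gt _) _; rewrite ler_nat ltnS.
  by move=> H; exact: (arith2 LF H cj).
exists g, G0; split.
- exact: ag.
- by move=> f af; exact: (le_trans (LS f af) LgS).
- exact: lt_le_trans S0 LgS.
- by [].
- by split; [exists r4|exact: Gm0].
Unshelve. all: by end_near. Qed.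

End existence.

End maximizer.

(** * Polarization *)

Lemma nn_integral_le_ae d (T : measurableType d) (R : realType)
    (mu : {measure set T -> \bar R}) (D : set T) (u v : T -> R) :
  measurable D -> measurable_fun D u -> measurable_fun D v ->
  (forall x, D x -> 0 <= v x) -> (forall x, D x -> v x <= u x) ->
  (\int[mu]_(x in D) (v x)%:E < +oo)%E ->
  (\int[mu]_(x in D) (u x)%:E <= \int[mu]_(x in D) (v x)%:E)%E ->
  {ae mu, forall x, D x -> u x = v x}.
Proof.
move=> mD mu' mv v0 vu Iv Iuv.
have w0 x : D x -> (0 <= (u x - v x)%:E)%E by move=> Dx; rewrite lee_fin subr_ge0 vu.
have mw : measurable_fun D (fun x => (u x - v x)%:E).
  by apply/measurable_EFinP; exact: measurable_funB.
have mvE : measurable_fun D (fun x => (v x)%:E) by exact/measurable_EFinP.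
have vE0 x : D x -> (0 <= (v x)%:E)%E by move=> Dx; rewrite lee_fin v0.
have E : (\int[mu]_(x in D) (u x)%:E =
    \int[mu]_(x in D) (u x - v x)%:E + \int[mu]_(x in D) (v x)%:E)%E.
  rewrite -(ge0_integralD _ mD w0 mw vE0 mvE).
  by apply: eq_integral => x _; rewrite -EFinD subrK.
have V0 : (0 <= \int[mu]_(x in D) (v x)%:E)%E by exact: integral_ge0.
have W0 : (0 <= \int[mu]_(x in D) (u x - v x)%:E)%E by exact: integral_ge0.
have I0 : (\int[mu]_(x in D) (u x - v x)%:E = 0)%E.
  apply/eqP; rewrite eq_le W0 andbT.
  move: Iuv; rewrite E -[leRHS]add0e leeD2rE//.
  by rewrite ge0_fin_numE.
have := integral_eq0_ae mD mw w0 I0; apply: filterS => x H Dx.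
by have [] := H Dx => /eqP; rewrite subr_eq0 => /eqP.
Qed.

Lemma adde_self_inj (R : realType) (x y : \bar R) : (0 <= x -> 0 <= y -> x + x = y + y -> x = y)%E.
Proof.
case: x => [x| |]; case: y => [y| |]//.
by rewrite -!EFinD => _ _ [] H; congr EFin; lra.
Qed.

(** Integrals are compared after doubling, because each integrand is paired with its reflection. *)
Lemma lee_doubleP (R : realType) (x y a b : \bar R) : (a = x + x -> b = y + y ->
  reflect (a <= b) (x <= y))%E.
Proof.
move=> -> ->; apply: (iffP idP) => [xy|]; first exact: leeD.
by apply: contraTT; rewrite -!ltNge => lt; exact: lteD.
Qed.

Lemma cube_enorm_lt (R : realType) n (r : R) (v : 'rV[R]_n) :
  0 < r -> cube (r / n.+1%:R) v -> enorm v < r.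
Proof.
move=> r0 vr; have rn : 0 <= r / n.+1%:R by rewrite divr_ge0// ltW.
apply: le_lt_trans (cube_enorm rn vr) _.
by rewrite mulrCA gtr_pMr// ltr_pdivrMr// mul1r ltr_nat.
Qed.

(** With [u = y - w], expanding [|u - e| ^ 2 < |e| ^ 2] gives [2 u.e > |u| ^ 2 >= 0]. *)
Lemma side_gt0_near (R : realType) n (w e y : 'rV[R]_n) :
  enorm (y - (w + e)) < enorm e -> 0 < side w e y.
Proof.
move=> ye; have du : dot (y - w - e) (y - w - e) < dot e e.
  by rewrite -!sqr_enorm ltr_pXn2r ?nnegrE ?enorm_ge0// -addrA -opprD.
have := dot_ge0 (y - w); move: du; rewrite /side; move: (y - w) => u.
rewrite !dotE (dotC e u).
by move: (dot u u) (dot u e) (dot e e) => A B C; lra.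
Qed.

Lemma le_eq2 d (T : porderType d) (x y a b : T) : x = a -> y = b -> (x <= y -> a <= b)%O.
Proof. by move=> -> ->. Qed.

Section polarization.
Context (R : realType) (n : nat) (b s q : R).
Hypotheses (b0 : 0 < b) (s0 : 0 < s) (bs : n.+1%:R < b * s) (n0 : (0 < n)%N).
Local Notation Y := 'rV[R]_n.
Local Notation X := ('rV[R]_n * measurableTypeR R)%type.
Local Notation mu := (lebesgue_rV R n).
Local Notation nu := (lebesgue_rV R n \x @lebesgue_measure R)%E.
Local Notation D := (@upper R n).
Local Notation ker := (@ker R n b).
Local Notation ext := (@ext R n b).
Local Notation good := (@good R n b).
Local Notation energy := (@energy R n b s).
Local Notation nrm := (@nrm R n b s).
Variables (w e : Y).
Hypothesis e0 : e != 0.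
Local Notation side := (side w e).
Local Notation refl := (refl w e).
Implicit Types (f g : Y -> R) (x : X) (y z : Y).

Let mD : measurable D := @measurable_upper R n.

(** Two-point rearrangement towards the half-space [0 <= side]. *)
Definition polar f y :=
  if 0 <= side y then Order.max (f y) (f (refl y)) else Order.min (f y) (f (refl y)).

Let side_refl' y : side (refl y) = - side y. Proof. exact: side_refl. Qed.

Let reflK' y : refl (refl y) = y. Proof. exact: reflK. Qed.

Lemma refl_fixed y : side y = 0 -> refl y = y.
Proof. by move=> y0; rewrite /refl y0 mulr0 mul0r scale0r subr0. Qed.

Lemma polar_pair f y : polar f y = f y /\ polar f (refl y) = f (refl y) \/
  polar f y = f (refl y) /\ polar f (refl y) = f y.
Proof.
rewrite /polar side_refl' reflK' oppr_ge0.
have [y0|y0|y0] := ltgtP 0 (side y).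
- by rewrite /Order.max /Order.min; case: (ltgtP (f y)) => [h|h|->]; [right|left|left].
- by rewrite /Order.max /Order.min; case: (ltgtP (f y)) => [h|h|->]; [left|right|left].
- by rewrite refl_fixed// maxxx; left.
Qed.

Lemma polar_refl f y : polar (f \o refl) y = polar f y.
Proof. by rewrite /polar /= reflK' maxC minC. Qed.

Lemma polar_fun_refl f : polar (f \o refl) = polar f.
Proof. by apply/funext => y; exact: polar_refl. Qed.

Lemma polar_sum (phi : R -> R) f y :
  phi (polar f y) + phi (polar f (refl y)) = phi (f y) + phi (f (refl y)).
Proof. by have [[-> ->]|[-> ->]] := polar_pair f y; rewrite // addrC. Qed.

Lemma measurable_polar f : measurable_fun setT f -> measurable_fun setT (polar f).
Proof.
move=> mf; have mfr : measurable_fun setT (fun y => f (refl y)).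
  by apply: measurableT_comp mf _; exact: measurable_refl.
apply: measurable_fun_ifT.
- apply: measurable_fun_ler => //; exact: measurable_side.
- exact: measurable_maxr.
- exact: measurable_minr.
Qed.

(** Added to its reflection, the integrand is unchanged by [polar]. The general [phi] covers both
    the mass and [powmass]. *)
Lemma mass_polar (phi : R -> R) f : measurable_fun setT phi -> (forall t, 0 <= phi t) ->
  measurable_fun setT f ->
  mass (fun y => phi (polar f y)) = mass (fun y => phi (f y)).
Proof.
move=> mphi phi0 mf; apply: adde_self_inj; [exact: mass_ge0|exact: mass_ge0|].
have int2 h : measurable_fun setT h ->
    (mass (fun y => phi (h y)) + mass (fun y => phi (h y)) =
     \int[mu]_y (phi (h y) + phi (h (refl y)))%:E)%E.
  move=> mh.
  have m1 : measurable_fun setT (fun y => (phi (h y))%:E).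
    by apply/measurable_EFinP; exact: measurableT_comp mphi mh.
  have p1 y : [set: Y] y -> (0 <= (phi (h y))%:E)%E by rewrite lee_fin.
  have p1' y : (0 <= (phi (h y))%:E)%E by rewrite lee_fin.
  have m2 : measurable_fun setT (fun y => (phi (h (refl y)))%:E).
    by apply: measurableT_comp m1 _; exact: measurable_refl.
  have p2 y : [set: Y] y -> (0 <= (phi (h (refl y)))%:E)%E by rewrite lee_fin.
  rewrite {2}/mass -(integral_refl w e0 m1 p1') -(ge0_integralD _ measurableT p1 m1 p2 m2).
  by apply: eq_integral => y _; rewrite EFinD.
rewrite int2; last exact: measurable_polar.
rewrite int2//; apply: eq_integral => y _; congr EFin; exact: polar_sum.
Qed.

Lemma ker_refl x y : ker (refl x.1, x.2) y = ker x (refl y).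
Proof.
by rewrite /ker /dist /= -{1}(reflK' y) enorm_reflB.
Qed.

Lemma ext_refl f x : measurable_fun setT f -> (forall y, 0 <= f y) ->
  ext (f \o refl) x = ext f (refl x.1, x.2).
Proof.
move=> mf f0; pose F y := (ker (refl x.1, x.2) y * f y)%:E.
have mF : measurable_fun setT F by exact: measurable_kerM1.
have F0 y : (0 <= F y)%E by rewrite lee_fin mulr_ge0 ?ker_ge0.
have FE y : F (refl y) = (ker x y * (f \o refl) y)%:E by rewrite /F /= ker_refl reflK'.
rewrite -[RHS](integral_refl w e0 mF F0).
by apply: eq_integral => y _; rewrite FE.
Qed.

Lemma ext_double f x : measurable_fun setT f -> (forall y, 0 <= f y) ->
  (ext f x + ext f x = \int[mu]_y (ker x y * f y + ker x (refl y) * f (refl y))%:E)%E.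
Proof.
move=> mf f0.
have m1 : measurable_fun setT (fun y => (ker x y * f y)%:E) := measurable_kerM1 b x mf.
have p1 y : (0 <= (ker x y * f y)%:E)%E by rewrite lee_fin mulr_ge0 ?ker_ge0.
have m2 : measurable_fun setT (fun y => (ker x (refl y) * f (refl y))%:E).
  by apply: measurableT_comp m1 _; exact: measurable_refl.
have E := integral_refl w e0 m1 p1.
rewrite -[X in (_ + X)%E]E.
rewrite -(ge0_integralD _ measurableT (fun y _ => p1 y) m1 (fun y _ => p1 (refl y)) m2).
by apply: eq_integral => y _; rewrite EFinD.
Qed.

Lemma ler_ker_refl x y : 0 <= side x.1 -> 0 <= side y -> ker x y <= ker x (refl y).
Proof.
move=> x0 y0; apply: ge0_ler_powR; rewrite ?nnegrE ?dist_ge0 ?(ltW b0)//.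
rewrite -(@ler_pXn2r _ 2) ?nnegrE ?dist_ge0// !sqr_dist lerD2r (sqr_dist_refl w e0 x.1 y) lerDl.
by rewrite divr_ge0 ?dot_ge0// !mulr_ge0.
Qed.

Lemma ltr_ker_refl x y : 0 < side x.1 -> 0 < side y -> ker x y < ker x (refl y).
Proof.
move=> x0 y0; apply: gt0_ltr_powR; rewrite ?nnegrE ?dist_ge0//.
rewrite -(@ltr_pXn2r _ 2) ?nnegrE ?dist_ge0// !sqr_dist ltrD2r (sqr_dist_refl w e0 x.1 y) ltrDl.
by rewrite divr_gt0 ?dot_gt0// !mulr_gt0.
Qed.

Let pair_gap f x y : ker x y * f y + ker x (refl y) * f (refl y) -
    (ker x y * polar f y + ker x (refl y) * polar f (refl y)) =
  (ker x (refl y) - ker x y) * (polar f y - f y).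
Proof.
have := polar_sum id f y => /= H.
have -> : polar f (refl y) = f y + f (refl y) - polar f y by rewrite -H addrC addKr.
move: (ker x y) (ker x (refl y)) (f y) (f (refl y)) (polar f y) => k k' a a' p.
by ring.
Qed.

(** For [y] on the side of [x] both factors are nonnegative; on the other side both are
    nonpositive. *)
Let pair_gap_ge0 f x y : 0 <= side x.1 -> 0 <= (ker x (refl y) - ker x y) * (polar f y - f y).
Proof.
move=> x0; have [y0|/ltW y0] := leP 0 (side y).
  by rewrite mulr_ge0 ?subr_ge0 ?ler_ker_refl// /polar y0 le_max lexx.
have y0' : 0 <= side (refl y) by rewrite side_refl' oppr_ge0.
rewrite -mulrNN mulr_ge0// !opprB subr_ge0.
  by rewrite -{2}(reflK' y) ler_ker_refl.
have [ys|yn0] := eqVneq (side y) 0; last first.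
  have yl : side y < 0 by rewrite lt_neqAle yn0.
  by rewrite /polar (lt_geF yl) ge_min lexx.
by rewrite /polar refl_fixed// maxxx minxx if_same.
Qed.

Let gap_int f x : good f -> 0 <= side x.1 ->
  let u := fun y => ker x y * f y + ker x (refl y) * f (refl y) in
  let v := fun y => ker x y * polar f y + ker x (refl y) * polar f (refl y) in
  (forall y, 0 <= v y) /\ (forall y, v y <= u y).
Proof.
move=> [mf f0 _ _ _] x0 /=; split=> y.
  have p0 z : 0 <= polar f z by rewrite /polar; case: ifP => _; rewrite ?le_max ?le_min ?f0.
  by rewrite addr_ge0// mulr_ge0 ?ker_ge0.
by rewrite -subr_ge0 pair_gap pair_gap_ge0.
Qed.

Lemma polar_ge0 f y : (forall y, 0 <= f y) -> 0 <= polar f y.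
Proof. by move=> f0; rewrite /polar; case: ifP => _; rewrite ?le_max ?le_min ?f0. Qed.

Lemma polar_le1 f y : (forall y, f y <= 1) -> polar f y <= 1.
Proof. by move=> f1; rewrite /polar; case: ifP => _; rewrite ?ge_max ?ge_min ?f1. Qed.

Let measurable_f_refl f : measurable_fun setT f -> measurable_fun setT (f \o refl).
Proof. by move=> mf; apply: measurableT_comp mf _; exact: measurable_refl. Qed.

Lemma good_refl f : good f -> good (f \o refl).
Proof.
move=> [mf f0 M0 Moo Eoo]; have mfr := measurable_f_refl mf.
have mE : measurable_fun setT (fun y => (f y)%:E) by exact/measurable_EFinP.
have fE0 y : (0 <= (f y)%:E)%E by rewrite lee_fin.
have ME : mass (f \o refl) = mass f by exact: (integral_refl w e0 mE fE0).
split=> //; [by move=> y /=|by rewrite ME|by rewrite ME|].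
by move=> x; rewrite ext_refl.
Qed.

Lemma mass_polar_id f : measurable_fun setT f -> (forall y, 0 <= f y) ->
  mass (polar f) = mass f.
Proof.
move=> mf f0.
have mm : measurable_fun setT (fun t : R => Order.max t 0) by exact: measurable_maxr.
have m0 (t : R) : 0 <= Order.max t 0 by rewrite le_max lexx orbT.
have := mass_polar mm m0 mf.
have -> : (fun y => Order.max (polar f y) 0) = polar f.
  by apply/funext => y; rewrite max_l// polar_ge0.
by have -> : (fun y => Order.max (f y) 0) = f by apply/funext => y; rewrite max_l.
Qed.

Let ext_sum f x : measurable_fun setT f -> (forall y, 0 <= f y) ->
  (ext f x + ext f (refl x.1, x.2) = \int[mu]_y (ker x y * (f y + f (refl y)))%:E)%E.
Proof.
move=> mf f0; rewrite -ext_refl//.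
have m1 : measurable_fun setT (fun y => (ker x y * f y)%:E) := measurable_kerM1 b x mf.
have m2 : measurable_fun setT (fun y => (ker x y * (f \o refl) y)%:E) :=
  measurable_kerM1 b x (measurable_f_refl mf).
have p1 y : [set: Y] y -> (0 <= (ker x y * f y)%:E)%E by rewrite lee_fin mulr_ge0 ?ker_ge0.
have p2 y : [set: Y] y -> (0 <= (ker x y * (f \o refl) y)%:E)%E.
  by rewrite lee_fin mulr_ge0 ?ker_ge0/=.
rewrite -(ge0_integralD _ measurableT p1 m1 p2 m2).
by apply: eq_integral => y _; rewrite -EFinD mulrDr.
Qed.

Lemma ext_polar_sum f x : measurable_fun setT f -> (forall y, 0 <= f y) ->
  (ext (polar f) x + ext (polar f) (refl x.1, x.2) = ext f x + ext f (refl x.1, x.2))%E.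
Proof.
move=> mf f0; have mp := measurable_polar mf; have p0 y : 0 <= polar f y by exact: polar_ge0.
rewrite ext_sum// ext_sum//.
by apply: eq_integral => y _; congr (_ * _)%:E; exact: (polar_sum id).
Qed.

Lemma good_polar f : good f -> good (polar f).
Proof.
move=> gf; have [mf f0 M0 Moo Eoo] := gf.
have p0 y : 0 <= polar f y by exact: polar_ge0.
split=> //; [exact: measurable_polar|by rewrite mass_polar_id|by rewrite mass_polar_id|].
move=> x; apply: (@le_lt_trans _ _ (ext f x + ext f (refl x.1, x.2))%E).
  rewrite -ext_polar_sum// leeDl// ext_ge0//.
by rewrite lte_add_pinfty.
Qed.

Lemma ext_polar_le f x : good f -> 0 <= side x.1 -> (ext (polar f) x <= ext f x)%E.
Proof.
move=> gf x0; have [mf f0 _ _ _] := gf.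
have [v0 vu] := gap_int gf x0.
have mp := measurable_polar mf; have p0 y : 0 <= polar f y by exact: polar_ge0.
apply/(lee_doubleP (esym (ext_double x mp p0)) (esym (ext_double x mf f0))).
by apply: nn_le_integral => y _; rewrite lee_fin.
Qed.

(** The gap, being nonnegative with zero integral, vanishes almost everywhere. Its kernel factor is
    nonzero off the hyperplane, and on the hyperplane the reflection is the identity. *)
Lemma ext_polar_eq f x : good f -> 0 < side x.1 -> ext (polar f) x = ext f x ->
  {ae mu, forall y, polar f y = f y}.
Proof.
move=> gf x0 E; have [mf f0 _ _ Eoo] := gf.
have [v0 vu] := gap_int gf (ltW x0).
have mp := measurable_polar mf; have p0 y : 0 <= polar f y by exact: polar_ge0.
have mpair h : measurable_fun setT h ->
    measurable_fun setT (fun y => ker x y * h y + ker x (refl y) * h (refl y)).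
  move=> mh; have m1 : measurable_fun setT (fun y => ker x y * h y).
    by apply/measurable_EFinP; exact: (measurable_kerM1 b x mh).
  by apply: measurable_funD => //; apply: measurableT_comp m1 _; exact: measurable_refl.
have H := @nn_integral_le_ae _ _ _ mu setT _ _ measurableT (mpair _ mf) (mpair _ mp)
  (fun y _ => v0 y) (fun y _ => vu y).
have D1 := ext_double x mp p0; have D2 := ext_double x mf f0.
rewrite -D1 -D2 E in H; have {H} := H _ (lexx _).
rewrite lte_add_pinfty// => /(_ isT); apply: filterS => y /(_ I) uv.
have : (ker x (refl y) - ker x y) * (polar f y - f y) = 0.
  by rewrite -pair_gap; apply/eqP; rewrite subr_eq0; apply/eqP.
have [y0|y0|y0] := ltgtP (side y) 0; last by rewrite /polar refl_fixed// y0 lexx maxxx.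
- move=> /eqP; rewrite mulf_eq0 subr_eq0 => /orP[|]; last by rewrite subr_eq0 => /eqP.
  have yr0 : 0 < side (refl y) by rewrite side_refl' oppr_gt0.
  have h := ltr_ker_refl x0 yr0; rewrite reflK' in h.
  by move=> /eqP E0; rewrite E0 ltxx in h.
- move=> /eqP; rewrite mulf_eq0 subr_eq0 => /orP[|]; last by rewrite subr_eq0 => /eqP.
  have h := ltr_ker_refl x0 y0.
  by move=> /eqP E0; rewrite E0 ltxx in h.
Qed.

(** Energy density summed over a point and its mirror image, the quantity to which majorization
    applies. *)
Let pairE f x := fine (ext f x) `^ (- s) + fine (ext f (refl x.1, x.2)) `^ (- s).

Let D_refl x : D x -> D (refl x.1, x.2). Proof. by []. Qed.

(** On the positive side the extension of [polar f] lies below both that of [f] and that of its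
    reflection, since the two have the same polarization. The sum over mirror points is preserved,
    so [powRN_majorization] applies. *)
Let polar_majorization f x : D x -> 0 <= side x.1 -> good f ->
  pairE f x <= pairE (polar f) x /\
  (ext (polar f) x != ext f x -> ext (polar f) x != ext f (refl x.1, x.2) ->
   pairE f x < pairE (polar f) x).
Proof.
move=> Dx x0 gf; have [mf f0 _ _ _] := gf.
have gp := good_polar gf; have gr := good_refl gf.
have A0 := fine_ext_gt0 Dx gp.
have Aa := ext_polar_le gf x0.
have Ab : (ext (polar f) x <= ext f (refl x.1, x.2))%E.
  have := ext_polar_le gr x0; rewrite (ext_refl x mf f0) polar_fun_refl; exact.
have AB := ext_polar_sum x mf f0.
have EA := extK x gp; have EB := extK (refl x.1, x.2) gp.
have Ea := extK x gf; have Eb := extK (refl x.1, x.2) gf.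
have Na : ext (polar f) x != ext f x -> fine (ext (polar f) x) != fine (ext f x).
  by apply: contra_neq => E; exact: (etrans (esym EA) (etrans (congr1 EFin E) Ea)).
have Nb : ext (polar f) x != ext f (refl x.1, x.2) ->
    fine (ext (polar f) x) != fine (ext f (refl x.1, x.2)).
  by apply: contra_neq => E; exact: (etrans (esym EA) (etrans (congr1 EFin E) Eb)).
rewrite -EA -Ea lee_fin in Aa; rewrite -EA -Eb lee_fin in Ab.
rewrite -EA -EB -Ea -Eb -EFinD -EFinD in AB.
have [H1 H2] := powRN_majorization s0 A0 Aa Ab (EFin_inj AB).
split; first exact: H1.
move=> /Na na /Nb nb; apply: H2; rewrite lt_neqAle.
  by apply/andP; split; [exact: na|exact: Aa].
by apply/andP; split; [exact: nb|exact: Ab].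
Qed.

Let pairE_refl f x : pairE f (refl x.1, x.2) = pairE f x.
Proof.
have E : (refl (refl x.1), x.2) = x by rewrite reflK'; case: x.
by rewrite /pairE [in LHS]E; exact: addrC.
Qed.

Let pairE_le f x : D x -> good f -> pairE f x <= pairE (polar f) x.
Proof.
move=> Dx gf; have [x0|x0] := leP 0 (side x.1).
  by have [] := polar_majorization Dx x0 gf.
have x0' : 0 <= side (refl x.1, x.2).1 by rewrite /= side_refl' oppr_ge0 ltW.
by rewrite -pairE_refl -(pairE_refl (polar f)); have [] := polar_majorization (D_refl Dx) x0' gf.
Qed.

Let measurable_pairE f : good f -> measurable_fun D (pairE f).
Proof.
move=> gf; have m1 : measurable_fun setT (fun x => fine (ext f x) `^ (- s)).
  apply: measurable_fun_powRl; apply: measurableT_comp => //.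
  by have [mf f0 _ _ _] := gf; exact: measurable_ext.
have mr : measurable_fun setT (fun x : X => (refl x.1, x.2) : X).
  apply/measurable_fun_pairP; split => /=; last exact: measurable_snd.
  apply: (@measurableT_comp _ _ _ _ _ _ refl _ fst) measurable_fst.
  exact: measurable_refl.
have m2 := measurableT_comp m1 mr.
exact: measurable_funTS (measurable_funD m1 m2).
Qed.

Let integral_pairE f : good f ->
  (\int[nu]_(x in D) (pairE f x)%:E = energy f + energy f)%E.
Proof.
move=> gf; have [mf f0 _ _ _] := gf.
pose F x := (fine (ext f x) `^ (- s))%:E.
have mF : measurable_fun setT F.
  apply/measurable_EFinP; apply: measurable_fun_powRl; apply: measurableT_comp => //.
  exact: measurable_ext.
have F0 x : (0 <= F x)%E by rewrite lee_fin powR_ge0.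
have E := upper_refl w e0 mF F0.
transitivity (energy f + \int[nu]_(x in D) F (refl x.1, x.2))%E; last exact: congr1 E.
have m2 : measurable_fun D (fun x => F (refl x.1, x.2)).
  apply: measurable_funTS; apply: measurableT_comp mF _.
  apply/measurable_fun_pairP; split => /=; last exact: measurable_snd.
  apply: (@measurableT_comp _ _ _ _ _ _ refl _ fst) measurable_fst.
  exact: measurable_refl.
rewrite -(ge0_integralD _ mD (fun x _ => F0 x) (measurable_funTS mF)
  (fun x _ => F0 (refl x.1, x.2)) m2).
by apply: eq_integral => x _; rewrite /F -EFinD.
Qed.

(** Without loss of energy, [pairE] is unchanged almost everywhere. A single point [x] strictly on
    the positive side then suffices: majorization is not strict there, so the extension of [polar f]
    at [x] equals one of the two competing values, and [ext_polar_eq] propagates this to almost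
    every [y]. *)
Lemma energy_polar_eq f : good f -> (energy (polar f) <= energy f)%E ->
  {ae mu, forall y, polar f y = f y} \/ {ae mu, forall y, polar f y = f (refl y)}.
Proof.
move=> gf H; have gp := good_polar gf; have [mf f0 _ _ _] := gf.
have p0 h x : D x -> 0 <= pairE h x by rewrite addr_ge0 ?powR_ge0.
have foo : (\int[nu]_(x in D) (pairE f x)%:E < +oo)%E.
  rewrite (integral_pairE gf); apply: lte_add_pinfty; exact: energy_lty.
have le2 : (\int[nu]_(x in D) (pairE (polar f) x)%:E <= \int[nu]_(x in D) (pairE f x)%:E)%E.
  exact/(lee_doubleP (integral_pairE gp) (integral_pairE gf)).
have Q := nn_integral_le_ae mD (measurable_pairE gp) (measurable_pairE gf)
  (fun x Dx => p0 f x Dx) (fun x Dx => pairE_le Dx gf) foo le2.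
have e0' := enorm_gt0 e0.
have r0 : 0 < enorm e / n.+1%:R by rewrite divr_gt0.
have [x [Dx xE xc]] := ae_upper_exists (w + e) r0 Q.
have x0 : 0 < side x.1 := side_gt0_near (cube_enorm_lt e0' xc).
have [_ S] := polar_majorization Dx (ltW x0) gf.
have [E1|N1] := eqVneq (ext (polar f) x) (ext f x).
  by left; exact: ext_polar_eq E1.
have [E2|N2] := eqVneq (ext (polar f) x) (ext f (refl x.1, x.2)).
  right; have gr := good_refl gf.
  have H2 := @ext_polar_eq (f \o refl) x gr x0; rewrite polar_fun_refl (ext_refl x mf f0) in H2.
  exact: H2 E2.
by have := S N1 N2; rewrite xE ltxx.
Qed.

Lemma polar_maximizer f : @adm R n b f ->
  (forall h, @adm R n b h -> @Lam R n b s q h <= @Lam R n b s q f) ->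
  {ae mu, forall y, polar f y = f y} \/ {ae mu, forall y, polar f y = f (refl y)}.
Proof.
move=> [gf f1] fmax; have [mf f0 _ _ _] := gf; have gp := good_polar gf.
apply: (energy_polar_eq gf).
have L : @Lam R n b s q (polar f) <= @Lam R n b s q f.
  by apply: fmax; split=> // y; exact: polar_le1.
have E1 : mass (polar f) = mass f by exact: mass_polar_id.
have E2 : powmass q (polar f) = powmass q f.
  exact: (@mass_polar (fun t : R => t `^ q) f (measurable_powR q)
    (fun t => powR_ge0 t q) mf).
have N : nrm f <= nrm (polar f).
  by rewrite /Lam E1 E2 lerD2l lerN2 in L.
have := le_eq2 (nrm_powN b0 s0 bs n0 gp) (nrm_powN b0 s0 bs n0 gf)
  (ler_powRN (ltW s0) (nrm_gt0 b0 s0 bs n0 gf) N).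
rewrite -lee_fin; exact: le_eq2 (energyK b0 s0 bs n0 gp) (energyK b0 s0 bs n0 gf).
Qed.

End polarization.

(** * Radial symmetry *)

Section moments.
Context (R : realType) (n : nat) (g : 'rV[R]_n -> R) (r : R).
Local Notation Y := 'rV[R]_n.
Local Notation mu := (lebesgue_rV R n).
Hypotheses (mg : measurable_fun setT g) (g0 : forall y, 0 <= g y).
Hypotheses (Mg0 : (0 < mass g)%E) (Mg : (mass g < +oo)%E).
Hypotheses (gr : forall y, r < enorm y -> g y = 0).
Implicit Types (h : Y -> R) (w e : Y).

(** Boundedness on the ball that carries [g], hence integrability against [g]. *)
Definition locally_bounded h := measurable_fun setT h /\
  exists K, forall y, enorm y <= r -> `|h y| <= K.

Definition moment h : R := Rintegral mu setT (fun y => h y * g y).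

Let M : R := fine (mass g).

Let M_gt0 : 0 < M.
Proof. by rewrite fine_gt0// Mg0. Qed.

Lemma integrable_moment h : locally_bounded h ->
  mu.-integrable setT (EFin \o (fun y => h y * g y)).
Proof.
move=> [mh [K hK]].
have ig : mu.-integrable setT (EFin \o g).
  apply/integrableP; split; first exact/measurable_EFinP.
  have -> : (\int[mu]_y `|(EFin \o g) y| = mass g)%E; last by [].
  by apply: eq_integral => y _ /=; rewrite ger0_norm.
have := integrableZl measurableT K ig; apply: le_integrable => //.
  by apply/measurable_EFinP; exact: measurable_funM.
move=> y _ /=; rewrite lee_fin !normrM.
have [yr|yr] := leP (enorm y) r; last by rewrite gr// normr0 !mulr0.
by rewrite ler_wpM2r// (le_trans (hK _ yr))// ler_norm.
Qed.

Lemma locally_bounded_cst (k : R) : locally_bounded (fun=> k).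
Proof. by split=> //; exists `|k|. Qed.

Lemma locally_boundedD h h' : locally_bounded h -> locally_bounded h' ->
  locally_bounded (fun y => h y + h' y).
Proof.
move=> [mh [K hK]] [mh' [K' hK']]; split; first exact: measurable_funD.
by exists (K + K') => y yr; rewrite (le_trans (ler_normD _ _))// lerD ?hK ?hK'.
Qed.

Lemma locally_boundedZ (k : R) h : locally_bounded h -> locally_bounded (fun y => k * h y).
Proof.
move=> [mh [K hK]]; split; first exact: measurable_funM.
by exists (`|k| * K) => y yr; rewrite normrM ler_wpM2l ?hK.
Qed.

Lemma locally_bounded_coord (i : 'I_n) : locally_bounded (fun y => y ord0 i).
Proof.
split; first exact: measurable_rV_coord.
by exists r => y yr; rewrite (le_trans (coord_le_enorm _ _)).
Qed.

Lemma moment_cst k : moment (fun=> k) = k * M.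
Proof.
have := integrable_moment (locally_bounded_cst 1).
have -> : (fun y => 1 * g y) = g by apply/funext => y; rewrite mul1r.
by move=> ig; rewrite /moment RintegralZl.
Qed.

Lemma momentD h h' : locally_bounded h -> locally_bounded h' ->
  moment (fun y => h y + h' y) = moment h + moment h'.
Proof.
move=> bh bh'; rewrite /moment -RintegralD ?integrable_moment//.
by apply: eq_Rintegral => y _; rewrite mulrDl.
Qed.

Lemma momentZ k h : locally_bounded h -> moment (fun y => k * h y) = k * moment h.
Proof.
move=> bh; rewrite /moment -RintegralZl ?integrable_moment//.
by apply: eq_Rintegral => y _; rewrite mulrA.
Qed.

Definition center : Y := \row_i (moment (fun y => y ord0 i) / M).

Lemma locally_bounded_sum (I : Type) (s : seq I) (F : I -> Y -> R) :
  (forall i, locally_bounded (F i)) -> locally_bounded (fun y => \sum_(i <- s) F i y).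
Proof.
move=> bF; elim: s => [|i s IH].
  have -> : (fun y => \sum_(i <- [::]) F i y) = fun=> 0.
    by apply/funext => y; rewrite big_nil.
  exact: locally_bounded_cst.
have -> : (fun y => \sum_(j <- i :: s) F j y) = fun y => F i y + \sum_(j <- s) F j y.
  by apply/funext => y; rewrite big_cons.
exact: locally_boundedD.
Qed.

Lemma moment_sum (I : Type) (s : seq I) (F : I -> Y -> R) :
  (forall i, locally_bounded (F i)) ->
  moment (fun y => \sum_(i <- s) F i y) = \sum_(i <- s) moment (F i).
Proof.
move=> bF; elim: s => [|i s IH].
  have -> : (fun y => \sum_(i <- [::]) F i y) = fun=> 0.
    by apply/funext => y; rewrite big_nil.
  by rewrite big_nil moment_cst mul0r.
have -> : (fun y => \sum_(j <- i :: s) F j y) = fun y => F i y + \sum_(j <- s) F j y.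
  by apply/funext => y; rewrite big_cons.
by rewrite big_cons momentD ?IH//; exact: locally_bounded_sum.
Qed.

Let sideE w e y : side w e y = \sum_(i < n) e ord0 i * y ord0 i + - dot w e.
Proof.
by rewrite /side !dotE; congr (_ - _); apply: eq_bigr => i _; rewrite mulrC.
Qed.

Let side_locally_bounded w e : locally_bounded (side w e).
Proof.
have -> : side w e = fun y => \sum_(i < n) e ord0 i * y ord0 i + - dot w e.
  by apply/funext => y; rewrite sideE.
apply: locally_boundedD; last exact: locally_bounded_cst.
by apply: locally_bounded_sum => i; apply: locally_boundedZ; exact: locally_bounded_coord.
Qed.

Lemma moment_side w e : moment (side w e) = side w e center * M.
Proof.
have -> : side w e = fun y => \sum_(i < n) e ord0 i * y ord0 i + - dot w e.
  by apply/funext => y; rewrite sideE.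
have bc i : locally_bounded (fun y => e ord0 i * y ord0 i).
  by apply: locally_boundedZ; exact: locally_bounded_coord.
rewrite momentD; [|exact: locally_bounded_sum|exact: locally_bounded_cst].
rewrite moment_sum// moment_cst [RHS]mulrDl mulr_suml; congr (_ + _).
apply: eq_bigr => i _; rewrite momentZ; last exact: locally_bounded_coord.
by rewrite mxE -mulrA divfK// gt_eqF.
Qed.

(** Split [side] into its positive and negative parts. Reflection turns the moment of the negative
    part into that of the positive part against [g (refl y)], which is at most that against [g y].
    So the moment of [side], which is its value at the center times the mass, is nonnegative. *)
Lemma side_center_ge0 w e : e != 0 ->
  {ae mu, forall y, 0 <= side w e y -> g (refl w e y) <= g y} -> 0 <= side w e center.
Proof.
move=> e0 Hae.
pose sp y := Order.max (side w e y) 0; pose sm y := Order.max (- side w e y) 0.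
have msp : measurable_fun setT sp by apply: measurable_maxr => //; exact: measurable_side.
have msm : measurable_fun setT sm.
  by apply: measurable_maxr => //; apply: measurableT_comp => //; exact: measurable_side.
have sp0 y : 0 <= sp y by rewrite le_max lexx orbT.
have sm0 y : 0 <= sm y by rewrite le_max lexx orbT.
have [_ [K sK]] := side_locally_bounded w e.
have bsp : locally_bounded sp.
  split=> //; exists K => y /sK; apply: le_trans; rewrite ger0_norm// ge_max normr_ge0.
  by rewrite ler_norm.
have bsm : locally_bounded sm.
  split=> //; exists K => y /sK; apply: le_trans; rewrite ger0_norm// ge_max normr_ge0.
  by rewrite -normrN ler_norm.
rewrite -(pmulr_lge0 _ M_gt0) -moment_side.
have -> : moment (side w e) = moment sp - moment sm.
  rewrite /moment -RintegralB ?integrable_moment//.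
  apply: eq_Rintegral => y _; rewrite -mulrBl; congr (_ * _).
  rewrite /sp /sm /Order.max; move: (side w e y) => S.
  by case: ltP => ?; case: ltP => ?; lra.
rewrite subr_ge0 /moment; apply: fine_le.
- exact: integral_fune_fin_num (integrable_moment bsm).
- exact: integral_fune_fin_num (integrable_moment bsp).
have mF : measurable_fun setT (fun y => (sm y * g y)%:E).
  by apply/measurable_EFinP; exact: measurable_funM.
have F0 y : (0 <= (sm y * g y)%:E)%E by rewrite lee_fin mulr_ge0.
rewrite -(integral_refl w e0 mF F0).
apply: nn_ae_le_integral => //; first by move=> y _; rewrite lee_fin mulr_ge0.
apply: filterS Hae => y H _; rewrite lee_fin.
have -> : sm (refl w e y) = sp y by rewrite /sm side_refl// opprK.
have [y0|y0] := leP 0 (side w e y); first by rewrite ler_wpM2l// H.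
by rewrite /sp max_r ?mul0r// ltW.
Qed.

End moments.

(** * Monotonicity of the maximizer about its barycenter *)

Section radial.
Context (R : realType) (n : nat) (b s q : R).
Hypotheses (b0 : 0 < b) (s0 : 0 < s) (bs : n.+1%:R < b * s) (n0 : (0 < n)%N) (q1 : 1 < q).
Local Notation Y := 'rV[R]_n.
Local Notation mu := (lebesgue_rV R n).
Local Notation adm := (@adm R n b).
Local Notation Lam := (@Lam R n b s q).
Local Notation Phi := (Phi q).

Lemma Phi_le (t u : R) : t <= u -> Phi u <= Phi t.
Proof.
rewrite le_eqVlt => /predU1P[->//|tu]; have [t1|t1] := ltP t 1.
  by apply: ltW; exact: Phi_lt.
by rewrite (Phi_eq0 q1 (le_trans t1 (ltW tu))) Phi_ge0.
Qed.

Section monotone.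
Variables (g G0 : Y -> R) (r : R).
Hypotheses (ag : adm g) (gmax : forall f, adm f -> Lam f <= Lam g).
Hypotheses (gE : forall y, g y = Phi (G0 y)) (gr : forall y, r < enorm y -> g y = 0).
Hypothesis G0_modulus : forall eps, 0 < eps -> exists2 del, 0 < del &
  forall y z, enorm (y - z) <= del -> G0 y <= G0 z + eps * (1 + enorm z) `^ b.
Implicit Types y z : Y.
Local Notation c := (center g).

(** Together with the next statement, the continuity of [G0] at [z]; below, this half is used at [d]
    and the other at [a]. *)
Let G0_usc z t : G0 z < t -> exists2 del, 0 < del &
  forall y, enorm (y - z) <= del -> G0 y < t.
Proof.
move=> zt; have K0 : 0 < (1 + enorm z) `^ b by rewrite powR_gt0// ltr_pwDl ?enorm_ge0.
have eps0 : 0 < (t - G0 z) / 2 / (1 + enorm z) `^ b by rewrite !divr_gt0// subr_gt0.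
have [del del0 H] := G0_modulus eps0; exists del => // y /H.
rewrite divfK ?gt_eqF// => /le_lt_trans; apply; move: zt; move: (G0 z) => G; lra.
Qed.

(** The modulus is now centred at the variable point [y]; [enorm (y - z) <= 1] replaces its weight
    by [(2 + enorm z) ^ b]. *)
Let G0_lsc z t : t < G0 z -> exists2 del, 0 < del &
  forall y, enorm (y - z) <= del -> t < G0 y.
Proof.
move=> zt; have K0 : 0 < (2 + enorm z) `^ b by rewrite powR_gt0// ltr_pwDl ?enorm_ge0.
have eps0 : 0 < (G0 z - t) / 2 / (2 + enorm z) `^ b by rewrite !divr_gt0// subr_gt0.
have [del del0 H] := G0_modulus eps0; exists (Order.min del 1) => [|y].
  by rewrite lt_min del0 ltr01.
rewrite le_min => /andP[ydel y1].
have := H z y; rewrite -[z - y]opprB enormN => /(_ ydel) zy.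
have yz : (1 + enorm y) `^ b <= (2 + enorm z) `^ b.
  apply: ge0_ler_powR; rewrite ?nnegrE ?addr_ge0 ?enorm_ge0 ?(ltW b0)//.
  have := ler_enormD (y - z) z; rewrite subrK => h.
  by move: h y1; move: (enorm y) (enorm (y - z)) (enorm z) => u v w; lra.
have := ler_wpM2l (ltW eps0) yz; rewrite divfK ?gt_eqF// => h.
have := le_trans zy (lerD (lexx (G0 y)) h); move: zt; move: (G0 z) (G0 y) => u v; lra.
Qed.

(* The reflection exchanging [a] and [d] leaves [c] on the side of [a]; there the first
   alternative of the polarization dichotomy contradicts the choice of [c]. *)
Lemma maximizer_lt_center a d : enorm (a - c) < enorm (d - c) -> g d <= g a.
Proof.
move=> acd; pose e := d - a; pose w := (2^-1 : R) *: (a + d).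
have e0 : e != 0.
  by apply: contraTneq acd => /eqP; rewrite subr_eq0 => /eqP ->; rewrite ltxx.
have ee0 := dot_gt0 e0.
have [gf g1] := ag; have [mg g0 Mg0 Mg _] := gf.
have sd : side w e d = dot e e / 2.
  by rewrite /side /e /w !dotE !(dotC d a); field.
have rd : refl w e d = a.
  by rewrite /refl sd mulrCA divff ?pnatr_eq0// mulr1 divff ?gt_eqF// scale1r /e subKr.
have sc : side w e c < 0.
  have : dot (a - c) (a - c) < dot (d - c) (d - c).
    by rewrite -!sqr_enorm ltr_pXn2r ?nnegrE ?enorm_ge0.
  rewrite /side /e /w !dotE !(dotC d a) !(dotC c a) !(dotC c d).
  move: (dot a a) (dot a d) (dot a c) (dot d d) (dot d c) (dot c c) => *; lra.
have [P|P] := polar_maximizer b0 s0 bs n0 w e0 ag gmax.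
  have : 0 <= side w e c.
    apply: (side_center_ge0 mg g0 Mg0 Mg gr e0); apply: filterS P => y + y0.
    by rewrite /polar y0 => <-; rewrite le_max lexx orbT.
  by rewrite leNgt sc.
(* Under the second alternative, [g y <= g (refl y)] for almost every [y] on the side of [d]. If
   [g a < g d], continuity of [G0] reverses this inequality strictly throughout a neighbourhood of
   [d], which has positive measure. *)
rewrite leNgt; apply/negP => gad.
have Gd1 : G0 d < 1.
  by rewrite ltNge; apply/negP => h; move: gad; rewrite (gE d) (Phi_eq0 q1 h) ltNge g0.
have Gda : G0 d < G0 a.
  by rewrite ltNge; apply/negP => /Phi_le h; move: gad; rewrite !gE ltNge h.
(* [Phi] decreases strictly only below 1, hence the cap on [G0 a]. *)
pose t := (G0 d + Order.min 1 (G0 a)) / 2.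
have dm : G0 d < Order.min 1 (G0 a) by rewrite lt_min Gd1.
have m1 : Order.min 1 (G0 a) <= 1 by rewrite ge_min lexx.
have ma : Order.min 1 (G0 a) <= G0 a by rewrite ge_min lexx orbT.
have dt : G0 d < t by rewrite /t; move: dm; move: (G0 d) (Order.min _ _) => *; lra.
have tm : t < Order.min 1 (G0 a) by rewrite /t; move: dm; move: (G0 d) (Order.min _ _) => *; lra.
have [d1 d10 H1] := G0_usc dt; have [d2 d20 H2] := G0_lsc (lt_le_trans tm ma).
(* The bound [enorm e / 2] is the distance from [d] to the hyperplane and keeps [y] on the side of
   [d]. *)
pose del := Order.min (Order.min d1 d2) (enorm e / 2).
have del0 : 0 < del by rewrite !lt_min d10 d20 divr_gt0 ?enorm_gt0.
have rho0 : 0 < del / n.+1%:R by rewrite divr_gt0.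
have [y yE yc] := ae_cube_exists d rho0 P.
have yd : enorm (y - d) <= del.
  exact: ltW (cube_enorm_lt del0 yc).
move: (yd); rewrite !le_min => /andP[/andP[yd1 yd2] yd3].
have ys : 0 <= side w e y.
  have -> : side w e y = dot e e / 2 - dot (d - y) e.
    by rewrite -sd /side !dotE; ring.
  have := dot_le_enorm (d - y) e; rewrite -[enorm (d - y)]enormN opprB.
  have := ler_wpM2r (enorm_ge0 e) yd3; rewrite -sqr_enorm expr2.
  move: (dot (d - y) e) (enorm e) (enorm (y - d)) => u v w' h1 h2.
  have -> : v * v / 2 = v / 2 * v by rewrite mulrAC.
  by rewrite subr_ge0 (le_trans h2).
have yr : enorm (refl w e y - a) <= d2 by rewrite -[X in _ - X]rd enorm_reflB.
move: yE; rewrite /polar ys => h.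
have : g y <= g (refl w e y) by rewrite -h le_max lexx.
rewrite !gE leNgt => /negP; apply; apply: (Phi_lt q1).
  by apply: lt_le_trans m1; apply: lt_trans tm; exact: H1.
by apply: lt_trans (H1 _ yd1) _; exact: H2.
Qed.

(** Moving [d] slightly away from [c] leads to the strict case, and the assumed inequality
    [g a < g d] survives by upper semicontinuity of [G0]. If [d = c] there is no direction to move
    in, but then [a = c] too. *)
Lemma maximizer_le_center a d : enorm (a - c) <= enorm (d - c) -> g d <= g a.
Proof.
move=> acd; rewrite leNgt; apply/negP => gad.
have [gf g1] := ag; have [mg g0 _ _ _] := gf.
have Gd1 : G0 d < 1.
  by rewrite ltNge; apply/negP => h; move: gad; rewrite (gE d) (Phi_eq0 q1 h) ltNge g0.
have Gda : G0 d < G0 a.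
  by rewrite ltNge; apply/negP => /Phi_le h; move: gad; rewrite !gE ltNge h.
have dm : G0 d < Order.min 1 (G0 a) by rewrite lt_min Gd1.
have dc0 : 0 < enorm (d - c).
  rewrite lt_neqAle enorm_ge0 andbT; apply/eqP => dc.
  have z0 u : enorm u = 0 -> u = 0.
    by move=> u0; apply/eqP; apply: contraPT u0 => /enorm_gt0 /gt_eqF /eqP.
  have dE : d = c by apply/eqP; rewrite -subr_eq0; apply/eqP; exact: z0.
  have aE : a = c.
    apply/eqP; rewrite -subr_eq0; apply/eqP; apply: z0; apply/le_anti.
    by rewrite enorm_ge0 andbT dc.
  by move: gad; rewrite dE aE ltxx.
have [del del0 H] := G0_usc dm.
pose eta := del / enorm (d - c); have eta0 : 0 < eta by rewrite divr_gt0.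
pose d' := d + eta *: (d - c).
have d'd : enorm (d' - d) <= del.
  by rewrite /d' addrAC subrr add0r enormZ gtr0_norm// divfK ?gt_eqF.
have d'c : enorm (d - c) < enorm (d' - c).
  rewrite /d' addrAC -{2}[d - c]scale1r -scalerDl enormZ gtr0_norm ?addr_gt0//.
  by rewrite mulrDl mul1r ltrDl mulr_gt0.
have := maximizer_lt_center (le_lt_trans acd d'c); rewrite leNgt => /negP; apply.
move: (H _ d'd); rewrite lt_min => /andP[h1 h2].
by rewrite !gE; exact: Phi_lt.
Qed.

End monotone.

Theorem radial_maximizer : (exists2 f, adm f & 0 < Lam f) -> exists g : Y -> R,
  [/\ adm g, forall f, adm f -> Lam f <= Lam g, 0 < Lam g,
      radially_nonincreasing (n := n.+1) g &
      exists2 r, 0 < r & forall y, r < enorm y -> g y = 0].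
Proof.
move=> Lp; have [g [G0 [ag gmax Lg gE [[r r0 gr] mod]]]] := maximizer_exists b0 s0 bs n0 q1 Lp.
have mono := maximizer_le_center ag gmax gE gr mod.
pose c := center g; have [gf g1] := ag.
exists (shift g c); split.
- exact: adm_shift.
- by move=> f /gmax; rewrite Lam_shift.
- by rewrite Lam_shift.
(* A unit vector, which exists because [0 < n]; the radial profile is read along its ray. *)
- pose u : Y := delta_mx ord0 (Ordinal n0).
  have uE t : enorm (t *: u) = `|t|.
    rewrite enormZ enormE /dot (bigD1 (Ordinal n0))//= big1 => [|i in0].
      by rewrite addr0 mxE !eqxx mulr1 sqrtr1 mulr1.
    by rewrite mxE (negPf in0) andbF mulr0.
  exists (fun t => shift g c (t *: u)).
    move=> t t' t0 tt'; apply: mono; rewrite !addrK !uE !ger0_norm//.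
    exact: le_trans tt'.
  move=> y; apply/le_anti/andP; split; apply: mono; rewrite !addrK uE ger0_norm ?enorm_ge0//.
- exists (r + enorm c) => [|y]; first by rewrite ltr_pwDl ?enorm_ge0.
  move=> yr; apply: gr; have := ler_enormD (y + c) (- c); rewrite addrK enormN.
  by move: yr; move: (enorm y) (enorm c) (enorm (y + c)) => *; lra.
Qed.

End radial.

(** * Scaling *)

Lemma fine_leD (R : realDomainType) (x y z t : \bar R) :
  x \is a fin_num -> y \is a fin_num -> z \is a fin_num -> t \is a fin_num ->
  (x + y <= z + t)%E -> fine x + fine y <= fine z + fine t.
Proof. by move: x y z t => [x| |]// [y| |]// [z| |]// [t| |]. Qed.

Lemma lerB_cross (R : realDomainType) (x y z t u v : R) :
  x + t <= z + y -> u <= v -> x - y - v <= z - t - u.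
Proof. by move=> *; lra. Qed.

Section scaling.
Context (R : realType) (n : nat) (b s q : R).
Hypotheses (b0 : 0 < b) (s0 : 0 < s) (bs : n.+1%:R < b * s) (n0 : (0 < n)%N) (q1 : 1 < q).
Local Notation Y := 'rV[R]_n.
Local Notation X := ('rV[R]_n * measurableTypeR R)%type.
Local Notation mu := (lebesgue_rV R n).
Local Notation nu := (lebesgue_rV R n \x @lebesgue_measure R)%E.
Local Notation D := (@upper R n).
Local Notation ker := (@ker R n b).
Local Notation ext := (@ext R n b).
Local Notation good := (@good R n b).
Local Notation energy := (@energy R n b s).
Local Notation nrm := (@nrm R n b s).
Local Notation adm := (@adm R n b).
Local Notation Lam := (@Lam R n b s q).
Local Notation powmass := (@powmass R n q).
Implicit Types (f g : Y -> R) (x : X) (y z : Y) (a l : R).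

(** Degree by which [nrm] exceeds the mass under dilation by [l]: the kernel contributes [l ^ b],
    and the volume of the half-space, raised to [- 1 / s], takes away [l ^ (n.+1 / s)]. *)
Definition kap : R := b - n.+1%:R / s.

Lemma kap_gt0 : 0 < kap.
Proof. by rewrite subr_gt0 ltr_pdivrMr. Qed.

Definition scale a l f y := a * f (l^-1 *: y).

Let measurable_contract l f : measurable_fun setT f ->
  measurable_fun setT (fun y => f (l^-1 *: y)).
Proof. by move=> mf; apply: measurableT_comp mf _; exact: measurable_rV_scalefun. Qed.

Lemma measurable_scale a l f : measurable_fun setT f -> measurable_fun setT (scale a l f).
Proof. by move=> mf; apply: measurable_funM => //; exact: measurable_contract. Qed.

Lemma mass_scale a l f : 0 <= a -> 0 < l -> measurable_fun setT f -> (forall y, 0 <= f y) ->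
  mass (scale a l f) = ((a * l ^+ n)%:E * mass f)%E.
Proof.
move=> a0 l0 mf f0.
have li0 : 0 < l^-1 by rewrite invr_gt0.
have mE : measurable_fun setT (fun y => (f y)%:E) by exact/measurable_EFinP.
have E0 y : (0 <= (f y)%:E)%E by rewrite lee_fin.
have mE' : measurable_fun setT (fun y => (f (l^-1 *: y))%:E).
  by apply/measurable_EFinP; exact: measurable_contract.
have H := integral_dilation li0 mE E0.
transitivity (a%:E * \int[mu]_y (f (l^-1 *: y))%:E)%E.
  by rewrite -(ge0_integralZl_EFin _ measurableT (fun y _ => E0 (l^-1 *: y)) mE' a0).
by rewrite H exprVn invrK muleA -EFinM.
Qed.

Lemma powmass_scale a l f : 0 <= a -> 0 < l -> measurable_fun setT f ->
  (forall y, 0 <= f y) ->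
  powmass (scale a l f) = ((a `^ q * l ^+ n)%:E * powmass f)%E.
Proof.
move=> a0 l0 mf f0.
have E : (fun y => scale a l f y `^ q) = scale (a `^ q) l (fun y => f y `^ q).
  by apply/funext => y; rewrite /scale powRM.
rewrite /powmass E mass_scale ?powR_ge0//; first exact: measurable_fun_powRl.
by move=> y; exact: powR_ge0.
Qed.

Let dist_scale l x y : 0 < l -> dist x y = l * dist (l^-1 *: x.1, l^-1 * x.2) (l^-1 *: y).
Proof.
move=> l0; rewrite /dist /=.
have -> : enorm (l^-1 *: x.1 - l^-1 *: y) = l^-1 * enorm (x.1 - y).
  by rewrite -scalerBr enormZ gtr0_norm// invr_gt0.
rewrite !exprMn -mulrDr sqrtrM ?sqr_ge0// sqrtr_sqr gtr0_norm ?invr_gt0//.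
by rewrite mulrA divff ?mul1r// gt_eqF.
Qed.

Lemma ext_scale a l f x : 0 <= a -> 0 < l -> measurable_fun setT f -> (forall y, 0 <= f y) ->
  ext (scale a l f) x = ((a * l `^ b * l ^+ n)%:E * ext f (l^-1 *: x.1, (l^-1 * x.2)%R))%E.
Proof.
move=> a0 l0 mf f0; set x' := (_, _).
have m1 : measurable_fun setT (fun y => ker x' y * f y).
  by apply/measurable_EFinP; exact: (measurable_kerM1 b x' mf).
have p1 y : 0 <= ker x' y * f y by rewrite mulr_ge0 ?ker_ge0.
have al0 : 0 <= a * l `^ b by rewrite mulr_ge0 ?powR_ge0.
have := mass_scale al0 l0 m1 p1; rewrite /mass => <-.
apply: eq_integral => y _; congr EFin; rewrite /scale /ker (dist_scale x y l0).
by rewrite powRM ?(ltW l0) ?dist_ge0//; ring.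
Qed.

Lemma good_scale a l f : 0 < a -> 0 < l -> good f -> good (scale a l f).
Proof.
move=> a0 l0 [mf f0 M0 Moo Eoo].
have al0 : 0 < a * l ^+ n by rewrite mulr_gt0 ?exprn_gt0.
split.
- exact: measurable_scale.
- by move=> y; rewrite mulr_ge0 ?(ltW a0).
- by rewrite mass_scale ?(ltW a0)//; apply: mule_gt0.
- by rewrite mass_scale ?(ltW a0)//; apply: lte_mul_pinfty; rewrite ?lee_fin ?(ltW al0).
- move=> x; rewrite ext_scale ?(ltW a0)//; apply: lte_mul_pinfty => //.
  by rewrite lee_fin !mulr_ge0 ?powR_ge0 ?exprn_ge0 ?(ltW a0) ?(ltW l0).
Qed.

Lemma energy_scale a l f : 0 < a -> 0 < l -> good f ->
  energy (scale a l f) = (((a * l `^ b * l ^+ n) `^ (- s) * l ^+ n.+1)%:E * energy f)%E.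
Proof.
move=> a0 l0 gf; have [mf f0 _ _ _] := gf.
have li0 : 0 < l^-1 by rewrite invr_gt0.
pose F x := (fine (ext f x) `^ (- s))%:E.
have mF : measurable_fun setT F.
  apply/measurable_EFinP; apply: measurable_fun_powRl; apply: measurableT_comp => //.
  exact: measurable_ext.
have F0 x : (0 <= F x)%E by rewrite lee_fin powR_ge0.
have H := upper_dilation li0 mF F0.
set A := a * l `^ b * l ^+ n; have A0 : 0 < A by rewrite !mulr_gt0 ?powR_gt0 ?exprn_gt0.
have As0 : 0 <= A `^ (- s) by exact: powR_ge0.
have E x : (fine (ext (scale a l f) x) `^ (- s))%:E =
    ((A `^ (- s))%:E * F (l^-1 *: x.1, (l^-1 * x.2)%R))%E.
  rewrite /F ext_scale ?(ltW a0)// -/A fineM//; last first.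
    by rewrite ge0_fin_numE ?ext_ge0//; case: gf => _ _ _ _; exact.
  by rewrite powRM ?(ltW A0)// ?EFinM// fine_ge0// ext_ge0.
transitivity ((A `^ (- s))%:E * \int[nu]_(x in D) F (l^-1 *: x.1, (l^-1 * x.2)%R))%E.
  rewrite -(ge0_integralZl_EFin _ (@measurable_upper R n) (fun x _ => F0 (l^-1 *: x.1, (l^-1 * x.2)%R)) _ As0).
    by apply: eq_integral => x _; exact: E.
  apply: measurable_funTS; apply: (measurableT_comp mF).
  apply/measurable_fun_pairP; split => /=.
    exact: (@measurable_rV_scalefun R n _ X (fun=> l^-1) fst _ measurable_fst).
  by apply: (measurable_funM _ measurable_snd).
by rewrite H exprVn invrK muleA -EFinM.
Qed.

Lemma nrm_scale a l f : 0 < a -> 0 < l -> good f ->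
  nrm (scale a l f) = a * l ^+ n * l `^ kap * nrm f.
Proof.
move=> a0 l0 gf; have s0' : s != 0 by rewrite gt_eqF.
set A := a * l `^ b * l ^+ n; have A0 : 0 < A by rewrite !mulr_gt0 ?powR_gt0 ?exprn_gt0.
rewrite /nrm (energy_scale a0 l0 gf) -/A fineM//; last first.
  by rewrite -(energyK b0 s0 bs n0 gf).
have e0 := fine_energy_gt0 b0 s0 bs n0 gf.
rewrite /= powRM ?mulr_ge0 ?powR_ge0 ?exprn_ge0 ?(ltW l0) ?(ltW e0)//; congr (_ * _).
rewrite powRM ?powR_ge0 ?exprn_ge0 ?(ltW l0)// -powRrM mulrNN divff// powRr1 ?(ltW A0)//.
rewrite -powR_mulrn ?(ltW l0)// -powRrM /A -!mulrA; congr (_ * _).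
rewrite mulrA (mulrC (l `^ b)) -mulrA; congr (_ * _).
by rewrite -powRD ?(gt_eqF l0) ?implybT// /kap mulrN.
Qed.

Lemma powmass_gt0 f : good f -> (0 < powmass f)%E.
Proof.
move=> [mf f0 M0 _ _]; rewrite lt_neqAle powmass_ge0// andbT eq_sym.
apply: contraTneq M0 => Q0; rewrite -leNgt.
have mq : measurable_fun setT (fun y => (f y `^ q)%:E).
  by apply/measurable_EFinP; exact: measurable_fun_powRl.
have q0 y : [set: Y] y -> (0 <= (f y `^ q)%:E)%E by rewrite lee_fin powR_ge0.
have := integral_eq0_ae measurableT mq q0 Q0.
move=> H; have fae : {ae mu, forall y, [set: Y] y -> (f y)%:E = cst 0%E y}.
  apply: filterS H => y /(_ I) [] /powR_eq0_eq0 -> //.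
rewrite /mass (nn_ae_eq_integral measurableT _ _ fae) ?integral0//.
by move=> y _; rewrite lee_fin.
Qed.

(** Where [f >= 1], [f - f ^ q <= 0], which is the value of [a - a ^ q] at [a = 1]; and [nrm] is
    monotone in [f]. *)
Lemma Lam_le_minr1 f : good f -> (powmass f < +oo)%E ->
  Lam f <= Lam (fun y => Order.min (f y) 1).
Proof.
move=> gf Qf; have [mf f0 M0 Moo Eoo] := gf.
set h := fun y => _; have gh : good h by exact: good_minr1.
have [mh h0 _ Mhoo _] := gh.
have hf y : h y <= f y by rewrite ge_min lexx.
have ah : adm h by split=> // y; rewrite ge_min lexx orbT.
have Qfin : powmass f \is a fin_num by rewrite ge0_fin_numE// powmass_ge0.
have Qhfin := powmass_fin_num q1 ah.
have N : nrm h <= nrm f.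
  have Eh : (energy f <= energy h)%E.
    apply: nn_le_integral => x Dx; first by rewrite lee_fin powR_ge0.
    rewrite lee_fin; apply: (ler_powRN (ltW s0) (fine_ext_gt0 Dx gh)).
    by rewrite -lee_fin (extK _ gh) (extK _ gf); exact: le_ext.
  have := Eh; rewrite -(energyK b0 s0 bs n0 gf) -(energyK b0 s0 bs n0 gh) lee_fin.
  have si : 0 <= s^-1 by rewrite invr_ge0 ltW.
  exact: (ler_powRN si (fine_energy_gt0 b0 s0 bs n0 gf)).
have E : fine (mass f) + fine (powmass h) <= fine (mass h) + fine (powmass f).
  have massfin k : good k -> mass k \is a fin_num.
    by move=> gk; have [_ k0 _ Mk _] := gk; rewrite ge0_fin_numE// mass_ge0.
  apply: (fine_leD (massfin _ gf) Qhfin (massfin _ gh) Qfin).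
  have mfE : measurable_fun setT (fun y => (f y)%:E) by exact/measurable_EFinP.
  have mhE : measurable_fun setT (fun y => (h y)%:E) by exact/measurable_EFinP.
  have mfq : measurable_fun setT (fun y => (f y `^ q)%:E).
    by apply/measurable_EFinP; exact: measurable_fun_powRl.
  have mhq : measurable_fun setT (fun y => (h y `^ q)%:E).
    by apply/measurable_EFinP; exact: measurable_fun_powRl.
  have pq k y : [set: Y] y -> (0 <= (k y `^ q : R)%:E)%E by rewrite lee_fin powR_ge0.
  have p0 (k : Y -> R) : (forall y, 0 <= k y) -> forall y, [set: Y] y -> (0 <= (k y)%:E)%E.
    by move=> k0 y _; rewrite lee_fin.
  rewrite /powmass /mass.
  rewrite -(ge0_integralD _ measurableT (p0 _ f0) mfE (pq h) mhq).
  rewrite -(ge0_integralD _ measurableT (p0 _ h0) mhE (pq f) mfq).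
  apply: nn_le_integral => y _; first by rewrite -EFinD lee_fin addr_ge0 ?powR_ge0.
  rewrite -!EFinD lee_fin /h; have [f1|f1] := ltP (f y) 1; first by [].
  rewrite powR1 addrC lerD2l.
  by rewrite -{1}[f y]powRr1// ler_powR// ltW.
exact: lerB_cross E N.
Qed.

End scaling.

Ltac positivity_of V W P := repeat first [assumption | apply P | apply W | apply V].

(** In logarithms both inequalities are linear, and the conclusion is the hypothesis multiplied by
    [kap / p]. Here [p] is the dimension of the boundary, and the two powers in the hypothesis are
    the amplitude and the dilation that normalize [f]. *)
Lemma scaling_normalization (R : realType) (kap q p M Q N M0 Q0 N0 : R) :
  0 < kap -> 1 < q -> 0 < p -> 0 < M -> 0 < Q -> 0 < N -> 0 < M0 -> 0 < Q0 -> 0 < N0 ->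
  (Q0 / M0 * (M / Q)) `^ (q - 1)^-1 * ((N0 / M0 * (M / N)) `^ kap^-1) `^ p * M <= M0 ->
  N0 * Q0 `^ (kap / (p * (q - 1))) * M `^ (1 + kap * q / (p * (q - 1))) <=
  N * Q `^ (kap / (p * (q - 1))) * M0 `^ (1 + kap * q / (p * (q - 1))).
Proof.
move=> kap0 q1 p0 HM HQ HN HM0 HQ0 HN0.
have V (x : R) : 0 < x -> 0 < x^-1 by rewrite invr_gt0.
have P (x y : R) : 0 < x -> 0 < y -> 0 < x * y by exact: mulr_gt0.
have W (x y : R) : 0 < x -> 0 < x `^ y by exact: powR_gt0.
have LM (x y : R) : 0 < x -> 0 < y -> ln (x * y) = ln x + ln y.
  by move=> x0 y0; rewrite lnM ?posrE.
have LD (x y : R) : 0 < x -> 0 < y -> ln (x / y) = ln x - ln y.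
  by move=> x0 y0; rewrite ln_div ?posrE.
rewrite -ler_ln ?posrE; try by positivity_of V W P.
rewrite !(LD, LM, ln_powR); try by positivity_of V W P.
move=> H; rewrite -ler_ln ?posrE; try by positivity_of V W P.
rewrite !(LD, LM, ln_powR); try by positivity_of V W P.
move: H; move: (ln M) (ln Q) (ln N) (ln M0) (ln Q0) (ln N0) => m u v m0 u0 v0.
rewrite -subr_ge0 => H; have kp : 0 < kap / p by rewrite divr_gt0.
rewrite -subr_ge0; apply: le_trans (mulr_ge0 (ltW kp) H) _; rewrite le_eqVlt; apply/orP; left.
apply/eqP.
by field; rewrite !gt_eqF// subr_gt0.
Qed.

(** After normalization the ratios of [powmass] and [nrm] to the mass are those of the maximizer.
    [Lam] is then the same positive multiple of the mass on both sides, and comparing [Lam] compares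
    the masses. *)
Lemma le_of_normalized (R : realFieldType) (A M Q N M0 Q0 N0 : R) :
  0 < M -> 0 < Q -> 0 < N -> 0 < M0 -> 0 < M0 - Q0 - N0 ->
  A * (M - Q0 / M0 * (M / Q) * Q - N0 / M0 * (M / N) * N) <= M0 - Q0 - N0 ->
  A * M <= M0.
Proof.
move=> HM HQ HN HM0 L0.
have -> : M - Q0 / M0 * (M / Q) * Q - N0 / M0 * (M / N) * N = M * (M0 - Q0 - N0) / M0.
  by field; rewrite !gt_eqF.
by rewrite mulrA ler_pdivrMr// mulrA [leRHS]mulrC ler_pM2r.
Qed.

(** * From the maximizer to the scale-invariant inequality *)

Section extremal.
Context (R : realType) (n : nat) (b s q : R).
Hypotheses (b0 : 0 < b) (s0 : 0 < s) (bs : n.+1%:R < b * s) (n0 : (0 < n)%N) (q1 : 1 < q).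
Local Notation Y := 'rV[R]_n.
Local Notation good := (@good R n b).
Local Notation nrm := (@nrm R n b s).
Local Notation adm := (@adm R n b).
Local Notation Lam := (@Lam R n b s q).
Local Notation powmass := (@powmass R n q).
Local Notation kap := (@kap R n b s).
Implicit Types (f g : Y -> R) (a l : R).

Let fine_scale k (x : \bar R) : fine (k%:E * x) = k * fine x \/ x \isn't a fin_num.
Proof. by case: x => [x| |]; [left|right|right]. Qed.

Lemma Lam_scale a l f : 0 < a -> 0 < l -> good f -> (powmass f < +oo)%E ->
  Lam (scale a l f) = a * l ^+ n *
    (fine (mass f) - a `^ (q - 1) * fine (powmass f) - l `^ kap * nrm f).
Proof.
move=> a0 l0 gf Qf; have [mf f0 _ Mf _] := gf.
have EM : fine (mass (scale a l f)) = a * l ^+ n * fine (mass f).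
  have fin : mass f \is a fin_num by rewrite ge0_fin_numE// mass_ge0.
  by rewrite mass_scale ?(ltW a0)//; case: (fine_scale (a * l ^+ n) (mass f)) => //; rewrite fin.
have EQ : fine (powmass (scale a l f)) = a * l ^+ n * (a `^ (q - 1) * fine (powmass f)).
  have fin : powmass f \is a fin_num by rewrite ge0_fin_numE// powmass_ge0.
  rewrite powmass_scale ?(ltW a0)//.
  case: (fine_scale (a `^ q * l ^+ n) (powmass f)) => [->|]; last by rewrite fin.
  have -> : a `^ q = a * a `^ (q - 1) by rewrite mulr_powRB1 ?(ltW a0)//; move: q1; lra.
  by move: (a `^ _) (l ^+ n) (fine _) => u v w; ring.
rewrite /Lam EM EQ (nrm_scale b0 s0 bs n0 a0 l0 gf).
by move: (fine _) (fine _) (nrm f) (a `^ _) (l `^ _) (l ^+ n) => u v w x y z; ring.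
Qed.

(** For the indicator of a cube mass and [powmass] coincide, so amplitude [1 / 2] leaves the
    positive difference [M (1 - c)]. Since [kap > 0], [l] can be chosen so that the norm term uses
    only half of it. *)
Lemma Lam_pos : exists2 f, adm f & 0 < Lam f.
Proof.
pose h : Y -> R := \1_(@cube R n 1).
have h01 y : 0 <= h y <= 1 by rewrite /h indicE; case: (_ \in _); rewrite ?ler01 ?lexx.
have mh : measurable_fun setT h by apply: measurable_indic; exact: measurable_cube.
have Mh : mass h = ((2 * 1) ^+ n)%:E.
  rewrite /mass integral_indic// ?setIT; last exact: measurable_cube.
  exact: (@lebesgue_cube R n 1 ler01).
have gh : good h.
  apply: (@good_bounded R n b b0 h n%:R) => // [y yn|]; last first.
    by rewrite Mh lte_fin exprn_gt0// mulr1.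
  rewrite /h indicE memNset// => /(cube_enorm ler01); rewrite mulr1 leNgt yn; exact.
have Qh : powmass h = mass h.
  congr mass; apply/funext => y; rewrite /h indicE; case: (_ \in _); first by rewrite powR1.
  by rewrite powR0// gt_eqF//; move: q1; lra.
have Qoo : (powmass h < +oo)%E by rewrite Qh; case: gh.
pose M := fine (mass h); pose N := nrm h; pose a : R := 2^-1; pose c := a `^ (q - 1).
have M0 : 0 < M by exact: fine_mass_gt0 gh.
have N0 : 0 < N by exact: (nrm_gt0 b0 s0 bs n0 gh).
have a0 : 0 < a by rewrite /a; lra.
have c1 : c < 1.
  have -> : 1 = 1 `^ (q - 1) :> R by rewrite powR1.
  by apply: gt0_ltr_powR; rewrite ?nnegrE ?ler01 ?(ltW a0)// /a; move: q1; lra.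
have B0 : 0 < M * (1 - c) / (2 * N) by rewrite divr_gt0 ?mulr_gt0 ?subr_gt0.
pose l := (M * (1 - c) / (2 * N)) `^ kap^-1.
have l0 : 0 < l by exact: powR_gt0.
have k0 := kap_gt0 s0 bs.
have lk : l `^ kap = M * (1 - c) / (2 * N).
  by rewrite /l -powRrM mulVf ?powRr1 ?gt_eqF// ltW.
exists (scale a l h).
  split; first exact: good_scale.
  move=> y; have /andP[h0 h1] := h01 (l^-1 *: y).
  by rewrite /scale mulr_ile1// ?(ltW a0)// /a; lra.
rewrite (Lam_scale a0 l0 gh Qoo) Qh -/M -/N -/c lk; apply: mulr_gt0.
  by rewrite mulr_gt0// exprn_gt0.
have -> : M - c * M - M * (1 - c) / (2 * N) * N = M * (1 - c) / 2.
  by field; rewrite gt_eqF.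
by rewrite divr_gt0// mulr_gt0// subr_gt0.
Qed.

Theorem extremal_exists : exists f0 : Y -> R,
  [/\ adm f0, radially_nonincreasing (n := n.+1) f0,
      exists2 r, 0 < r & forall y, r < enorm y -> f0 y = 0 &
      forall f, good f -> (powmass f < +oo)%E ->
        nrm f0 * fine (powmass f0) `^ (kap / (n%:R * (q - 1))) *
          fine (mass f) `^ (1 + kap * q / (n%:R * (q - 1))) <=
        nrm f * fine (powmass f) `^ (kap / (n%:R * (q - 1))) *
          fine (mass f0) `^ (1 + kap * q / (n%:R * (q - 1)))].
Proof.
have [f0 [af0 max0 L0 rad0 sup0]] := radial_maximizer b0 s0 bs n0 q1 Lam_pos.
exists f0; split; [exact: af0|exact: rad0|exact: sup0|move=> f gf Qoo].
have [gf0 _] := af0; have Qoo0 := powmass_fin_num q1 af0.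
have HM := fine_mass_gt0 gf; have HM0 := fine_mass_gt0 gf0.
have HN := nrm_gt0 b0 s0 bs n0 gf; have HN0 := nrm_gt0 b0 s0 bs n0 gf0.
have HQ : 0 < fine (powmass f) by rewrite fine_gt0// (powmass_gt0 q gf).
have HQ0 : 0 < fine (powmass f0).
  by rewrite fine_gt0// (powmass_gt0 q gf0) -ge0_fin_numE// powmass_ge0.
have k0 := kap_gt0 s0 bs.
apply: scaling_normalization => //; first by rewrite ltr0n.
(* With these parameters the ratios [powmass / mass] and [nrm / mass] of the scaled [f] match those
   of [f0]. *)
set a := _ `^ _; set l := _ `^ kap^-1.
have VA (x y : R) : 0 < x -> 0 < y -> 0 < x / y by move=> *; rewrite divr_gt0.
have A0 : 0 < fine (powmass f0) / fine (mass f0) * (fine (mass f) / fine (powmass f)).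
  by apply: mulr_gt0; exact: VA.
have B0 : 0 < nrm f0 / fine (mass f0) * (fine (mass f) / nrm f).
  by apply: mulr_gt0; exact: VA.
have a0 : 0 < a by exact: powR_gt0.
have l0 : 0 < l by exact: powR_gt0.
have aq : a `^ (q - 1) = fine (powmass f0) / fine (mass f0) * (fine (mass f) / fine (powmass f)).
  by rewrite /a -powRrM mulVf ?powRr1 ?(ltW A0)// gt_eqF// subr_gt0.
have lk : l `^ kap = nrm f0 / fine (mass f0) * (fine (mass f) / nrm f).
  by rewrite /l -powRrM mulVf ?powRr1 ?(ltW B0)// gt_eqF.
rewrite powR_mulrn ?(ltW l0)//.
have gs := good_scale a0 l0 gf.
have Qs : (powmass (scale a l f) < +oo)%E.
  have [mf f0' _ _ _] := gf; rewrite powmass_scale ?(ltW a0)//; apply: lte_mul_pinfty => //.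
  by rewrite lee_fin mulr_ge0 ?powR_ge0// exprn_ge0// ltW.
have ah : adm (fun y => Order.min (scale a l f y) 1).
  by split=> [|y]; [exact: good_minr1|rewrite ge_min lexx orbT].
have := le_trans (Lam_le_minr1 b0 s0 bs n0 q1 gs Qs) (max0 _ ah).
rewrite (Lam_scale a0 l0 gf Qoo) aq lk.
exact: (le_of_normalized HM HQ HN HM0 L0).
Qed.

End extremal.

(** * The sharp inequality *)

Section interface.
Context (R : realType) (k : nat) (alpha q t' : R).
Local Notation Y := 'rV[R]_k.
Local Notation X := ('rV[R]_k * measurableTypeR R)%type.
Local Notation b := (alpha - k.+1%:R).
Local Notation s := (- t').
Hypotheses (b0 : 0 < b) (s0 : 0 < s) (bs : k.+1%:R < b * s) (k0 : (0 < k)%N) (q1 : 1 < q).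
Local Notation mu := (lebesgue_rV R k).
Local Notation good := (@good R k b).
Local Notation nrm := (@nrm R k b s).
Local Notation powmass := (@powmass R k q).
Local Notation kap := (@kap R k b s).
Local Notation ext := (@ext R k b).
Local Notation gam := (gammat k.+1 alpha q t').
Implicit Types (f g : Y -> R) (x : X) (y : Y).

Let q0 : 0 < q. Proof. by move: q1; lra. Qed.

Let kR0 : 0 < k%:R :> R. Proof. by rewrite ltr0n. Qed.

Let t'0 : t' < 0. Proof. by rewrite -oppr_gt0. Qed.

(** Exhibits the exponents dictated by the scaling, and makes [gam > 1] visible. *)
Lemma gammatE : gam = 1 + kap * q / (k%:R * (q - 1)).
Proof.
rewrite /gammat /kap -natr1; field.
by rewrite (lt_eqF t'0) (gt_eqF kR0) subr_eq0 (gt_eqF q1) subr_eq0 (lt_eqF q1).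
Qed.

Lemma gammat_gt1 : 1 < gam.
Proof.
have kap0 := kap_gt0 s0 bs.
by rewrite gammatE ltrDl divr_gt0// mulr_gt0// subr_gt0.
Qed.

Lemma norm_half_space_good g : good g ->
  norm_half_space (n := k.+1) t' (ext g) = (nrm g)%:E.
Proof.
move=> gg; have mgg := gg; rewrite /norm_half_space /Lpnorm.
have -> : (\int[@lebesgue_Rn R k.+1]_(x in @half_space R k.+1) epow `|ext g x| t' =
    energy b s g)%E.
  apply: eq_integral => x /set_mem Dx; rewrite -(extK x gg) /= /epow leNgt t'0 /=.
  have e0 := fine_ext_gt0 Dx gg.
  by rewrite gtr0_norm// inver gt_eqF ?powR_gt0// -powRN opprK.
rewrite /epow invr_ge0 leNgt t'0 /= -(energyK b0 s0 bs k0 gg).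
have e0 := fine_energy_gt0 b0 s0 bs k0 gg.
rewrite poweR_EFin inver gt_eqF ?powR_gt0// /nrm -powRN; congr (_ `^ _)%:E.
by rewrite opprK invrN opprK.
Qed.

Lemma norm_boundary_mass p g : 0 < p -> (forall y, 0 <= g y) ->
  norm_boundary (n := k.+1) p g = (mass (fun y => (g y `^ p)%R) `^ p^-1)%E.
Proof.
move=> p0 g0; rewrite /norm_boundary /Lpnorm.
have -> : (\int[mu]_(y in setT) epow `|(EFin \o g) y| p = mass (fun y => (g y `^ p)%R))%E.
  by apply: eq_integral => y _; rewrite /epow (ltW p0) /= ger0_norm.
by rewrite /epow invr_ge0 (ltW p0).
Qed.

Lemma rhsE C g : good g -> rhs (n := k.+1) alpha q t' C g = (C * fine (mass g) `^ gam)%:E.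
Proof.
move=> gg; have [mg g0 _ _ _] := gg.
rewrite /rhs norm_boundary_mass ?ltr01//.
have -> : (fun y => (g y `^ 1)%R) = g by apply/funext => y; rewrite powRr1.
rewrite invr1 poweRe1 ?mass_ge0// -(massK gg) /epow.
by rewrite (le_trans ler01 (ltW gammat_gt1)) poweR_EFin.
Qed.

Lemma norm_boundary_powmass g : (forall y, 0 <= g y) -> (powmass g < +oo)%E ->
  epow (norm_boundary (n := k.+1) q g) (gam - 1) =
  (fine (powmass g) `^ (kap / (k%:R * (q - 1))))%:E.
Proof.
move=> g0 Qg; rewrite norm_boundary_mass//.
have -> : mass (fun y => (g y `^ q)%R) = powmass g by [].
have Qfin : powmass g \is a fin_num by rewrite ge0_fin_numE// powmass_ge0.
rewrite -(fineK Qfin) poweR_EFin /epow subr_ge0 (ltW gammat_gt1) poweR_EFin /= -powRrM.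
congr (_ `^ _)%:E; rewrite gammatE addrC addKr; field.
by rewrite !gt_eqF// subr_gt0.
Qed.

Lemma lhsE g : good g -> (powmass g < +oo)%E ->
  lhs (n := k.+1) alpha q t' g = (nrm g * fine (powmass g) `^ (kap / (k%:R * (q - 1))))%:E.
Proof.
move=> gg Qg; have [_ g0 _ _ _] := gg.
by rewrite /lhs norm_boundary_powmass// EFinM; congr (_ * _)%E; exact: norm_half_space_good.
Qed.

Lemma borel_representative f : completion_measurable_fun mu setT (EFin \o f) ->
  (forall y, 0 <= f y) ->
  exists g, [/\ measurable_fun setT g, forall y, 0 <= g y & {ae mu, forall y, f y = g y}].
Proof.
move=> [h mh fh] f0; exists (fun y => Order.max (fine (h y)) 0); split.
- by apply: measurable_maxr => //; exact: measurableT_comp.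
- by move=> y; rewrite le_max lexx orbT.
- by apply: filterS fh => y /(_ I) /= <- /=; rewrite max_l.
Qed.

Lemma mass_ae_eq f g : (forall y, 0 <= f y) -> (forall y, 0 <= g y) ->
  {ae mu, forall y, f y = g y} -> mass f = mass g.
Proof.
move=> f0 g0 fg; apply: nn_ae_eq_integral => //; [by move=> y _; rewrite lee_fin..|].
by apply: filterS fg => y ->.
Qed.

Lemma ext_ae_eq f g x : (forall y, 0 <= f y) -> (forall y, 0 <= g y) ->
  {ae mu, forall y, f y = g y} -> ext f x = ext g x.
Proof.
move=> f0 g0 fg; apply: mass_ae_eq; [by move=> y; rewrite mulr_ge0 ?ker_ge0..|].
by apply: filterS fg => y ->.
Qed.

Lemma mass_powR_ae_eq p f g : (forall y, 0 <= f y) -> (forall y, 0 <= g y) ->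
  {ae mu, forall y, f y = g y} ->
  mass (fun y => f y `^ p) = mass (fun y => g y `^ p).
Proof.
move=> f0 g0 fg; apply: mass_ae_eq; [by move=> y; exact: powR_ge0..|].
by apply: filterS fg => y ->.
Qed.

Lemma lhs_ae_eq f g : (forall y, 0 <= f y) -> (forall y, 0 <= g y) ->
  {ae mu, forall y, f y = g y} ->
  lhs (n := k.+1) alpha q t' f = lhs (n := k.+1) alpha q t' g.
Proof.
move=> f0 g0 fg; rewrite /lhs (norm_boundary_mass q0 f0) (norm_boundary_mass q0 g0).
have -> : extension (n := k.+1) alpha f = extension (n := k.+1) alpha g.
  by apply/funext => x; exact: ext_ae_eq.
by rewrite (mass_powR_ae_eq _ f0 g0 fg).
Qed.

Lemma rhs_ae_eq C f g : (forall y, 0 <= f y) -> (forall y, 0 <= g y) ->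
  {ae mu, forall y, f y = g y} ->
  rhs (n := k.+1) alpha q t' C f = rhs (n := k.+1) alpha q t' C g.
Proof.
move=> f0 g0 fg; rewrite /rhs (norm_boundary_mass ltr01 f0) (norm_boundary_mass ltr01 g0).
by rewrite (mass_powR_ae_eq _ f0 g0 fg).
Qed.

Lemma powmass_inLp f : (forall y, 0 <= f y) ->
  inLp mu setT q (EFin \o f) -> (powmass f < +oo)%E.
Proof.
move=> f0 [_]; have -> // : (\int[mu]_(y in setT) epow `|(EFin \o f) y| q = powmass f)%E.
by apply: eq_integral => y _; rewrite /epow (ltW q0) /= ger0_norm.
Qed.

Lemma mass_inLp f : (forall y, 0 <= f y) -> inLp mu setT 1 (EFin \o f) -> (mass f < +oo)%E.
Proof.
move=> f0 [_]; have -> // : (\int[mu]_(y in setT) epow `|(EFin \o f) y| 1 = mass f)%E.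
by apply: eq_integral => y _; rewrite /epow ler01 /= ger0_norm// powRr1.
Qed.

Lemma admissible_good f : good f -> (powmass f < +oo)%E -> admissible (n := k.+1) q f.
Proof.
move=> [mf f0 M0 Moo _] Qoo.
have cm : completion_measurable_fun mu setT (EFin \o f).
  by exists (EFin \o f); [exact/measurable_EFinP|exact: aeW].
split => //.
- split=> //; have -> // : (\int[mu]_(y in setT) epow `|(EFin \o f) y| 1 = mass f)%E.
  by apply: eq_integral => y _; rewrite /epow ler01 /= ger0_norm// powRr1.
- split=> //; have -> // : (\int[mu]_(y in setT) epow `|(EFin \o f) y| q = powmass f)%E.
  by apply: eq_integral => y _; rewrite /epow (ltW q0) /= ger0_norm.
- move=> f00; have := @mass_ae_eq f (fun=> 0) f0 (fun=> lexx _) f00.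
  by rewrite /(mass (fun=> 0)) integral0 => E; rewrite E ltxx in M0.
Qed.

(** After passing to a Borel representative, the remaining case is an extension that is infinite
    everywhere. Its power [t' < 0] is then 0, so the integral vanishes, and the power [1 / t'] of 0
    is [+oo]; as [powmass] is positive, the left-hand side is infinite. *)
Lemma valid_of_good C :
  (forall g, good g -> (powmass g < +oo)%E -> 
    (rhs (n := k.+1) alpha q t' C g <= lhs (n := k.+1) alpha q t' g)%E) ->
  valid_constant k.+1 alpha q t' C.
Proof.
move=> H f [f0 f1 fq fn0].
have [g [mg g0 fg]] := borel_representative f1.1 f0.
rewrite (rhs_ae_eq _ f0 g0 fg) (lhs_ae_eq f0 g0 fg).
have Mg : (mass g < +oo)%E by have := mass_inLp f0 f1; rewrite (mass_ae_eq f0 g0 fg).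
have Qg : (powmass g < +oo)%E.
  by have := powmass_inLp f0 fq; rewrite /powmass (mass_powR_ae_eq q f0 g0 fg).
have M0 : (0 < mass g)%E.
  rewrite lt_neqAle mass_ge0// andbT eq_sym; apply/negP => /eqP Mg0; apply: fn0.
  have mE : measurable_fun setT (fun y => (g y)%:E) by exact/measurable_EFinP.
  have E0 y : [set: Y] y -> (0 <= (g y)%:E)%E by rewrite lee_fin.
  have := integral_eq0_ae measurableT mE E0 Mg0.
  by apply: filterS2 fg => y -> /(_ I) [].
have [[x0 x0oo]|noo] := pselect (exists x0, (ext g x0 < +oo)%E).
  exact: (H g (And5 mg g0 M0 Mg (fun x => ext_lty b0 x mg g0 Mg x0oo)) Qg).
have extoo x : ext g x = +oo%E.
  by apply/eqP; rewrite -leye_eq leNgt; apply/negP => h; apply: noo; exists x.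
have -> : lhs (n := k.+1) alpha q t' g = +oo%E; last exact: leey.
rewrite /lhs (norm_boundary_powmass g0 Qg).
have -> : norm_half_space (n := k.+1) t' (extension (n := k.+1) alpha g) = +oo%E.
  rewrite /norm_half_space /Lpnorm.
  rewrite (_ : integral _ _ _ = 0%E); last first.
    apply: integral0_eq => x _; have -> : extension (n := k.+1) alpha g x = +oo%E := extoo x.
    rewrite gee0_abs ?leey// /epow lt_geF//.
    by rewrite poweRyr ?invey// oppr_eq0 lt_eqF.
  rewrite /epow invr_ge0 lt_geF// poweR0r ?inve0//.
  by rewrite oppr_eq0 invr_eq0 lt_eqF.
rewrite gt0_mulye// lte_fin powR_gt0// fine_gt0// Qg andbT.
have q0' y : [set: Y] y -> (0 <= (g y `^ q)%:E)%E by rewrite lee_fin powR_ge0.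
rewrite lt_neqAle powmass_ge0 andbT eq_sym; apply/negP => /eqP Q0.
have mq : measurable_fun setT (fun y => (g y `^ q)%:E).
  by apply/measurable_EFinP; exact: measurable_fun_powRl.
have H0 := integral_eq0_ae measurableT mq q0' Q0.
have g00 : {ae mu, forall y, g y = 0}.
  by apply: filterS H0 => y /(_ I) [] /powR_eq0_eq0.
apply: fn0; apply: filterS2 fg g00 => y -> ->; exact.
Qed.

Lemma compact_support_bounded g r : 0 < r -> (forall y, r < enorm y -> g y = 0) ->
  compact_support (n := k.+1) g.
Proof.
move=> r0 gr; pose K : set Y := [set v | forall i, v ord0 i \in `[- r, r]].
have cK : compact K.
  have := @rV_compact R k (fun=> `[- r, r]%classic) (fun=> @segment_compact R _ _).
  exact.
have clK : closed K by apply: compact_closed cK; exact: norm_hausdorff.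
apply: (subclosed_compact (@closed_closure _ _) cK).
rewrite [K](closure_id _).1//; apply: closure_subset => y /= yn0.
have yr : enorm y <= r by rewrite leNgt; apply: contra yn0 => /gr ->.
exact: enorm_cube yr.
Qed.

End interface.

Lemma ler_of_cross (R : realDomainType) (C x y z t : R) :
  0 < y -> C * y = z -> z * x <= t * y -> C * x <= t.
Proof. by move=> y0 <-; rewrite mulrAC ler_pM2r. Qed.

Theorem theorem1p8 (R : realType) (n : nat) (alpha t t' q : R)
    (hn : (2 <= n)%N) (halpha : n%:R < alpha)
    (ht : n%:R / alpha < t) (ht1 : t < 1) (hq : 1 < q)
    (ht' : 1 / t + 1 / t' = 1) :
  1 < gammat n alpha q t' /\
  exists C : R,
    [/\ 0 < C,
        sharp_constant n alpha q t' C &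
        exists f : 'rV[R]_n.-1 -> R,
          [/\ admissible q f,
              radially_nonincreasing f,
              exists M : R, forall y, f y <= M,
              compact_support f &
              lhs alpha q t' f = rhs alpha q t' C f]].
Proof.
case: n hn halpha ht => [|k]// k0 halpha ht.
have n0 : 0 < k.+1%:R :> R by rewrite ltr0n.
have a0 : 0 < alpha by exact: lt_trans halpha.
have t0 : 0 < t by apply: lt_trans ht; rewrite divr_gt0.
have t'E : 1 / t' = 1 - 1 / t by rewrite -[X in X - _]ht' addrAC subrr add0r.
have it : 1 < 1 / t by rewrite ltr_pdivlMr// mul1r.
have t'0 : t' < 0 by rewrite -invr_lt0 -[ltLHS]mul1r t'E subr_lt0.
have b0 : 0 < alpha - k.+1%:R by rewrite subr_gt0.
have s0 : 0 < - t' by rewrite oppr_gt0.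
(* As [1 / t' = 1 - 1 / t], this amounts to [n / t < alpha], the lower bound assumed on [t]. *)
have bs : k.+1%:R < (alpha - k.+1%:R) * - t'.
  rewrite -ltr_pdivrMr//.
  have -> : k.+1%:R / - t' = k.+1%:R * (1 / t - 1).
    by rewrite invrN -[t'^-1]mul1r t'E opprB.
  rewrite mulrBr mulr1 ltrD2r mulrA mulr1 ltr_pdivrMr//.
  by move: ht; rewrite ltr_pdivrMr// mulrC.
split; first exact: gammat_gt1.
have [f0 [[gf0 f01] rad0 [r r0 sup0] ineq]] := extremal_exists b0 s0 bs k0 hq.
have Q0fin := powmass_fin_num hq (conj gf0 f01).
have Q0oo : (powmass q f0 < +oo)%E by rewrite -ge0_fin_numE// powmass_ge0.
have M0 := fine_mass_gt0 gf0.
have N0 := nrm_gt0 b0 s0 bs k0 gf0.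
have Q0 : 0 < fine (powmass q f0) by rewrite fine_gt0// Q0oo (powmass_gt0 q gf0).
rewrite -(gammatE alpha s0 k0 hq) in ineq.
set gam := gammat k.+1 alpha q t' in ineq *.
have Mg0 : 0 < fine (mass f0) `^ gam by exact: powR_gt0.
set del := _ / _ in ineq.
(* The value of the quotient at the extremal function: equality at [f0] is built in, and testing any
   valid constant on [f0] shows that none is larger. *)
pose C := nrm (alpha - k.+1%:R) (- t') f0 * fine (powmass q f0) `^ del / fine (mass f0) `^ gam.
have C0 : 0 < C := divr_gt0 (mulr_gt0 N0 (powR_gt0 _ Q0)) Mg0.
have CE : C * fine (mass f0) `^ gam =
    nrm (alpha - k.+1%:R) (- t') f0 * fine (powmass q f0) `^ del.
  by apply: divfK; rewrite gt_eqF.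
have EL g (gg : good (alpha - k.+1%:R) g) Qg := lhsE b0 s0 bs k0 hq gg Qg.
have ER K g (gg : good (alpha - k.+1%:R) g) := rhsE s0 bs k0 hq K gg.
have Eq : lhs (n := k.+1) alpha q t' f0 = rhs (n := k.+1) alpha q t' C f0.
  by rewrite (EL _ gf0 Q0oo) (ER _ _ gf0) CE.
exists C; split; [exact: C0|split=> [|C' VC']|].
- apply: (valid_of_good b0 s0 bs k0 hq) => g gg Qg; rewrite (EL _ gg Qg) (ER _ _ gg) lee_fin.
  exact: (ler_of_cross Mg0 CE (ineq g gg Qg)).
- have := VC' f0 (admissible_good hq gf0 Q0oo); rewrite Eq !(ER _ _ gf0) lee_fin.
  by rewrite ler_pM2r.
exists f0; split.
- exact: (admissible_good hq gf0 Q0oo).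
- exact: rad0.
- by exists 1; exact: f01.
- exact: (compact_support_bounded r0 sup0).
- exact: Eq.
Qed.
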